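(* Let $\eta$ be a proper Poisson process on a measurable space $(\mathcal{X},\mathcal{B})$ with $\sigma$-finite intensity measure $\lambda$ (see context). For any measurable $F\colon\mathcal{N}\to\mathbb{R}$ and any $r\ge2$, $$\|F-\mathbb{E}F\|_r\le D\sqrt r\,\Bigl\|\Bigl(\int_{\mathcal{X}}(D_x^+F)^2\,\lambda(dx)+\int_{\mathcal{X}}(D_x^-F)^2\,\eta(dx)\Bigr)^{1/2}\Bigr\|_r$$ and $$\|(F-\mathbb{E}F)_+\|_r\le D\sqrt r\,\Bigl\|\Bigl(\int_{\mathcal{X}}(D_x^+F)_-^2\,\lambda(dx)+\int_{\mathcal{X}}(D_x^-F)_+^2\,\eta(dx)\Bigr)^{1/2}\Bigr\|_r,$$ where $D=\sqrt{3\frac{\sqrt e}{\sqrt e-1}}$.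
   Context: $\mathcal{N}$ is the space of all $\mathbb{N}\cup\{\infty\}$-valued measures on $(\mathcal{X},\mathcal{B})$ which are countable sums of $\mathbb{N}$-valued measures, with the smallest $\sigma$-field making all maps $\mu\mapsto\mu(B)$, $B\in\mathcal{B}$, measurable. $\eta$ is an $\mathcal{N}$-valued random variable such that $\eta(B)$ is Poisson with parameter $\lambda(B)$ for each $B\in\mathcal{B}$ (Dirac mass at $\lambda(B)$ if $\lambda(B)\in\{0,\infty\}$) and $\eta(B_1),\dots,\eta(B_m)$ are independent for pairwise disjoint $B_1,\dots,B_m$. Proper means $\eta=\sum_{i=1}^{\kappa}\delta_{X_i}$ for a random $\kappa\le\infty$ and $\mathcal{X}$-valued random variables $X_i$. (One fixes sets $\mathcal{X}_n\subseteq\mathcal{X}$ of finite $\lambda$-measure with $\bigcup_n\mathcal{X}_n=\mathcal{X}$ and assumes, as one may, that $\eta(\mathcal{X}_n)<\infty$ for all $n$.) $D_x^+F(\eta)=F(\eta+\delta_x)-F(\eta)$; $D_x^-F(\eta)=F(\eta)-F(\eta-\delta_x)$ if $\eta\ge\delta_x$ and $D_x^-F=0$ otherwise. $F$ stands for $F(\eta)$, $\|Y\|_r=(\mathbb{E}|Y|^r)^{1/r}$, $t_+=\max(t,0)$, $t_-=\max(-t,0)$. Convention: an estimate $A\le B$ means ''if $B<\infty$, then $A$ is well-defined and the inequality holds''. *)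

(* Defs.v *)
From HB Require Import structures.
From mathcomp Require Import all_boot all_order all_algebra.
From mathcomp Require Import all_classical all_reals all_analysis.
From mathcomp Require Import measurable_realfun.
Set Implicit Arguments.
Unset Strict Implicit.
Unset Printing Implicit Defensive.
Import Order.TTheory GRing.Theory Num.Theory.
Import numFieldNormedType.Exports.
Local Open Scope classical_set_scope.
Local Open Scope ring_scope.
Local Open Scope ereal_scope.

Section configurations.
Context d (X : measurableType d) (R : realType).
Implicit Types (mu : {measure set X -> \bar R}) (x : X).

Definition natural_number (a : \bar R) : Prop := exists n : nat, a = n%:R%:E.

Definition extended_natural (a : \bar R) : Prop := a = +oo \/ natural_number a.

(* Library measures take (irrelevant) values on non-measurable sets too, so
   all conditions are restricted to measurable sets. A finite sum is a
   countable one padded with zero measures. *)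
Definition counting_like mu : Prop :=
  (forall B, measurable B -> extended_natural (mu B)) /\
  exists m : nat -> {measure set X -> \bar R},
    (forall i B, measurable B -> natural_number (m i B)) /\
    (forall B, measurable B -> mu B = \sum_(i <oo) m i B).

Record config : Type := Config {
  config_measure :> {measure set X -> \bar R} ;
  configP : counting_like config_measure }.

Let counting_like0 : counting_like (@mzero _ X R).
Proof.
split=> [B _|]; first by right; exists 0%N.
exists (fun=> @mzero _ X R); split=> [_ B _|B _]; first by exists 0%N.
by rewrite eseries0.
Qed.

HB.instance Definition _ := gen_eqMixin config.
HB.instance Definition _ := gen_choiceMixin config.
HB.instance Definition _ := isPointed.Build config (Config counting_like0).

Definition config_ev (B : set X) (mu : config) : \bar R := mu B.

(* The smallest sigma-field making every evaluation mu |-> mu B measurable. *)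
Definition config_generator : set (set config) :=
  \bigcup_(B in measurable)
    preimage_set_system [set: config] (config_ev B) (@measurable _ (\bar R)).

HB.instance Definition _ := @isMeasurable.Build
  (sigma_display config_generator) config <<s config_generator >>
  (@sigma_algebra0 _ setT config_generator)
  (@sigma_algebraC _ config_generator)
  (@sigma_algebra_bigcup _ setT config_generator).

Lemma measurable_config_ev (B : set X) : measurable B ->
  measurable_fun [set: config] (config_ev B).
Proof.
move=> mB; apply: (@measurability _ _ config _ setT (config_ev B)
  (@measurable _ (\bar R))).
  by rewrite smallest_id//; exact: sigma_algebra_measurable.
apply: subset_trans; last exact: sub_gen_smallest.
exact: (bigcup_sup mB).
Qed.

Lemma natural_dirac x (B : set X) : natural_number (\d_x B).
Proof. by rewrite diracE; exists (x \in B). Qed.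

Let counting_like_add (mu : config) x : counting_like (measure_add mu \d_x).
Proof.
case: (configP mu) => mu_nat [m [m_nat muE]]; split=> [B mB|].
  rewrite [X in extended_natural X](measure_addE mu \d_x) /=; have [k ->] := natural_dirac x B.
  have [->|[n ->]] := mu_nat _ mB; first by left; rewrite addye.
  by right; exists (n + k)%N; rewrite natrD.
pose m' i : {measure set X -> \bar R} := if i is j.+1 then m j else \d_x.
exists m'; split=> [[|i] B mB|B mB].
- exact: natural_dirac.
- exact: m_nat.
rewrite [LHS](measure_addE mu \d_x) muE// [RHS]nneseries_recl// addeC.
rewrite -(nneseries_addn (f := m' ^~ B) 1)//; congr (_ + _).
by apply: eq_eseriesr => i _; rewrite addn1.
Qed.

Definition add_point (mu : config) x : config := Config (counting_like_add mu x).

Definition dirac_le x mu : Prop :=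
  forall B, measurable B -> (\d_x : set X -> \bar R) B <= mu B.

(* mu - \d_x: on measurable sets the maximum is redundant (see remE); elsewhere
   it enforces the nonnegativity that the library asks of measures. *)
Definition rem mu x (h : dirac_le x mu) : set X -> \bar R :=
  fun B => maxe (mu B - \d_x B) 0.

Lemma remE mu x (h : dirac_le x mu) (B : set X) : measurable B ->
  rem h B = mu B - \d_x B.
Proof.
by move=> mB; rewrite /rem; apply/max_idPl; rewrite sube_ge0 ?h// diracE.
Qed.

Section rem_measure.
Variables (mu : {measure set X -> \bar R}) (x : X) (h : dirac_le x mu).

Let rem0 : rem h set0 = 0.
Proof. by rewrite remE// !measure0 sube0. Qed.

Let rem_ge0 B : 0 <= rem h B.
Proof. by rewrite /rem le_max lexx orbT. Qed.

Let rem_sigma_additive : semi_sigma_additive (rem h).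
Proof.
move=> F mF tF mUF; rewrite remE//.
have fd (B : set X) : (\d_x B : \bar R) \is a fin_num by rewrite diracE.
rewrite (_ : (fun n => _) = (fun n => \sum_(0 <= i < n) mu (F i)) \-
                            (fun n => \sum_(0 <= i < n) \d_x (F i))); last first.
  apply/funext => n /=; rewrite -fin_num_sumeN// -big_split/=.
  by apply: eq_bigr => i _; rewrite remE.
apply: cvgeB; first by rewrite fin_num_adde_defl// fin_numN.
- exact: measure_semi_sigma_additive.
- exact: measure_semi_sigma_additive.
Qed.

HB.instance Definition _ := isMeasure.Build _ X R (rem h)
  rem0 rem_ge0 rem_sigma_additive.

End rem_measure.

Lemma natural_sub_dirac mu x (h : dirac_le x mu) (B : set X) :
  measurable B -> natural_number (mu B) -> natural_number (rem h B).
Proof.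
move=> mB [n muB]; have := h _ mB; rewrite remE// muB.
have [k ->] := natural_dirac x B; rewrite lee_fin ler_nat => kn.
by exists (n - k)%N; rewrite natrB// EFinB.
Qed.

Let counting_like_rem (mu : config) x (h : dirac_le x mu) :
  counting_like (rem h).
Proof.
case: (configP mu) => mu_nat [m [m_nat muE]]; split=> [B mB|].
  have [muB|?] := mu_nat _ mB; last by right; exact: natural_sub_dirac.
  by left; rewrite [LHS](remE h mB) muB; have [k ->] := natural_dirac x B.
have [i hi] : exists i, dirac_le x (m i).
  apply: contrapT => /forallNP noi.
  have /choice[B BP] : forall i, exists B, [/\ measurable B, B x & m i B = 0].
    move=> i; have /existsNP[B /not_implyP[mB]] := noi i.
    move=> /negP; rewrite -ltNge => miB; exists B.
    have Bx : B x.
      apply: contrapT => nBx; move: miB.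
      by rewrite diracE memNset// ltNge measure_ge0.
    split => //; have [n mn] := m_nat i B mB; move: miB.
    rewrite mn diracE mem_set// lte_fin ltr_nat ltnS leqn0 => /eqP ->.
    by [].
  have mBB : measurable (\bigcap_i B i).
    by apply: bigcap_measurable => // i _; case: (BP i).
  have := h _ mBB.
  rewrite muE// eseries0; last first.
    move=> i _ _; have [mB _ mB0] := BP i.
    apply/eqP; rewrite eq_le measure_ge0 andbT -mB0.
    by apply: le_measure; rewrite ?inE//; exact: bigcap_inf.
  rewrite diracE mem_set ?lee_fin ?ler10// => i _.
  by case: (BP i).
pose mi' : {measure set X -> \bar R} := rem hi.
pose m' j := if j == i then mi' else m j.
exists m'; split=> [j B mB|B mB].
  rewrite /m'; case: ifPn => _; last exact: m_nat.
  exact: natural_sub_dirac (m_nat _ _ _).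
rewrite [LHS](remE h mB) muE//.
rewrite [in LHS](nneseriesD1 (n := i) (P := xpredT))//.
rewrite [RHS](nneseriesD1 (n := i) (P := xpredT))//=.
rewrite {1}/m' eqxx [mi' B](remE hi mB) addeAC; congr (_ + _).
rewrite [LHS]eseries_mkcond [RHS]eseries_mkcond; apply: eq_eseriesr => j _.
by rewrite /m'; case: (eqVneq j i).
Qed.

Definition remove_point (mu : config) x (h : dirac_le x mu) : config :=
  Config (counting_like_rem h).

End configurations.

Section difference_operators.
Context d (X : measurableType d) (R : realType).
Implicit Types (F : config X R -> R) (x : X) (mu : config X R).

Definition diff_add F x mu : R := (F (add_point mu x) - F mu)%R.

Definition diff_rem F x mu : R :=
  match pselect (dirac_le x mu) with
  | left h => (F mu - F (remove_point h))%R
  | right _ => 0%R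
  end.

End difference_operators.

Section poisson_process.
Context dO (Omega : measurableType dO) d (X : measurableType d) (R : realType).
Variable P : probability Omega R.

Definition independent_variables (m : nat) (Y : 'I_m -> Omega -> \bar R) : Prop :=
  forall U : 'I_m -> set (\bar R), (forall i, measurable (U i)) ->
    P (\bigcap_i (Y i @^-1` U i)) = \prod_(i < m) P (Y i @^-1` U i).

(* poisson_prob takes a dummy second argument, and poisson_prob 0 is the Dirac
   mass at 0. *)
Definition poisson_process (lambda : {measure set X -> \bar R})
    (eta : Omega -> config X R) : Prop :=
  [/\ measurable_fun setT eta,
      forall B, measurable B -> lambda B < +oo ->
        forall n : nat, P [set w | eta w B = n%:R%:E] =
          poisson_prob (fine (lambda B)) 0 [set n],
      forall B, measurable B -> lambda B = +oo ->
        P [set w | eta w B = +oo] = 1 &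
      forall (m : nat) (B : 'I_m -> set X),
        (forall i, measurable (B i)) -> trivIset setT B ->
        independent_variables (fun i w => eta w (B i))].

(* The points are numbered from 0, so that eta is the sum of the Dirac masses
   at Z i for i < kappa. *)
Definition proper_representation (eta : Omega -> config X R)
    (kappa : Omega -> \bar R) (Z : nat -> Omega -> X) : Prop :=
  [/\ measurable_fun setT kappa,
      forall w, extended_natural (kappa w),
      forall i, measurable_fun setT (Z i) &
      {ae P, forall w, forall B, measurable B ->
        eta w B = \sum_(i <oo | i%:R%:E < kappa w) \d_(Z i w) B}].

End poisson_process.

Section points_integral.
Context d (X : measurableType d) (R : realType).

(* Integral of g >= 0 against the sum of the Dirac masses at z i for i < k.
   It is the Lebesgue integral when g is measurable (see points_integralE),
   but it also makes sense for functions such as x |-> diff_rem F x mu, which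
   need not be measurable when the sigma-field of X is not countably generated;
   the Lebesgue integral of the library would then be a lower integral. *)
Definition points_integral (k : \bar R) (z : nat -> X) (g : X -> \bar R) :=
  \sum_(i <oo | i%:R%:E < k) g (z i).

Lemma points_integralE (mu : {measure set X -> \bar R}) (k : \bar R)
    (z : nat -> X) (g : X -> \bar R) :
  (forall B, measurable B -> mu B = \sum_(i <oo | i%:R%:E < k) \d_(z i) B) ->
  measurable_fun setT g -> (forall x, 0 <= g x) ->
  \int[mu]_x g x = points_integral k z g.
Proof.
move=> muE mg g0.
pose dz i : {measure set X -> \bar R} := \d_(z i).
pose m i := if i%:R%:E < k then dz i else mzero.
rewrite (eq_measure_integral (mseries m 0)); last first.
  move=> B mB _; rewrite muE// /mseries [LHS]eseries_mkcond.
  by apply: eq_eseriesr => i _; rewrite /m; case: ifP.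
rewrite ge0_integral_measure_series// /points_integral [RHS]eseries_mkcond.
apply: eq_eseriesr => i _; rewrite /m; case: ifP => _.
  by rewrite integral_dirac// diracE mem_set// mul1e.
by rewrite integral_measure_zero.
Qed.

End points_integral.

Definition moment_constant (R : realType) : R :=
  Num.sqrt (3 * (Num.sqrt (expR 1) / (Num.sqrt (expR 1) - 1))).

(* Main.v *)
(** Adding the points of a set [A] of finite intensity one at a time, as small
independent Bernoulli experiments, and passing to the Poisson limit yields a
Beckner inequality: for [1 < p <= 2] the increase of [x ^ p] under averaging
over a Poisson process is at most the mean of
[int (b ^ p - a ^ p - p a ^ (p - 1) (b - a)) lambda(dx)], where [a = g(eta)] and
[b = g(eta + delta_x)]; each step uses the joint convexity of this Bregman
divergence. Functions of the points in [A] are dense in L^1 as [A] exhausts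
the space, so that the inequality holds for [eta] itself. With
[p = q / (q - 1)] and [g = G ^ (q - 1)] the divergence is at most
[q max(s, t) ^ (q - 2) (s - t) ^ 2], where [s = G(eta + delta_x)] and
[t = G(eta)], and the Mecke formula turns its part with [s > t] into a sum over
the points of [eta]; hence
[E G ^ q <= (E G ^ (q - 1)) ^ (q / (q - 1)) + q E (G ^ (q - 2) V_+)],
with [V_+] the expression under the root in the second inequality.
For [G] the maximum of [F - E F] and a small constant, induction from [q - 1] to
[q], with Young's inequality, gives the moment bound for bounded [F]; truncation
removes boundedness. The first inequality follows from the second one for [F] and
[- F]. *)
Require Import Defs.
From HB Require Import structures.
From mathcomp Require Import all_boot all_order all_algebra.
From mathcomp Require Import all_classical all_reals all_analysis.
From mathcomp Require Import measurable_realfun.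
From mathcomp Require Import ring lra.
Set Implicit Arguments.
Unset Strict Implicit.
Unset Printing Implicit Defensive.
Import Order.TTheory GRing.Theory Num.Theory.
Import numFieldNormedType.Exports.
Local Open Scope classical_set_scope.
Local Open Scope ring_scope.
Local Open Scope ereal_scope.

(** Two obstacles shape the proof. When the sigma-field of [X] is not countably generated, functions
    built from [eta - delta_x] need not be measurable; points are therefore removed by their index
    in the proper representation, and [diff_rem] enters only through an almost sure identity with
    something measurable. Moreover [F] is not assumed integrable: the existence of [E F] has to be
    extracted from the finiteness of the right-hand side. The constant satisfies
    [D ^ 2 = 3 / (1 - e ^ (-1/2))]. Let [v] bound the norm of [V_+] of order [r / 2]. The recursion
    at [q = 2] is a Poincare inequality and bounds the variance by [2 v]; the constant in [G] is the
    square root of [v] and adds another [v] to the second moment, whence the [3]. The other factor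
    comes from [(1 - 1/q) ^ (q/2) <= e ^ (-1/2)], which measures the gain when the bound for [q - 1]
    is inserted into the recursion for [q]. That constant also keeps [G] away from zero, where the
    negative powers in the second derivatives of the divergence would be singular. *)

Lemma le_of_eq disp (T : porderType disp) (x y : T) : x = y -> (x <= y)%O.
Proof. by move->. Qed.

Lemma integral_probability_cst d (T : measurableType d) (R : realType)
    (P : probability T R) (r : R) : \int[P]_t r%:E = r%:E.
Proof. by rewrite integral_cst// [X in _ * X]probability_setT mule1. Qed.

(** * Measurability in the space of configurations *)

Section configuration_space.
Context d (X : measurableType d) (R : realType).
Notation C := (config X R).

Lemma measurable_fun_config dT (T : measurableType dT) (f : T -> C) :
  (forall B, measurable B -> measurable_fun setT (fun t => f t B)) ->
  measurable_fun setT f.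
Proof.
move=> mf; apply: (@measurability _ _ _ _ setT f (@config_generator d X R)) => //.
move=> _ [_ [B mB [U mU <-]] <-]; rewrite setTI -[X in measurable X]setTI.
by have := mf _ mB measurableT _ mU; rewrite !setTI.
Qed.

(** Configurations may still differ on non-measurable sets, so this relation stands in for equality;
    measurable functions into spaces with measurable points cannot see the difference. *)
Definition config_eq (mu nu : C) := forall B, measurable B -> mu B = nu B.

(** The sets that do not separate [mu] from [nu] form a sigma-field, and it contains the
    generators. *)
Lemma config_eq_set (mu nu : C) (S : set C) : config_eq mu nu -> measurable S ->
  S mu -> S nu.
Proof.
move=> mn mS.
suff : <<s @config_generator d X R>> `<=` [set S | S mu <-> S nu].
  by move=> /(_ _ mS) /= [].
apply: smallest_sub; first split => [|A /= AA|A /= AA].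
- by split.
- by split=> -[_ nA]; split=> // /AA.
- by split=> -[i _ Ai]; exists i => //; apply/AA.
move=> _ [B mB [U mU <-]] /=.
by rewrite /config_ev/= mn.
Qed.

Lemma config_eq_fun dT (T : measurableType dT) (F : C -> T) (mu nu : C) :
  measurable_fun setT F -> (forall t : T, measurable [set t]) ->
  config_eq mu nu -> F mu = F nu.
Proof.
move=> mF m1 mn; apply/esym.
have := @config_eq_set mu nu (F @^-1` [set F mu]) mn; apply=> //.
by rewrite -[X in measurable X]setTI; exact: mF.
Qed.

Lemma measurable_add_point :
  measurable_fun setT (fun z : X * C => add_point z.2 z.1).
Proof.
apply: measurable_fun_config => B mB.
rewrite (_ : (fun _ => _) = (fun z : X * C => config_ev B z.2 + \d_(z.1) B)); last first.
  by apply/funext => z; rewrite [LHS](measure_addE z.2 \d_(z.1)).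
apply: emeasurable_funD.
  by apply: measurableT_comp; [exact: measurable_config_ev|exact: measurable_snd].
under eq_fun do rewrite diracE.
have -> : (fun z : X * C => ((z.1 \in B)%:R : R)%:E) = EFin \o (\1_B \o fst).
  by apply/funext=> z /=; rewrite indicE.
apply/measurable_EFinP/measurableT_comp; last exact: measurable_fst.
exact: measurable_indic.
Qed.

Lemma add_pointE (mu : C) x B : add_point mu x B = mu B + \d_x B.
Proof. exact: (measure_addE mu \d_x). Qed.

Definition points_measure (D : pred nat) (z : nat -> X) (i : nat) :
    {measure set X -> \bar R} :=
  if D i then (\d_(z i) : {measure set X -> \bar R}) else mzero.

Lemma counting_like_points (D : pred nat) (z : nat -> X) :
  counting_like (mseries (points_measure D z) 0).
Proof.
have nat_m i B : measurable B -> natural_number (points_measure D z i B).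
  rewrite /points_measure; case: ifP => _ mB; first exact: natural_dirac.
  by exists 0%N.
split=> [B mB|]; last by exists (points_measure D z).
have /choice[n nE] i := nat_m i B mB.
rewrite [X in extended_natural X](_ : _ = \sum_(i <oo) (n i)%:R%:E); last first.
  by apply: eq_eseriesr => i _; exact: nE.
(* Either all but finitely many terms vanish and the sum is a natural number, or the partial sums,
   being integers, exceed every bound. *)
have [Hn|Hn] := boolP `[< exists N, forall i, (N <= i)%N -> n i = 0%N >].
  have /asboolP[N HN] := Hn; right; exists (\sum_(0 <= i < N) n i)%N.
  rewrite (nneseries_split 0 N)//.
  rewrite eseries0 ?adde0; last by move=> i Ni _; rewrite HN.
  by rewrite add0n sumEFin natr_sum.
left; apply/eqyP => _/posnumP[e].
move: Hn => /asboolPn/forallNP Hn.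
have H M : exists N, (M <= \sum_(0 <= i < N) n i)%N.
  elim: M => [|M [N HM]]; first by exists 0%N.
  have /existsNP[i /not_implyP[Ni /eqP ni]] := Hn N.
  exists i.+1; rewrite big_nat_recr//= (big_cat_nat _ (n := N))//=.
  move: ni; rewrite -lt0n => ni.
  by rewrite -addn1 leq_add// (leq_trans HM)// leq_addr.
have [N HN] := H (Num.truncn e%:num).+1.
apply: (@le_trans _ _ (\sum_(0 <= i < N) (n i)%:R%:E)); last first.
  by apply: (nneseries_lim_ge N) => i _ _; rewrite lee_fin.
rewrite sumEFin lee_fin -natr_sum (@le_trans _ _ (Num.truncn e%:num).+1%:R)//.
  by rewrite ltW// truncnS_gt.
by rewrite ler_nat.
Qed.

Definition points (D : pred nat) (z : nat -> X) : C := Config (counting_like_points D z).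

Lemma pointsE D z B : points D z B = \sum_(i <oo | D i) \d_(z i) B.
Proof.
rewrite [LHS]/= /mseries [RHS]eseries_mkcond; apply: eq_eseriesr => i _.
by rewrite /points_measure; case: ifP.
Qed.

End configuration_space.

(** * The Mecke formula *)

Section image_measure.
Context d d' (T1 : measurableType d) (T2 : measurableType d') (R : realType).
Variables (m : {measure set T1 -> \bar R}) (f : T1 -> T2).
Hypothesis mf : measurable_fun setT f.

Definition image_measure : {measure set T2 -> \bar R} :=
  measure_function_pushforward__canonical__measure_function_Measure m mf.

Lemma image_measureE A : image_measure A = m (f @^-1` A).
Proof. by []. Qed.

Lemma ge0_integral_image_measure (g : T2 -> \bar R) : measurable_fun setT g ->
  (forall y, 0 <= g y) -> \int[image_measure]_y g y = \int[m]_x g (f x).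
Proof.
move=> mg g0; have := @ge0_integral_pushforward _ _ _ _ _ _ mf m setT g measurableT mg.
by rewrite preimage_setT; apply=> y _.
Qed.

End image_measure.

Section poisson_probability.
Variable R : realType.

(** Size-biasing a Poisson count and then removing one point gives the same law back: this is the
    Mecke formula for a single cell. *)
Lemma poisson_prob_recurrence (c : R) (n : nat) : (0 <= c)%R ->
  n.+1%:R%:E * poisson_prob c 0 [set n.+1] = c%:E * poisson_prob c 0 [set n].
Proof.
move=> c0; rewrite /poisson_prob; case: ifPn => [c_gt0|].
  rewrite !esum_set1 ?lee_fin ?poisson_pmf_ge0// /poisson_pmf c_gt0 -!EFinM.
  congr EFin; rewrite factS natrM exprS; field.
  by rewrite pnatr_eq0 -lt0n fact_gt0 nat1r pnatr_eq0.
rewrite -leNgt => cle0; have -> : c = 0%R by apply/eqP; rewrite eq_le cle0.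
by rewrite mul0e diracE memNset ?mule0.
Qed.

Lemma poisson_prob_set0 (c : R) : (0 <= c)%R ->
  poisson_prob c 0 [set 0%N] = (expR (- c))%:E.
Proof.
move=> c0; rewrite /poisson_prob; case: ifPn => [c_gt0|].
  rewrite esum_set1 ?lee_fin ?poisson_pmf_ge0// /poisson_pmf c_gt0.
  by rewrite expr0 fact0 divr1 mul1r.
rewrite -leNgt => cle0; have -> : c = 0%R by apply/eqP; rewrite eq_le cle0.
by rewrite oppr0 expR0 diracE mem_set.
Qed.

End poisson_probability.

Section poisson_counts.
Context d (X : measurableType d) (R : realType) dO (Omega : measurableType dO).
Variables (P : probability Omega R) (lambda : {measure set X -> \bar R}).
Variable eta : Omega -> config X R.
Hypothesis eta_poisson : poisson_process P lambda eta.

Lemma measurable_count (B : set X) : measurable B ->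
  measurable_fun setT (fun w => eta w B).
Proof.
move=> mB; apply: (@measurableT_comp _ _ _ _ _ _ (config_ev B)).
  exact: measurable_config_ev.
by case: eta_poisson.
Qed.

Lemma measurable_count_eq (B : set X) (a : \bar R) : measurable B ->
  measurable [set w | eta w B = a].
Proof.
move=> mB; rewrite -[X in measurable X]setTI.
exact: (measurable_count mB measurableT (emeasurable_set1 a)).
Qed.

Lemma poisson_count (B : set X) (n : nat) : measurable B -> lambda B < +oo ->
  P [set w | eta w B = n%:R%:E] = poisson_prob (fine (lambda B)) 0 [set n].
Proof. by move=> mB Boo; case: eta_poisson => _ + _ _; apply. Qed.

(** The finite values already exhaust the mass, since the Poisson weights sum to one. *)
Lemma poisson_count_pinfty (B : set X) : measurable B -> lambda B < +oo ->
  P [set w | eta w B = +oo] = 0.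
Proof.
move=> mB Boo; have mn (n : nat) := measurable_count_eq n%:R%:E mB.
have -> : [set w | eta w B = +oo] = ~` \bigcup_n [set w | eta w B = n%:R%:E].
  apply/seteqP; split=> w /=; first by move=> wE [n _ /=]; rewrite wE.
  move=> nw; have [//|[n wn]] := (configP (eta w)).1 _ mB.
  by exfalso; apply: nw; exists n.
rewrite probability_setC//; last exact: bigcupT_measurable.
rewrite (_ : P _ = 1) ?subee// measure_semi_bigcup//; last 2 first.
- move=> i j _ _ [w [/= -> []]] /eqP.
  by rewrite eqr_nat => /eqP.
- exact: bigcupT_measurable.
rewrite -(@probability_setT _ _ _ (poisson_prob (fine (lambda B)) 0)).
have -> : [set: nat] = \bigcup_n [set n] by apply/seteqP; split=> // n _; exists n.
rewrite measure_semi_bigcup//; last by move=> i j _ _ [w [/= -> ->]].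
by apply: eq_eseriesr => n _; exact: poisson_count.
Qed.

Lemma independent_counts (T : finType) (B : T -> set X) (U : T -> set (\bar R)) :
  (forall t, measurable (B t)) -> trivIset setT B -> (forall t, measurable (U t)) ->
  P [set w | forall t, U t (eta w (B t))] = \prod_t P [set w | U t (eta w (B t))].
Proof.
move=> mB tB mU; have [_ _ _ ind] := eta_poisson.
rewrite (big_enum_val (A := predT) (fun t => P [set w | U t (eta w (B t))])).
rewrite -(ind #|T| (fun i => B (enum_val i)) _ _ (fun i => U (enum_val i)))//; last first.
  move=> i j _ _ [x [Bi Bj]]; apply: enum_val_inj; apply: tB => //.
  by exists x.
congr (P _); apply/seteqP; split=> w /= H; first by move=> i _; exact: H.
by move=> t; have := H (enum_rank t) I; rewrite /= enum_rankK.
Qed.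

End poisson_counts.

Section cells.
Context d (X : measurableType d) (R : realType).
Variables (T : finType) (l : X -> T).
Hypothesis ml : forall t, measurable (l @^-1` [set t]).

(** Coding an infinite count by [None] makes the vectors of counts a countable type, so that events
    about finitely many cells are countable unions of events [cell_event]. *)
Definition count_value (o : option nat) : \bar R :=
  if o is Some n then n%:R%:E else +oo.

Definition cell_event (n : {ffun T -> option nat}) : set (config X R) :=
  [set mu | forall t, mu (l @^-1` [set t]) = count_value (n t)].

Lemma count_value_inj : injective count_value.
Proof. by move=> [m|] [n|] // [] /eqP; rewrite eqr_nat => /eqP ->. Qed.

Lemma count_value_ge0 o : 0 <= count_value o.
Proof. by case: o => [n|] //=; rewrite lee_fin. Qed.

Lemma count_value_succ o : count_value (omap succn o) = count_value o + 1.
Proof. by case: o => [n|] //=; rewrite -EFinD natr1. Qed.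

Lemma measurable_cell_event n : measurable (cell_event n).
Proof.
have -> : cell_event n =
    \bigcap_(t in [set: T]) (config_ev (l @^-1` [set t]) @^-1` [set count_value (n t)]).
  by apply/seteqP; split=> mu /= H t => [_|]; exact: H.
apply: fin_bigcap_measurable => // t _.
by rewrite -[X in measurable X]setTI; apply: measurable_config_ev.
Qed.

Lemma trivIset_cell_event : trivIset setT cell_event.
Proof.
move=> m n _ _ [mu [/= Hm Hn]]; apply/ffunP => t.
by apply: count_value_inj; rewrite -Hm -Hn.
Qed.

Lemma cell_event_cover (mu : config X R) : exists n, cell_event n mu.
Proof.
have /choice[n Hn] : forall t, exists o, mu (l @^-1` [set t]) = count_value o.
  by move=> t; have [->|[n ->]] := (configP mu).1 _ (ml t); [exists None|exists (Some n)].
by exists (finfun n) => t; rewrite ffunE.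
Qed.

Lemma measure_cells (mu : {measure set X -> \bar R}) (A : set X) : measurable A ->
  mu A = \sum_t mu (A `&` l @^-1` [set t]).
Proof.
move=> mA; rewrite -[in LHS](setIT A) -(preimage_setT l).
have -> : [set: T] = \bigcup_(t in [set: T]) [set t].
  by apply/seteqP; split=> // t _; exists t.
rewrite preimage_bigcup setI_bigcupr measure_fin_bigcup//.
- have -> : [set: T] = [set` index_enum T].
    by apply/seteqP; split=> // t _ /=; exact: mem_index_enum.
  by rewrite -fsbig_seq// index_enum_uniq.
- exact: finite_finset.
- by move=> s t _ _ [x [[_ /= <-] [_ /= <-]]].
- by move=> t _; apply: measurableI.
Qed.

End cells.

(** * A pi-system generating the sigma-field of configurations *)

Section pi_system.
Context d (X : measurableType d) (R : realType).

(** The map [l] labels the cells of a finite measurable partition. The set [D] is arbitrary: the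
    counts take only countably many values, so measurability of the event is automatic. *)
Definition cylinder (S : set (config X R)) : Prop :=
  exists (T : finType) (l : X -> T) (D : set (T -> \bar R)),
    (forall t, measurable (l @^-1` [set t])) /\
    S = [set mu : config X R | D (fun t => mu (l @^-1` [set t]))].

Lemma cylinder_bigcup (T : finType) (l : X -> T) (D : set (T -> \bar R)) :
  (forall t, measurable (l @^-1` [set t])) ->
  [set mu : config X R | D (fun t => mu (l @^-1` [set t]))] =
  \bigcup_(n in [set n : {ffun T -> option nat} | D (fun t => count_value R (n t))])
    cell_event l n.
Proof.
move=> ml; apply/seteqP; split=> mu /=.
  have [n Hn] := cell_event_cover ml mu.
  move=> Dmu; exists n => //=; congr D: Dmu.
  by apply/funext => t; exact: Hn.
move=> [n /= Dn nmu]; congr D: Dn.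
by apply/funext => t; rewrite nmu.
Qed.

Lemma bigcup_countType (I : countType) (T : Type) (D : set I) (F : I -> set T) :
  \bigcup_(i in D) F i =
  \bigcup_n (if pickle_inv n is Some i then if `[< D i >] then F i else set0 else set0).
Proof.
apply/seteqP; split=> [t [i Di Fit]|t [n _]].
  by exists (pickle i) => //; rewrite pickleK_inv; case: asboolP.
by case: pickle_inv => // i; case: asboolP => // Di Fit; exists i.
Qed.

Lemma measurable_bigcup_countType (I : countType) dT (T : measurableType dT)
    (D : set I) (F : I -> set T) : (forall i, measurable (F i)) ->
  measurable (\bigcup_(i in D) F i).
Proof.
move=> mF; rewrite bigcup_countType; apply: bigcupT_measurable => n.
by case: pickle_inv => // i; case: ifP.
Qed.

Lemma measure_eq_bigcup_countType (I : countType) dT (T : measurableType dT)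
    (m1 m2 : {measure set T -> \bar R}) (D : set I) (F : I -> set T) :
  (forall i, measurable (F i)) -> trivIset setT F ->
  (forall i, D i -> m1 (F i) = m2 (F i)) ->
  m1 (\bigcup_(i in D) F i) = m2 (\bigcup_(i in D) F i).
Proof.
move=> mF tF m12; rewrite bigcup_countType.
set G := fun n => _; have mG n : measurable (G n).
  by rewrite /G; case: pickle_inv => // i; case: ifP.
have tG : trivIset setT G.
  move=> a b _ _ [t []]; rewrite /G.
  case Ea : (pickle_inv a) => [i|//]; case Eb : (pickle_inv b) => [j|//].
  case: asboolP => // Di; case: asboolP => // Dj Fi Fj.
  have ij : i = j by apply: tF => //; exists t.
  have := @pickle_invK I a; have := @pickle_invK I b.
  by rewrite Ea Eb /= ij => -> ->.
rewrite !measure_semi_bigcup//; try exact: bigcupT_measurable.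
apply: eq_eseriesr => n _; rewrite /G.
case: pickle_inv => [i|]; last by rewrite !measure0.
by case: asboolP => [Di|]; [exact: m12|rewrite !measure0].
Qed.

Lemma measurable_cylinder S : cylinder S -> measurable S.
Proof.
move=> [T [l [D [ml ->]]]]; rewrite cylinder_bigcup//.
by apply: measurable_bigcup_countType => n; exact: measurable_cell_event.
Qed.

End pi_system.

Section pi_system_generates.
Context d (X : measurableType d) (R : realType).

(** Both events can be read off the common refinement, labelled by pairs, because the coarser counts
    are sums of the finer ones. *)
Lemma cylinderI : setI_closed (@cylinder d X R).
Proof.
move=> _ _ [T1 [l1 [D1 [ml1 ->]]]] [T2 [l2 [D2 [ml2 ->]]]].
pose l x := (l1 x, l2 x).
have lE t1 t2 : l @^-1` [set (t1, t2)] = l1 @^-1` [set t1] `&` l2 @^-1` [set t2].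
  by apply/seteqP; split=> x /= [<- <-].
exists (T1 * T2)%type, l, [set v | D1 (fun t1 => \sum_t2 v (t1, t2)) /\
                             D2 (fun t2 => \sum_t1 v (t1, t2))]; split.
  by move=> [t1 t2]; rewrite lE; exact: measurableI.
apply/seteqP; split=> mu /= [H1 H2]; split.
- congr D1: H1; apply/funext => t1; rewrite (measure_cells ml2)//.
  by apply: eq_bigr => t2 _; rewrite lE.
- congr D2: H2; apply/funext => t2; rewrite (measure_cells ml1)//.
  by apply: eq_bigr => t1 _; rewrite lE setIC.
- congr D1: H1; apply/funext => t1; rewrite [RHS](measure_cells ml2)//.
  by apply: eq_bigr => t2 _; rewrite lE.
- congr D2: H2; apply/funext => t2; rewrite [RHS](measure_cells ml1)//.
  by apply: eq_bigr => t1 _; rewrite lE setIC.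
Qed.

Lemma cylinderT : @cylinder d X R setT.
Proof.
exists unit, (fun=> tt), setT; split; last by apply/seteqP.
by move=> t; rewrite preimage_cst; case: ifP.
Qed.

Lemma measurable_cylinders : @measurable _ (config X R) = <<s @cylinder d X R >>.
Proof.
apply/seteqP; split; last first.
  apply: smallest_sub; first exact: sigma_algebra_measurable.
  exact: measurable_cylinder.
apply: smallest_sub; first exact: smallest_sigma_algebra.
move=> _ [B mB [U mU <-]]; rewrite setTI; apply: sub_gen_smallest.
(* A generator concerns a single set [B], that is, the partition into [B] and its complement. *)
exists bool, (fun x => `[< B x >]), [set v | U (v true)].
have BE : (fun x => `[< B x >]) @^-1` [set true] = B.
  by apply/seteqP; split=> x /= /asboolP.
have BE' : (fun x => `[< B x >]) @^-1` [set false] = ~` B.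
  apply/seteqP; split=> x /=; first by move=> H; apply/asboolPn; rewrite H.
  by move=> /asboolPn/negbTE.
split; last by apply/seteqP; split=> mu /=; rewrite BE.
by case; rewrite ?BE ?BE'//; exact: measurableC.
Qed.

End pi_system_generates.

Section mecke.
Context d (X : measurableType d) (R : realType) dO (Omega : measurableType dO).
Variables (P : probability Omega R).
Variable lambda : {sigma_finite_measure set X -> \bar R}.
Variables (eta : Omega -> config X R) (kappa : Omega -> \bar R).
Variable Z : nat -> Omega -> X.
Hypothesis eta_poisson : poisson_process P lambda eta.
Hypothesis eta_proper : proper_representation P eta kappa Z.

(** Dropping the point by its index requires no inequality between measures and yields a
    configuration for every [w], whether or not the point exists. *)
Definition others (i : nat) (w : Omega) : config X R :=
  points R (fun j => (j%:R%:E < kappa w) && (j != i)) (Z ^~ w).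

Definition has_point (i : nat) : set Omega := [set w | i%:R%:E < kappa w].

Let mZ i : measurable_fun setT (Z i). Proof. by case: eta_proper. Qed.

Lemma measurable_has_point i : measurable (has_point i).
Proof.
have mk : measurable_fun setT kappa by case: eta_proper.
rewrite -[X in measurable X]setTI.
have -> : has_point i = kappa @^-1` `]i%:R%:E, +oo[%classic `|` kappa @^-1` [set +oo].
  apply/seteqP; split=> w /=; rewrite in_itv/= andbT.
    rewrite /has_point/=; case: (kappa w) => [k| |]; rewrite ?ltry//; by [left|right].
  by move=> []//; rewrite /has_point/= => ->; rewrite ltry.
rewrite setIUr; apply: measurableU; apply: mk => //.
exact: emeasurable_itv.
Qed.

Let measurable_dirac_Z j B : measurable B ->
  measurable_fun setT (fun w => \d_(Z j w) B : \bar R).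
Proof.
move=> mB; under eq_fun do rewrite diracE.
have -> : (fun w => ((Z j w \in B)%:R : R)%:E) = EFin \o (\1_B \o Z j).
  by apply/funext=> z /=; rewrite indicE.
by apply/measurable_EFinP/measurableT_comp => //; exact: measurable_indic.
Qed.

Lemma measurable_others i : measurable_fun setT (others i).
Proof.
apply: measurable_fun_config => B mB.
rewrite (_ : (fun _ => _) = (fun w => \sum_(j <oo)
    if (j%:R%:E < kappa w) && (j != i) then \d_(Z j w) B else 0)); last first.
  by apply/funext => w; rewrite [LHS]pointsE [LHS]eseries_mkcond.
apply: (@ge0_emeasurable_sum _ _ _ _ _ xpredT).
  by move=> j w _ _; case: ifP.
move=> j _; apply: measurable_fun_ifT => //; last exact: measurable_dirac_Z.
apply: measurable_and; last exact: measurable_cst.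
apply: (@measurable_fun_bool _ _ setT _ true).
rewrite setTI; exact: measurable_has_point.
Qed.

Lemma eta_others : {ae P, forall w, forall i, has_point i w ->
  config_eq (eta w) (add_point (others i w) (Z i w))}.
Proof.
have [_ _ _] := eta_proper; apply: filterS => w H i wi B mB.
rewrite H// add_pointE pointsE (nneseriesD1 (n := i))//.
by rewrite addeC.
Qed.

Lemma dirac_sum_eta : {ae P, forall w, forall B, measurable B ->
  eta w B = \sum_(i <oo) (\1_(has_point i `&` Z i @^-1` B) w)%:E}.
Proof.
have [_ _ _] := eta_proper; apply: filterS => w H B mB.
rewrite H// [LHS]eseries_mkcond; apply: eq_eseriesr => i _.
rewrite diracE indicE in_setI.
rewrite (_ : (w \in has_point i) = (i%:R%:E < kappa w)); last first.
  by apply/idP/idP; rewrite inE.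
rewrite (_ : (w \in Z i @^-1` B) = (Z i w \in B)); last by apply/idP/idP; rewrite !inE.
by case: ifP.
Qed.

End mecke.

Lemma ae_eq_measure d (T : measurableType d) (R : realType)
    (mu : {measure set T -> \bar R}) (A B : set T) :
  measurable A -> measurable B -> {ae mu, forall w, A w <-> B w} -> mu A = mu B.
Proof.
move=> mA mB AB; rewrite -(setIT A) -(setIT B) -!integral_indic//.
apply: ge0_ae_eq_integral => //; try exact/measurable_EFinP/measurable_indic.
apply: filterS AB => w wAB _; rewrite !indicE; congr ((nat_of_bool _)%:R%:E).
by apply/idP/idP; rewrite !inE => /wAB.
Qed.

Lemma ge0_integral_mrestr d (T : measurableType d) (R : realType)
    (mu : {measure set T -> \bar R}) (D : set T) (mD : measurable D)
    (f : T -> \bar R) : measurable_fun setT f -> (forall x, 0 <= f x) ->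
  \int[mrestr mu mD]_x f x = \int[mu]_(x in D) f x.
Proof.
move=> mf f0; rewrite (@ge0_negligible_integral _ _ _ _ setT (~` D))//.
- rewrite setTD setCK; apply: eq_measure_integral => A mA AD.
  by rewrite -[in RHS](setIidl AD).
- exact: measurableC.
by rewrite [LHS]/= /mrestr setICl measure0.
Qed.

(** * The Mecke formula as an identity between measures *)

Section mecke_formula.
Context d (X : measurableType d) (R : realType) dO (Omega : measurableType dO).
Variables (P : probability Omega R).
Variable lambda : {sigma_finite_measure set X -> \bar R}.
Variables (eta : Omega -> config X R) (kappa : Omega -> \bar R).
Variable Z : nat -> Omega -> X.
Hypothesis eta_poisson : poisson_process P lambda eta.
Hypothesis eta_proper : proper_representation P eta kappa Z.

Let others := @others d X R dO Omega kappa Z.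
Let has_point := @has_point R dO Omega kappa.

Let mZ i : measurable_fun setT (Z i). Proof. by case: eta_proper. Qed.

Let meta : measurable_fun setT eta. Proof. by case: eta_poisson. Qed.

Let mh i : measurable (has_point i). Proof. exact: measurable_has_point eta_proper i. Qed.

Let mpair i : measurable_fun setT (fun w => (Z i w, others i w)).
Proof. by apply: measurable_fun_pair => //; exact: measurable_others eta_proper i. Qed.

Let mpair_eta : measurable_fun setT (fun z : X * Omega => (z.1, eta z.2)).
Proof.
by apply: measurable_fun_pair => //; apply: measurableT_comp => //; exact: measurable_snd.
Qed.

(** The reduced Campbell measure of the process: the mean number of points whose position, together
    with the configuration of the other points, lies in a given set. The Mecke formula says that it
    is the product of [lambda] and the law of [eta]. *)
Definition reduced_campbell : {measure set (X * config X R) -> \bar R} :=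
  mseries (fun i => image_measure (mrestr P (mh i)) (mpair i)) 0.

Definition product_law : {measure set (X * config X R) -> \bar R} :=
  image_measure (lambda \x P) mpair_eta.

Let reduced_campbellE (A : set X) (S : set (config X R)) :
  reduced_campbell (A `*` S) =
  \sum_(i <oo) P (has_point i `&` Z i @^-1` A `&` others i @^-1` S).
Proof.
apply: eq_eseriesr => i _; rewrite image_measureE /mrestr.
by congr (P _); apply/seteqP; split=> w /= [[]].
Qed.

Let product_lawE (A : set X) (S : set (config X R)) : measurable A -> measurable S ->
  product_law (A `*` S) = lambda A * P (eta @^-1` S).
Proof.
move=> mA mS; rewrite image_measureE.
rewrite (_ : _ @^-1` _ = A `*` (eta @^-1` S)); last by apply/seteqP; split=> -[].
apply: product_measure1E => //.
by rewrite -[X in measurable X]setTI; exact: meta.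
Qed.

Section one_cell.
Variables (T : finType) (l : X -> T).
Hypothesis ml : forall t, measurable (l @^-1` [set t]).
Variables (t0 : T) (n : {ffun T -> option nat}).

Let n' := [ffun t => if t == t0 then omap succn (n t) else n t].

Let S' := eta @^-1` cell_event l n'.

Let mS' : measurable S'.
Proof. by rewrite -[X in measurable X]setTI; apply: meta => //; exact: measurable_cell_event. Qed.

Let mZt i : measurable (has_point i `&` Z i @^-1` (l @^-1` [set t0])).
Proof. by apply: measurableI => //; rewrite -[X in measurable X]setTI; exact: mZ. Qed.

(** Putting a point of the cell [t0] back changes the counts of the others from [n] to [n'], almost
    surely. *)
Let others_cell i :
  P (has_point i `&` Z i @^-1` (l @^-1` [set t0]) `&` others i @^-1` cell_event l n) =
  P (has_point i `&` Z i @^-1` (l @^-1` [set t0]) `&` S').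
Proof.
have mo : measurable (others i @^-1` cell_event l n).
  rewrite -[X in measurable X]setTI; apply: (measurable_others eta_proper i) => //.
  exact: measurable_cell_event.
apply: ae_eq_measure; [exact: measurableI|exact: measurableI|].
have := eta_others eta_proper; apply: filterS => w Hw.
suff H : has_point i w -> l (Z i w) = t0 ->
    (cell_event l n (others i w) <-> cell_event l n' (eta w)).
  by split=> -[[wi Zi] /(H wi Zi)].
move=> wi Zi; split=> E t.
- rewrite (Hw i wi _ (ml t)) add_pointE E /n' ffunE diracE.
  case: eqVneq => [->|tt0]; first by rewrite mem_set// count_value_succ.
  by rewrite memNset ?adde0//= Zi => /esym/eqP; apply/negP.
- have := E t; rewrite (Hw i wi _ (ml t)) add_pointE /n' ffunE diracE.
  case: eqVneq => [->|tt0].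
    rewrite mem_set// count_value_succ.
    by move/(congr1 (fun x => x - 1)); rewrite !addeK.
  by rewrite memNset ?adde0//= Zi => /esym/eqP; apply/negP.
Qed.

(** On the event that [eta] has the counts [n'], the number of points in the cell [t0] is the
    constant [n' t0], so the sum over the points is this constant times a probability. By
    independence the probability factors over the cells; all factors except the one at [t0] agree on
    both sides, and that one is [poisson_prob_recurrence]. *)
Lemma reduced_campbell_cell : lambda (l @^-1` [set t0]) < +oo ->
  reduced_campbell ((l @^-1` [set t0]) `*` cell_event l n) =
  product_law ((l @^-1` [set t0]) `*` cell_event l n).
Proof.
move=> loo; rewrite reduced_campbellE product_lawE//; last exact: measurable_cell_event.
under eq_eseriesr do rewrite others_cell.
have -> : \sum_(i <oo) P (has_point i `&` Z i @^-1` (l @^-1` [set t0]) `&` S') =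
    count_value R (n' t0) * P S'.
  transitivity (\int[P]_(w in S') \sum_(i <oo)
      (\1_(has_point i `&` Z i @^-1` (l @^-1` [set t0])) w)%:E).
    rewrite integral_nneseries//; last first.
      by move=> i; apply/measurable_EFinP/measurable_funTS/measurable_indic; exact: mZt.
    by apply: eq_eseriesr => i _; rewrite integral_indic.
  rewrite (ge0_ae_eq_integral (g := cst (count_value R (n' t0))))//.
  - by rewrite integral_cst.
  - apply: (@ge0_emeasurable_sum _ _ _ _ _ xpredT) => [i w _ _|i _].
      by rewrite lee_fin.
    apply/measurable_EFinP/measurable_funTS/measurable_indic; exact: mZt.
  - by move=> w _; apply: nneseries_ge0 => i _ _; rewrite lee_fin.
  - by move=> w _; exact: count_value_ge0.
  have := dirac_sum_eta eta_proper; apply: filterS => w Hw S'w.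
  by rewrite -Hw//; exact: S'w.
have tl : trivIset setT (fun t => l @^-1` [set t]).
  by move=> s t _ _ [x [/= <- <-]].
have cellE m : P (eta @^-1` cell_event l m) =
    \prod_t P [set w | eta w (l @^-1` [set t]) = count_value R (m t)].
  rewrite -(independent_counts eta_poisson ml tl (U := fun t => [set count_value R (m t)]))//.
rewrite /S' !cellE (bigD1 t0)//= [in RHS](bigD1 t0)//=.
have -> : \prod_(i | i != t0) P [set w | eta w (l @^-1` [set i]) = count_value R (n' i)] =
    \prod_(i | i != t0) P [set w | eta w (l @^-1` [set i]) = count_value R (n i)].
  by apply: eq_bigr => t /negbTE tt0; rewrite /n' ffunE tt0.
rewrite !muleA; congr (_ * _).
(* For an infinite count both sides vanish, because the cell has finite intensity. *)
rewrite /n' ffunE eqxx; case: (n t0) => [k|] /=; last first.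
  by rewrite (poisson_count_pinfty eta_poisson)// !mule0.
rewrite !(poisson_count eta_poisson)//.
have lE : lambda (l @^-1` [set t0]) = (fine (lambda (l @^-1` [set t0])))%:E.
  by rewrite fineK// ge0_fin_numE.
by rewrite [X in _ = X * _]lE poisson_prob_recurrence// fine_ge0.
Qed.

End one_cell.

(** Refining the partition by [A] itself turns the product of [A] and a cylinder into a countable
    disjoint union of products of a cell inside [A] and a [cell_event]. *)
Let reduced_campbell_cylinder (A : set X) (S : set (config X R)) :
  measurable A -> lambda A < +oo -> cylinder S ->
  reduced_campbell (A `*` S) = product_law (A `*` S).
Proof.
move=> mA Aoo [T [l [D [ml ->]]]].
pose l' x := (l x, `[< A x >]).
have AE : (fun x => `[< A x >]) @^-1` [set true] = A.
  by apply/seteqP; split=> x /= /asboolP.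
have AE' : (fun x => `[< A x >]) @^-1` [set false] = ~` A.
  apply/seteqP; split=> x /=; first by move=> H; apply/asboolPn; rewrite H.
  by move=> /asboolPn/negbTE.
have l'E t b : l' @^-1` [set (t, b)] = l @^-1` [set t] `&` (fun x => `[< A x >]) @^-1` [set b].
  by apply/seteqP; split=> x /= [<- <-].
have ml' t : measurable (l' @^-1` [set t]).
  case: t => t b; rewrite l'E; apply: measurableI => //.
  by case: b; rewrite ?AE ?AE'//; exact: measurableC.
pose D' := [set n : {ffun T * bool -> option nat} |
  D (fun t => \sum_b count_value R (n (t, b)))].
pose I := (T * {ffun T * bool -> option nat})%type.
pose F (i : I) := (l' @^-1` [set (i.1, true)]) `*` cell_event (R := R) l' i.2.
have mF i : measurable (F i).
  by apply: measurableX; [exact: ml'|exact: measurable_cell_event].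
have -> : A `*` [set mu : config X R | D (fun t => mu (l @^-1` [set t]))] =
    \bigcup_(i in [set i : I | D' i.2]) F i.
  have cellsE (mu : config X R) n : cell_event l' n mu ->
      (fun t => mu (l @^-1` [set t])) = fun t => \sum_b count_value R (n (t, b)).
    move=> nmu; apply/funext => t.
    have mb b : measurable ((fun x => `[< A x >]) @^-1` [set b]).
      by case: b; rewrite ?AE ?AE'//; exact: measurableC.
    rewrite (measure_cells mb)//; apply: eq_bigr => b _.
    by rewrite -l'E; exact: nmu.
  apply/seteqP; split=> [[x mu] [/= Ax Dmu]|[x mu] [[t n] /= Dn [/= xt nmu]]].
    have [n nmu] := cell_event_cover ml' mu.
    exists (l x, n); last by split => //=; rewrite /l'; congr pair; apply/asboolP.
    by rewrite /D' /= -(cellsE _ _ nmu).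
  split=> /=; first by case: xt => _ /asboolP.
  by rewrite (cellsE _ _ nmu).
apply: measure_eq_bigcup_countType => //.
  move=> [s m] [t n] _ _ [[x mu] [[/= xs smu] [/= xt tmu]]].
  congr pair; first by have := etrans (esym xs) xt; case.
  exact: (trivIset_cell_event Logic.I Logic.I (ex_intro _ mu (conj smu tmu))).
move=> [t n] _; apply: reduced_campbell_cell => //.
rewrite (le_lt_trans _ Aoo)// l'E AE; apply: le_measure; rewrite ?inE//.
  exact: measurableI.
Qed.

(** For fixed [A] both sides are finite measures in [S] that agree on the pi-system of cylinders. *)
Let reduced_campbell_rectangle (A : set X) (S : set (config X R)) :
  measurable A -> lambda A < +oo -> measurable S ->
  reduced_campbell (A `*` S) = product_law (A `*` S).
Proof.
move=> mA Aoo mS.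
have mAT : measurable (A `*` [set: config X R]) by exact: measurableX.
pose m1 := image_measure (mrestr reduced_campbell mAT) measurable_snd.
pose m2 := image_measure (mrestr product_law mAT) measurable_snd.
have AS S' : (snd @^-1` S') `&` (A `*` [set: config X R]) = A `*` S'.
  by apply/seteqP; split=> -[x mu] /= [] // ? [].
have m1E S' : m1 S' = reduced_campbell (A `*` S') by rewrite -AS.
have m2E S' : m2 S' = product_law (A `*` S') by rewrite -AS.
suff : m1 S = m2 S by rewrite m1E m2E.
apply: (@measure_unique _ _ _ (@cylinder d X R) (fun=> setT)) => //.
- exact: measurable_cylinders.
- exact: cylinderI.
- by move=> _; exact: cylinderT.
- by apply/seteqP; split=> // mu _; exists 0%N.
- by move=> C CC; rewrite m1E m2E reduced_campbell_cylinder.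
move=> _; rewrite m1E reduced_campbell_cylinder//; last exact: cylinderT.
by rewrite product_lawE// preimage_setT probability_setT mule1.
Qed.

(** Rectangles over sets of finite intensity form a pi-system; since [lambda] is sigma-finite, they
    generate the product sigma-field and exhaust the product space by sets of finite measure. *)
Lemma reduced_campbell_eq (S : set (X * config X R)) : measurable S ->
  reduced_campbell S = product_law S.
Proof.
have /sigma_finiteP[A [AT ndA Aoo]] := sigma_finiteT lambda.
pose G : set (set (X * config X R)) :=
  [set C | exists B, [/\ measurable B, lambda B < +oo &
                     exists2 S, measurable S & C = B `*` S]].
move=> mS; apply: (@measure_unique _ _ _ G (fun n => A n `*` setT)) => //.
- apply/seteqP; split; last first.
    apply: smallest_sub; first exact: sigma_algebra_measurable.
    by move=> _ [B [mB _ [U mU ->]]]; exact: measurableX.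
  rewrite measurable_prod_measurableType.
  apply: smallest_sub; first exact: smallest_sigma_algebra.
  move=> _ [B mB [U mU <-]].
  have -> : B `*` U = \bigcup_n ((B `&` A n) `*` U).
    apply/seteqP; split=> [[x mu] [/= Bx Umu]|[x mu] [n _ [/= [Bx _] Umu]]]//.
    have : [set: X] x by [].
    by rewrite AT => -[n _ Anx]; exists n.
  have [_ _ SA] := @smallest_sigma_algebra _ setT G.
  apply: SA => n; apply: sub_gen_smallest.
  exists (B `&` A n); split; last by exists U.
    by apply: measurableI => //; case: (Aoo n).
  have [mAn Anoo] := Aoo n.
  rewrite (le_lt_trans _ Anoo)//; apply: le_measure; rewrite ?inE//.
  exact: measurableI.
- move=> _ _ [B1 [mB1 B1oo [S1 mS1 ->]]] [B2 [mB2 B2oo [S2 mS2 ->]]].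
  rewrite -setXI; exists (B1 `&` B2); split; first exact: measurableI.
    rewrite (le_lt_trans _ B1oo)//; apply: le_measure; rewrite ?inE//.
    exact: measurableI.
  by exists (S1 `&` S2) => //; exact: measurableI.
- move=> n; have [mAn Anoo] := Aoo n; exists (A n); split => //.
  by exists setT.
- apply/seteqP; split=> // -[x mu] _.
  have : [set: X] x by [].
  by rewrite AT => -[n _ Anx]; exists n.
- by move=> _ [B [mB Boo [U mU ->]]]; exact: reduced_campbell_rectangle.
move=> n; have [mAn Anoo] := Aoo n.
rewrite reduced_campbell_rectangle// product_lawE//.
by rewrite preimage_setT probability_setT mule1.
Qed.

Theorem mecke_formula (h : X * config X R -> \bar R) :
  measurable_fun setT h -> (forall z, 0 <= h z) ->
  \int[P]_w \sum_(i <oo | i%:R%:E < kappa w) h (Z i w, others i w) =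
  \int[P]_w \int[lambda]_x h (x, eta w).
Proof.
move=> mh0 h0.
transitivity (\int[reduced_campbell]_z h z).
  rewrite ge0_integral_measure_series//.
  transitivity (\sum_(i <oo) \int[P]_w
      (((fun w => h (Z i w, others i w)) \_ (has_point i)) w)).
    rewrite -integral_nneseries//.
    - apply: eq_integral => w _; rewrite [LHS]eseries_mkcond.
      apply: eq_eseriesr => i _; rewrite patchE.
      rewrite (_ : (w \in has_point i) = (i%:R%:E < kappa w))//.
      by apply/idP/idP; rewrite inE.
    - move=> i; apply/(measurable_restrictT _ (mh i)).
      by apply: measurable_funTS; exact: measurableT_comp.
    - by move=> i w _; rewrite patchE; case: ifP.
  apply: eq_eseriesr => i _.
  rewrite ge0_integral_image_measure// ge0_integral_mrestr//.
    by rewrite -integral_mkcond.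
  exact: measurableT_comp.
rewrite (eq_measure_integral product_law); last first.
  by move=> A mA _; exact: reduced_campbell_eq.
rewrite ge0_integral_image_measure//.
apply: (fubini_tonelli2 (fun z : X * Omega => h (z.1, eta z.2))) => //.
exact: measurableT_comp.
Qed.

End mecke_formula.

(** * Scalar inequalities for Bregman divergences *)


Section scalar_inequalities.
Local Open Scope ring_scope.
Variable R : realType.
Implicit Types a b p q s t u x y : R.

Lemma powR_sum_eq1 a x y : (0 < a -> x + y = 0 -> a `^ x * a `^ y = 1)%R.
Proof. by move=> a0 xy; rewrite -powRD ?xy ?powRr0//; rewrite (gt_eqF a0) implybT. Qed.

(** The weighted mean inequality is Young's inequality for the conjugate exponents [1 / t] and
    [1 / (1 - t)]; these degenerate at the endpoints, which are treated apart. *)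
Lemma young_powR x y t : (0 <= x -> 0 <= y -> 0 <= t <= 1 ->
  x `^ t * y `^ (1 - t) <= t * x + (1 - t) * y)%R.
Proof.
move=> x0 y0 /andP[]; rewrite le_eqVlt => /predU1P[<- _|t0].
  by rewrite powRr0 subr0 powRr1// mul0r !mul1r add0r.
rewrite le_eqVlt => /predU1P[->|t1].
  by rewrite subrr powRr0 powRr1// mul0r addr0 mulr1 mul1r.
have := @conjugate_powR _ (x `^ t) (y `^ (1 - t)) t^-1 (1 - t)^-1.
rewrite !powR_ge0 => /(_ erefl erefl); rewrite !invr_gt0 subr_gt0 => /(_ t0 t1).
rewrite !invrK addrC subrK => /(_ erefl).
by rewrite -!powRrM !divff ?gt_eqF ?subr_gt0// !powRr1// (mulrC x) (mulrC y).
Qed.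

(** Convexity of the power in the form of its tangent at [x], obtained from the weighted mean
    inequality for [y ^ q] and [x ^ q] with weight [1 / q]. *)
Lemma powR_bernoulli q x y : (1 <= q -> 0 < x -> 0 < y ->
  x `^ q + q * x `^ (q - 1) * (y - x) <= y `^ q)%R.
Proof.
move=> q1 x0 y0; have q0 : (0 < q)%R by lra.
have q0' : q != 0 by rewrite gt_eqF.
have E1 : (y `^ q) `^ q^-1 = y by rewrite -powRrM mulfV// powRr1// ltW.
have E2 : (x `^ q) `^ (1 - q^-1) = x `^ (q - 1).
  by rewrite -powRrM mulrBr mulr1 mulfV.
have E3 : x `^ q = x * x `^ (q - 1) by rewrite mulr_powRB1// ltW.
have qV : 0 <= q^-1 <= 1 by rewrite invr_ge0 ltW//= invf_le1.
have := young_powR (powR_ge0 y q) (powR_ge0 x q) qV.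
rewrite E1 E2 -(ler_pM2l q0) mulrDr !mulrA mulrBr mulfV// !mul1r mulr1 E3.
move: (y `^ q) (x `^ (q - 1)) => Y Z {E1 E2 E3 qV q0' q0 q1}; lra.
Qed.

(** The concave counterpart: the weighted mean inequality for [y] and [x] with weight [q],
    multiplied by [x ^ (q - 1)]. *)
Lemma powR_bernoulli_le1 q x y : (0 <= q <= 1 -> 0 < x -> 0 < y ->
  y `^ q <= x `^ q + q * x `^ (q - 1) * (y - x))%R.
Proof.
move=> q01 x0 y0.
have := @young_powR y x q (ltW y0) (ltW x0) q01.
have E : (x `^ (1 - q) * x `^ (q - 1) = 1)%R by apply: powR_sum_eq1 => //; lra.
have F : (x `^ q = x * x `^ (q - 1))%R.
  by rewrite -[X in (_ = X * _)%R](@powRr1 _ x) ?ltW// -powRD ?(gt_eqF x0) ?implybT//; congr powR; lra.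
have xq : (0 < x `^ (q - 1))%R by rewrite powR_gt0.
rewrite -(ler_pM2r xq) -[X in X <= _]mulrA E mulr1 F.
move: (y `^ q) (x `^ (q - 1)) => Y Z {E F xq q01}; lra.
Qed.

Definition bregman_power p a b := (a `^ p - b `^ p - p * b `^ (p - 1) * (a - b))%R.

Lemma bregman_power_ge0 p a b : (1 <= p -> 0 < a -> 0 < b ->
  0 <= bregman_power p a b)%R.
Proof.
by move=> p1 a0 b0; have := powR_bernoulli p1 b0 a0; rewrite /bregman_power; lra.
Qed.

(** With [S = s ^ (q - 1)] and [T = t ^ (q - 1)], the divergence times [q - 1] equals
    [q (s - t) S - (s ^ q - t ^ q)]. The tangent of [x ^ q] at [t] bounds this by
    [q (s - t) (S - T)], and [S - T] is comparable to [s - t] by the mean value bound [K]. *)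
Lemma bregman_power_le q s t : (2 <= q -> 0 < s -> 0 < t ->
  bregman_power (q / (q - 1)) (s `^ (q - 1)) (t `^ (q - 1)) <=
  q * Num.max s t `^ (q - 2) * (s - t) ^+ 2)%R.
Proof.
move=> q2 s0 t0.
have q10 : (0 < q - 1)%R by lra.
have q11 : (q - 1 != 0)%R by rewrite gt_eqF.
have cancel x : (0 < x -> (x `^ (q - 1)) `^ (q / (q - 1)) = x `^ q)%R.
  by move=> x0; rewrite -powRrM mulrCA divff// mulr1.
have cancel1 x : (0 < x -> (x `^ (q - 1)) `^ (q / (q - 1) - 1) = x)%R.
  move=> x0; rewrite -powRrM mulrBr mulrCA divff// !mulr1.
  by rewrite (_ : q - (q - 1) = 1)%R ?powRr1 ?ltW//; lra.
rewrite /bregman_power !cancel// cancel1//.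
have E x : (0 < x -> x `^ q = x * x `^ (q - 1))%R.
  by move=> x0; rewrite mulr_powRB1 ?ltW//; lra.
have E1 x : (0 < x -> x `^ (q - 1) = x * x `^ (q - 2))%R.
  move=> x0; rewrite -(@mulr_powRB1 _ x (q - 1)) ?ltW//.
  by congr (_ * powR _ _)%R; lra.
(* The tangent of [x ^ (q - 1)] at the larger of the two points; convexity of this power is where
   [2 <= q] is used. *)
have K : ((s `^ (q - 1) - t `^ (q - 1)) * (s - t) <=
    (q - 1) * Num.max s t `^ (q - 2) * (s - t) ^+ 2)%R.
  have q11' : (1 <= q - 1)%R by lra.
  have [st|ts] := leP s t.
  - have := powR_bernoulli q11' t0 s0.
    rewrite (_ : q - 1 - 1 = q - 2)%R; last lra.
    have ts0 : (0 <= t - s)%R by lra.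
    move=> H.
    have : (t `^ (q - 1) - s `^ (q - 1) <= (q - 1) * t `^ (q - 2) * (t - s))%R by lra.
    move/(ler_wpM2r ts0); lra.
  - have := powR_bernoulli q11' s0 t0.
    rewrite (_ : q - 1 - 1 = q - 2)%R; last lra.
    have st0 : (0 <= s - t)%R by lra.
    move=> H.
    have : (s `^ (q - 1) - t `^ (q - 1) <= (q - 1) * s `^ (q - 2) * (s - t))%R by lra.
    move/(ler_wpM2r st0); lra.
have q1 : (1 <= q)%R by lra.
have L := powR_bernoulli q1 t0 s0.
rewrite -(ler_pM2l q10).
have -> : ((q - 1) * (s `^ q - t `^ q - q / (q - 1) * t * (s `^ (q - 1) - t `^ (q - 1))) =
  (q - 1) * s `^ q - (q - 1) * t `^ q - q * t * (s `^ (q - 1) - t `^ (q - 1)))%R by field.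
move: L K; rewrite !E//.
move: (s `^ (q - 1)) (t `^ (q - 1)) (Num.max s t `^ (q - 2)) => S T M L K.
have := ler_wpM2l (ltW (lt_le_trans ltr01 q1)) K.
move: L => {q2 s0 t0 q10 q11 cancel cancel1 E E1 q1 K}; lra.
Qed.

Lemma ger0_derive2_ge0 (f f1 f2 : R -> R) :
  (forall x, 0 <= x <= 1 -> is_derive x 1 f (f1 x)) ->
  (forall x, 0 <= x <= 1 -> is_derive x 1 f1 (f2 x)) ->
  (forall x, 0 <= x <= 1 -> 0 <= f2 x) ->
  f 0 = 0 -> f1 0 = 0 -> 0 <= f 1.
Proof.
have mono (g g1 : R -> R) x : (forall y, 0 <= y <= 1 -> is_derive y 1 g (g1 y)) ->
    (forall y, 0 <= y <= 1 -> 0 <= g1 y) -> 0 <= x <= 1 -> g 0 <= g x.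
  move=> dg g1_ge0 /andP[x0 x1].
  have sub y : y \in `[0, x]%R -> 0 <= y <= 1.
    by rewrite in_itv/= => /andP[-> yx]; rewrite (le_trans yx).
  have [y yx gE] : exists2 y, y \in `[0, x]%R & g x - g 0 = g1 y * (x - 0).
    apply: MVT_segment => //.
      by move=> y /subset_itv_oo_cc/sub/dg.
    apply: derivable_within_continuous => y /sub/dg[].
    by [].
  by rewrite -subr_ge0 gE mulr_ge0 ?subr_ge0// g1_ge0// sub.
move=> df df1 f2_ge0 f0 f10.
rewrite -f0; apply: (mono f f1); rewrite ?ler01 ?lexx//.
move=> y y01; rewrite -f10; exact: (mono f1 f2).
Qed.

Lemma is_derive_powR_affine b z q x : 0 < b + x * z ->
  is_derive x 1 (fun u => (b + u * z) `^ q) (q * (b + x * z) `^ (q - 1) * z).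
Proof.
move=> bz; have da : is_derive x 1 (fun u : R => b + u * z) z.
  by apply: is_derive_eq; rewrite /GRing.scale/=; ring.
have := @is_derive1_comp _ (fun y => y `^ q) (fun u => b + u * z) x _ _
  (is_derive1_powR q bz) da.
by [].
Qed.

(* The function [(y, z) |-> z ^+ 2 / y `^ g] lies above its tangent plane at
   [(y0, z0)]. *)
Lemma square_over_powR_tangent g y y0 z z0 : 0 <= g <= 1 -> 0 < y -> 0 < y0 ->
  0 <= y `^ (- g) * z ^+ 2 + y0 `^ (- g) * z0 ^+ 2 - 2 * y0 `^ (- g) * z0 * z +
       g * y0 `^ (- g - 1) * z0 ^+ 2 * (y - y0).
Proof.
move=> g01 y_gt0 y0_gt0.
have H := powR_bernoulli_le1 g01 y0_gt0 y_gt0.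
have Ey : y `^ g * y `^ (- g) = 1 by apply: powR_sum_eq1; rewrite ?subrr.
have Ey0 : y0 `^ g * y0 `^ (- g) = 1 by apply: powR_sum_eq1; rewrite ?subrr.
have E : y0 `^ (g - 1) * y0 `^ (- g) * y0 `^ (- g) = y0 `^ (- g - 1).
  rewrite -!powRD ?(gt_eqF y0_gt0) ?implybT//; congr powR; lra.
have yg : 0 < y `^ (- g) by rewrite powR_gt0.
have y0g : 0 <= (y0 `^ (- g) * z0) ^+ 2 by rewrite sqr_ge0.
have := ler_wpM2r y0g H.
have := mulr_ge0 (ltW yg) (sqr_ge0 (z - y0 `^ (- g) * z0 * y `^ g)).
rewrite -E; move: Ey Ey0.
move: (y `^ g) (y `^ (- g)) (y0 `^ g) (y0 `^ (- g)) (y0 `^ (g - 1)) => a a' b b' c.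
move=> aa bb H1 H2.
have -> : a' * z ^+ 2 + b' * z0 ^+ 2 - 2 * b' * z0 * z + g * (c * b' * b') * z0 ^+ 2 * (y - y0)
  = (a' * (z - b' * z0 * a) ^+ 2) + ((b + g * c * (y - y0)) * (b' * z0) ^+ 2 - a * (b' * z0) ^+ 2) +
    (1 - a * a') * (a * (b' * z0) ^+ 2 - 2 * z * b' * z0) + (1 - b * b') * b' * z0 ^+ 2 by ring.
by rewrite aa bb subrr !mul0r !addr0 addr_ge0// subr_ge0.
Qed.

(* Joint convexity of the Bregman divergence: along the segments from the
   diagonal, [u |-> (b + u (a - b), b)], the second derivative of the difference
   between the divergence and its tangent plane is nonnegative by
   [square_over_powR_tangent]. *)
Lemma bregman_power_tangent p a b a0 b0 :
  1 <= p <= 2 -> 0 < a -> 0 < b -> 0 < a0 -> 0 < b0 ->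
  bregman_power p a0 b0 + p * (a0 `^ (p - 1) - b0 `^ (p - 1)) * (a - a0) -
    p * (p - 1) * b0 `^ (p - 2) * (a0 - b0) * (b - b0) <= bregman_power p a b.
Proof.
move=> /andP[p1 p2] a_gt0 b_gt0 a0_gt0 b0_gt0.
have pos c e u : 0 < c -> 0 < e -> 0 <= u <= 1 -> 0 < e + u * (c - e).
  move=> c0 e0 /andP[u0 u1]; rewrite (_ : _ + _ = (1 - u) * e + u * c); last by ring.
  have [->|un0] := eqVneq u 0; first by rewrite subr0 mul1r mul0r addr0.
  by rewrite ltr_wpDl ?mulr_ge0 ?subr_ge0 ?(ltW e0)// mulr_gt0// lt_neqAle eq_sym un0.
have E1 : p - 1 - 1 = p - 2 by lra.
have E2 : p - 2 - 1 = p - 3 by lra.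
have E3 : - (2 - p) - 1 = p - 3 by lra.
have E4 : - (2 - p) = p - 2 by lra.
have E5 u : b + u * (a - b) - (b0 + u * (a0 - b0)) =
  b - b0 + u * (a - b - (a0 - b0)) by ring.
have g01 : 0 <= 2 - p <= 1 by apply/andP; split; lra.
have p10 : 0 <= p * (p - 1) by rewrite mulr_ge0 ?subr_ge0//; lra.
set z := a - b; set z0 := a0 - b0.
(* The base point of the tangent plane moves as well, along its own segment from the diagonal. Hence
   [f] and its derivative [f1] both vanish at [0], while [f 1] is the difference to be estimated. *)
pose f u := (b + u * z) `^ p - b `^ p - p * b `^ (p - 1) * (u * z)
  - ((b0 + u * z0) `^ p - b0 `^ p - p * b0 `^ (p - 1) * (u * z0))
  - p * ((b0 + u * z0) `^ (p - 1) - b0 `^ (p - 1)) * (b - b0 + u * (z - z0))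
  + p * (p - 1) * b0 `^ (p - 2) * (u * z0) * (b - b0).
pose f1 u := p * (b + u * z) `^ (p - 1) * z - p * b `^ (p - 1) * z
  - (p * (b0 + u * z0) `^ (p - 1) * z0 - p * b0 `^ (p - 1) * z0)
  - (p * ((p - 1) * (b0 + u * z0) `^ (p - 2) * z0) * (b - b0 + u * (z - z0))
    + p * ((b0 + u * z0) `^ (p - 1) - b0 `^ (p - 1)) * (z - z0))
  + p * (p - 1) * b0 `^ (p - 2) * z0 * (b - b0).
pose f2 u := p * (p - 1) * ((b + u * z) `^ (p - 2) * z ^+ 2
  + (b0 + u * z0) `^ (p - 2) * z0 ^+ 2 - 2 * (b0 + u * z0) `^ (p - 2) * z0 * z
  + (2 - p) * (b0 + u * z0) `^ (p - 3) * z0 ^+ 2 * (b - b0 + u * (z - z0))).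
suff : 0 <= f 1.
  rewrite /f /bregman_power !mul1r /z /z0 !(addrC b) !(addrC b0) !subrK.
  move: (a `^ p) (b `^ p) (a0 `^ p) (b0 `^ p) (b `^ (p - 1)) (a0 `^ (p - 1)) (b0 `^ (p - 1)) (b0 `^ (p - 2)) => *.
  lra.
apply: (@ger0_derive2_ge0 f f1 f2) => [u u01|u u01|u u01||].
- have Pb := is_derive_powR_affine p (pos _ _ _ a_gt0 b_gt0 u01).
  have Pb0 := is_derive_powR_affine p (pos _ _ _ a0_gt0 b0_gt0 u01).
  have Pb1 := is_derive_powR_affine (p - 1) (pos _ _ _ a0_gt0 b0_gt0 u01).
  rewrite E1 in Pb1.
  rewrite /f; apply: is_derive_eq; rewrite /f1 /GRing.scale/=.
  move: ((b + u * z) `^ (p - 1)) (b `^ (p - 1)) ((b0 + u * z0) `^ (p - 1)) => A1 A2 A3.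
  move: (b0 `^ (p - 1)) ((b0 + u * z0) `^ (p - 2)) (b0 `^ (p - 2)) => A4 A5 A6.
  move: (b `^ p) (b0 `^ p) ((b + u * z) `^ p) ((b0 + u * z0) `^ p) => A7 A8 A9 A10.
  by rewrite /z /z0; ring.
- have Pb := is_derive_powR_affine (p - 1) (pos _ _ _ a_gt0 b_gt0 u01).
  have Pb1 := is_derive_powR_affine (p - 1) (pos _ _ _ a0_gt0 b0_gt0 u01).
  have Pb2 := is_derive_powR_affine (p - 2) (pos _ _ _ a0_gt0 b0_gt0 u01).
  rewrite E1 in Pb Pb1; rewrite E2 in Pb2.
  rewrite /f1; apply: is_derive_eq; rewrite /f2 /GRing.scale/=.
  move: ((b + u * z) `^ (p - 1)) (b `^ (p - 1)) ((b0 + u * z0) `^ (p - 1)) => A1 A2 A3.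
  move: (b0 `^ (p - 1)) ((b0 + u * z0) `^ (p - 2)) (b0 `^ (p - 2)) => A4 A5 A6.
  move: ((b + u * z) `^ (p - 2)) ((b0 + u * z0) `^ (p - 3)) => A7 A8.
  by rewrite /z /z0; ring.
- rewrite /f2 mulr_ge0//.
  have := square_over_powR_tangent z z0 g01 (pos _ _ _ a_gt0 b_gt0 u01) (pos _ _ _ a0_gt0 b0_gt0 u01).
  by rewrite E3 E4 E5.
- by rewrite /f !mul0r !addr0 !mulr0 !mul0r !subrr mulr0 mul0r !subrr addr0.
- by rewrite /f1 !mul0r !addr0; ring.
Qed.

End scalar_inequalities.

(** * Adding the points of a finite Poisson process *)

Section bounded_functions.
Local Open Scope ring_scope.
Context dT (T : measurableType dT) (R : realType).
Implicit Types f g : T -> R.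

Definition bounded_measurable f :=
  measurable_fun setT f /\ exists M : R, forall t, `|f t| <= M.

Lemma bounded_measurable_cst r : bounded_measurable (fun=> r).
Proof. by split; [exact: measurable_cst|exists `|r|]. Qed.

Lemma bounded_measurableD f g : bounded_measurable f -> bounded_measurable g ->
  bounded_measurable (fun t => f t + g t).
Proof.
move=> [mf [M fM]] [mg [N gN]]; split; first exact: measurable_funD.
by exists (M + N) => t; rewrite (le_trans (ler_normD _ _))// lerD.
Qed.

Lemma bounded_measurableM f g : bounded_measurable f -> bounded_measurable g ->
  bounded_measurable (fun t => f t * g t).
Proof.
move=> [mf [M fM]] [mg [N gN]]; split; first exact: measurable_funM.
by exists (M * N) => t; rewrite normrM ler_pM.
Qed.

Lemma bounded_measurableN f : bounded_measurable f ->
  bounded_measurable (fun t => - f t).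
Proof.
move=> [mf [M fM]]; split; first exact: measurable_funN.
by exists M => t; rewrite normrN.
Qed.

Lemma bounded_measurableB f g : bounded_measurable f -> bounded_measurable g ->
  bounded_measurable (fun t => f t - g t).
Proof. by move=> ? ?; apply: bounded_measurableD => //; exact: bounded_measurableN. Qed.

Lemma bounded_measurableZ r f : bounded_measurable f ->
  bounded_measurable (fun t => r * f t).
Proof. by move=> bf; apply: bounded_measurableM => //; exact: bounded_measurable_cst. Qed.

Lemma bounded_measurable_powR p f : 0 <= p -> (forall t, 0 <= f t) ->
  bounded_measurable f -> bounded_measurable (fun t => f t `^ p).
Proof.
move=> p0 f0 [mf [M fM]]; split; first exact: measurableT_comp (measurable_powR p) mf.
exists (M `^ p) => t; rewrite ger0_norm ?powR_ge0//.
have fM' : f t <= M by rewrite (le_trans (ler_norm _)).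
by rewrite ge0_ler_powR ?nnegrE// (le_trans (f0 t)).
Qed.

Lemma bounded_measurable_bregman p f g : 1 <= p -> (forall t, 0 <= f t) ->
  (forall t, 0 <= g t) -> bounded_measurable f -> bounded_measurable g ->
  bounded_measurable (fun t => bregman_power p (f t) (g t)).
Proof.
move=> p1 f0 g0 bf bg; rewrite /bregman_power.
have p0 : 0 <= p by rewrite (le_trans ler01).
apply: bounded_measurableB; first by apply: bounded_measurableB; exact: bounded_measurable_powR.
apply: bounded_measurableM; last exact: bounded_measurableB.
by apply: bounded_measurableZ; apply: bounded_measurable_powR => //; rewrite subr_ge0.
Qed.

Lemma bounded_measurable_integrable (nu : {finite_measure set T -> \bar R}) f :
  bounded_measurable f -> nu.-integrable setT (EFin \o f).
Proof.
move=> [mf [M fM]]; apply: measurable_bounded_integrable => //.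
  by rewrite -ge0_fin_numE//; exact: fin_num_measure.
exists M; split; [exact: num_real|move=> N MN t _].
by apply: (le_trans (fM t)); exact: ltW.
Qed.

Lemma EFin_Rintegral (nu : {finite_measure set T -> \bar R}) f :
  bounded_measurable f -> ((\int[nu]_x f x)%:E = \int[nu]_x (f x)%:E)%E.
Proof.
move=> bf; rewrite /Rintegral fineK//.
by apply: integrable_fin_num => //; exact: bounded_measurable_integrable.
Qed.

Lemma bounded_measurable_comp dS (S : measurableType dS) (h : S -> T) f :
  measurable_fun setT h -> bounded_measurable f ->
  measurable_fun setT (f \o h) /\ exists M : R, forall s, `|f (h s)| <= M.
Proof.
by move=> mh [mf [M fM]]; split; [exact: measurableT_comp|exists M => s; exact: fM].
Qed.

End bounded_functions.

Section parameter_integral.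
Local Open Scope ring_scope.
Context dT (T : measurableType dT) dX (X : measurableType dX) (R : realType).
Variable nu : {finite_measure set X -> \bar R}.

Lemma measurable_Rintegral_param (u : T * X -> R) : measurable_fun setT u ->
  measurable_fun setT (fun t => \int[nu]_x u (t, x)).
Proof.
move=> mu; rewrite /Rintegral; apply: measurableT_comp; first exact: fine_measurable.
have mu' : measurable_fun setT (EFin \o u) by exact/measurable_EFinP.
under eq_fun do rewrite integralE.
apply: emeasurable_funB.
  rewrite (_ : (fun t => _) = fubini_F nu (EFin \o u)^\+%E).
    by apply: measurable_fun_fubini_tonelli_F; [exact: measurable_funepos|exact: funepos_ge0].
  by apply/funext => t; apply: eq_integral => x _; rewrite unlock.
rewrite (_ : (fun t => _) = fubini_F nu (EFin \o u)^\-%E).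
  by apply: measurable_fun_fubini_tonelli_F; [exact: measurable_funeneg|exact: funeneg_ge0].
by apply/funext => t; apply: eq_integral => x _; rewrite unlock.
Qed.

Lemma bounded_measurable_Rintegral_param (u : T * X -> R) : bounded_measurable u ->
  bounded_measurable (fun t => \int[nu]_x u (t, x)).
Proof.
move=> [mu [M uM]]; split; first exact: measurable_Rintegral_param.
exists (M * fine (nu setT)) => t.
have bu : bounded_measurable (fun x => u (t, x)).
  by split; [exact: measurableT_comp|exists M].
rewrite -Rintegral_cst//.
apply: (le_trans (le_normr_Rintegral _ (bounded_measurable_integrable nu bu))) => //.
apply: le_Rintegral => //.
- apply: (@bounded_measurable_integrable _ _ _ nu (fun x => `|u (t, x)|)).
  split; last by exists M => x; rewrite normr_id.
  by apply: measurableT_comp => //; case: bu.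
- by apply: bounded_measurable_integrable; exact: bounded_measurable_cst.
Qed.

End parameter_integral.

Lemma Rintegral_swap d1 d2 (T1 : measurableType d1) (T2 : measurableType d2) (R : realType)
    (m1 : {finite_measure set T1 -> \bar R}) (m2 : {finite_measure set T2 -> \bar R})
    (u : T1 * T2 -> R) : bounded_measurable u ->
  (\int[m1]_x \int[m2]_y u (x, y) = \int[m2]_y \int[m1]_x u (x, y))%R.
Proof.
move=> bu; have [mu [M uM]] := bu.
have b1 y : bounded_measurable (fun x => u (x, y)).
  by split; [exact: measurableT_comp|exists M].
have b2 x : bounded_measurable (fun y => u (x, y)).
  by split; [exact: measurableT_comp|exists M].
have bu' : bounded_measurable (fun z => u (z.2, z.1)).
  by apply: bounded_measurable_comp bu; exact: measurable_swap.
have b3 := bounded_measurable_Rintegral_param m2 bu.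
have b4 := bounded_measurable_Rintegral_param m1 bu'.
apply: EFin_inj; rewrite !EFin_Rintegral//.
under eq_integral do rewrite EFin_Rintegral//.
under [RHS]eq_integral do rewrite EFin_Rintegral//.
apply: (@Fubini _ _ _ _ _ m1 m2 (EFin \o u)).
apply: measurable_bounded_integrable => //.
  rewrite [ltLHS](_ : _ = m1 setT * m2 setT); last by rewrite -product_measure1E// setXTT.
  by rewrite ltey_eq fin_numM ?fin_num_measure.
exists M; split; [exact: num_real|move=> N MN z _].
by apply: (le_trans (uM z)); exact: ltW.
Qed.

(** * Bernoulli steps for points acting on an abstract state space *)

Section bernoulli_step.
Local Open Scope ring_scope.
Context dT (T : measurableType dT) dX (X : measurableType dX) (R : realType).
Variable nu : {finite_measure set X -> \bar R}.
Variable s : T -> X -> T.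
Hypothesis ms : measurable_fun setT (fun z : T * X => s z.1 z.2).
Implicit Types g h : T -> R.

Definition shift_integral g : T -> R := fun t => \int[nu]_x g (s t x).

Let c := fine (nu setT).

(* One Bernoulli step: with probability [e * nu setT] a point is added, its
   position having the law proportional to [nu]. *)
Definition bernoulli_step e g : T -> R :=
  fun t => (1 - e * c) * g t + e * shift_integral g t.

Lemma bounded_measurable_shift g t : bounded_measurable g ->
  bounded_measurable (fun x => g (s t x)).
Proof.
move=> bg; apply: bounded_measurable_comp bg.
exact: (measurableT_comp ms (pair1_measurable t)).
Qed.

Lemma bounded_measurable_shift_integral g : bounded_measurable g ->
  bounded_measurable (shift_integral g).
Proof.
move=> bg; apply: (bounded_measurable_Rintegral_param nu (u := fun z => g (s z.1 z.2))).
exact: bounded_measurable_comp bg.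
Qed.

Lemma bounded_measurable_bernoulli_step e g : bounded_measurable g ->
  bounded_measurable (bernoulli_step e g).
Proof.
move=> bg; apply: bounded_measurableD; apply: bounded_measurableZ => //.
exact: bounded_measurable_shift_integral.
Qed.

Lemma bounded_measurable_iter_bernoulli_step e n g : bounded_measurable g ->
  bounded_measurable (iter n (bernoulli_step e) g).
Proof.
by move=> bg; elim: n => //= n IH; exact: bounded_measurable_bernoulli_step.
Qed.

Let int_shift g t : bounded_measurable g -> nu.-integrable setT (EFin \o (fun x => g (s t x))).
Proof. by move=> bg; apply/bounded_measurable_integrable/bounded_measurable_shift. Qed.

Lemma shift_integralD g h t : bounded_measurable g -> bounded_measurable h ->
  shift_integral (fun t => g t + h t) t = shift_integral g t + shift_integral h t.
Proof. by move=> bg bh; rewrite /shift_integral RintegralD//; exact: int_shift. Qed.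

Lemma shift_integralZ r g t : bounded_measurable g ->
  shift_integral (fun t => r * g t) t = r * shift_integral g t.
Proof. by move=> bg; rewrite /shift_integral RintegralZl//; exact: int_shift. Qed.

Lemma shift_integral_cst r t : shift_integral (fun=> r) t = r * c.
Proof. by rewrite /shift_integral Rintegral_cst. Qed.

Lemma le_shift_integral g h t : bounded_measurable g -> bounded_measurable h ->
  (forall t, g t <= h t) -> shift_integral g t <= shift_integral h t.
Proof.
move=> bg bh gh; apply: le_Rintegral => //; exact: int_shift.
Qed.

Lemma bernoulli_stepD e g h t : bounded_measurable g -> bounded_measurable h ->
  bernoulli_step e (fun t => g t + h t) t = bernoulli_step e g t + bernoulli_step e h t.
Proof. by move=> bg bh; rewrite /bernoulli_step shift_integralD//; ring. Qed.

Lemma bernoulli_stepZ e r g t : bounded_measurable g ->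
  bernoulli_step e (fun t => r * g t) t = r * bernoulli_step e g t.
Proof. by move=> bg; rewrite /bernoulli_step shift_integralZ//; ring. Qed.

Lemma bernoulli_step_cst e r t : bernoulli_step e (fun=> r) t = r.
Proof. by rewrite /bernoulli_step shift_integral_cst; ring. Qed.

Section admissible_step.
Variable e : R.
Hypotheses (e0 : 0 <= e) (ec1 : e * c <= 1).

(** The weight [1 - e * c] of adding no point is nonnegative for an admissible step, which is
    therefore a Markov operator. *)
Lemma le_bernoulli_step g h t : bounded_measurable g -> bounded_measurable h ->
  (forall t, g t <= h t) -> bernoulli_step e g t <= bernoulli_step e h t.
Proof.
move=> bg bh gh; rewrite lerD// ler_wpM2l ?subr_ge0//.
exact: le_shift_integral.
Qed.

Lemma bernoulli_step_ge r g t : bounded_measurable g -> (forall t, r <= g t) ->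
  r <= bernoulli_step e g t.
Proof.
move=> bg rg; rewrite -[X in X <= _](bernoulli_step_cst e r t).
by apply: le_bernoulli_step => //; exact: bounded_measurable_cst.
Qed.

Lemma iter_bernoulli_step_ge r n g t : bounded_measurable g -> (forall t, r <= g t) ->
  r <= iter n (bernoulli_step e) g t.
Proof.
move=> bg rg; elim: n t => //= n IH t; apply: bernoulli_step_ge => //.
exact: bounded_measurable_iter_bernoulli_step.
Qed.

Lemma le_iter_bernoulli_step n g h t : bounded_measurable g -> bounded_measurable h ->
  (forall t, g t <= h t) -> iter n (bernoulli_step e) g t <= iter n (bernoulli_step e) h t.
Proof.
move=> bg bh gh; elim: n t => //= n IH t; apply: le_bernoulli_step => //;
  exact: bounded_measurable_iter_bernoulli_step.
Qed.

Variable p : R.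
Hypothesis p12 : 1 <= p <= 2.
Let p1 : 1 <= p. Proof. by case/andP: p12. Qed.
Let p0 : 0 <= p. Proof. exact: le_trans p1. Qed.

Section positive_functions.
Variables (dl : R) (g h : T -> R).
Hypotheses (dl0 : 0 < dl) (bg : bounded_measurable g) (bh : bounded_measurable h).
Hypotheses (dg : forall t, dl <= g t) (dh : forall t, dl <= h t).

Lemma bounded_measurable_bregman_power :
  bounded_measurable (fun t => bregman_power p (g t) (h t)).
Proof.
by apply: bounded_measurable_bregman => // t; rewrite (le_trans (ltW dl0)).
Qed.

(** Jensen's inequality for a jointly convex function of two variables: [L] is its tangent plane at
    the pair of means, evaluated at [(g, h)]. The step integrates affine expressions exactly, and
    [L] lies below the divergence. *)
Lemma bernoulli_step_bregman t :
  bregman_power p (bernoulli_step e g t) (bernoulli_step e h t) <=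
  bernoulli_step e (fun t => bregman_power p (g t) (h t)) t.
Proof.
set a0 := bernoulli_step e g t; set b0 := bernoulli_step e h t.
have a0_gt0 : 0 < a0 by rewrite (lt_le_trans dl0)// bernoulli_step_ge.
have b0_gt0 : 0 < b0 by rewrite (lt_le_trans dl0)// bernoulli_step_ge.
pose A := p * (a0 `^ (p - 1) - b0 `^ (p - 1)).
pose B := - (p * (p - 1) * b0 `^ (p - 2) * (a0 - b0)).
pose L t := A * g t + (B * h t + (bregman_power p a0 b0 - A * a0 - B * b0)).
have bL2 : bounded_measurable (fun t => B * h t + (bregman_power p a0 b0 - A * a0 - B * b0)).
  by apply: bounded_measurableD; [exact: bounded_measurableZ|exact: bounded_measurable_cst].
have bL1 : bounded_measurable (fun t => A * g t) by exact: bounded_measurableZ.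
have bL : bounded_measurable L by exact: bounded_measurableD.
have -> : bregman_power p a0 b0 = bernoulli_step e L t.
  rewrite bernoulli_stepD// bernoulli_stepZ// bernoulli_stepD//; last 2 first.
  - exact: bounded_measurableZ.
  - exact: bounded_measurable_cst.
  by rewrite bernoulli_stepZ// bernoulli_step_cst -/a0 -/b0; ring.
apply: le_bernoulli_step => // [|t']; first exact: bounded_measurable_bregman_power.
have := @bregman_power_tangent _ p (g t') (h t') a0 b0 p12.
move=> /(_ (lt_le_trans dl0 (dg t')) (lt_le_trans dl0 (dh t')) a0_gt0 b0_gt0).
apply: le_trans; rewrite le_eqVlt /L /A /B; apply/orP; left; apply/eqP.
move: (bregman_power p a0 b0) (a0 `^ (p - 1)) (b0 `^ (p - 1)) (b0 `^ (p - 2)) => *.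
by ring.
Qed.

End positive_functions.

Lemma iter_bernoulli_step_bregman n dl g h t : 0 < dl ->
  bounded_measurable g -> bounded_measurable h ->
  (forall t, dl <= g t) -> (forall t, dl <= h t) ->
  bregman_power p (iter n (bernoulli_step e) g t) (iter n (bernoulli_step e) h t) <=
  iter n (bernoulli_step e) (fun t => bregman_power p (g t) (h t)) t.
Proof.
move=> dl0 bg bh dg dh; elim: n t => //= n IH t.
have bgn := bounded_measurable_iter_bernoulli_step e n bg.
have bhn := bounded_measurable_iter_bernoulli_step e n bh.
have dgn t' : dl <= iter n (bernoulli_step e) g t' by exact: iter_bernoulli_step_ge.
have dhn t' : dl <= iter n (bernoulli_step e) h t' by exact: iter_bernoulli_step_ge.
apply: (le_trans (bernoulli_step_bregman dl0 bgn bhn dgn dhn t)).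
apply: le_bernoulli_step => //.
  exact: bounded_measurable_bregman_power dl0 bgn bhn dgn dhn.
apply: bounded_measurable_iter_bernoulli_step.
exact: bounded_measurable_bregman_power dl0 bg bh dg dh.
Qed.

End admissible_step.

End bernoulli_step.

Section local_beckner.
Local Open Scope ring_scope.
Context dT (T : measurableType dT) dX (X : measurableType dX) (R : realType).
Variable nu : {finite_measure set X -> \bar R}.
Variable s : T -> X -> T.
Hypothesis ms : measurable_fun setT (fun z : T * X => s z.1 z.2).
Hypothesis sC : forall g : T -> R, measurable_fun setT g ->
  forall t x y, g (s (s t x) y) = g (s (s t y) x).
Implicit Types g h : T -> R.

Let c := fine (nu setT).

Variable e : R.
Hypotheses (e0 : 0 <= e) (ec1 : e * c <= 1).

Let K := bernoulli_step nu s e.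

(** By [sC] a measurable function does not notice in which order points are added, so steps commute
    with the insertion of a fixed point. *)
Lemma iter_bernoulli_step_shift n g t x : bounded_measurable g ->
  iter n K g (s t x) = iter n K (fun t => g (s t x)) t.
Proof.
move=> bg; elim: n t => //= n IH t; rewrite /K /bernoulli_step /shift_integral -/K.
rewrite IH; congr (_ + e * _); apply: eq_Rintegral => y _.
rewrite -IH; apply: sC.
by case: (bounded_measurable_iter_bernoulli_step nu ms e n bg).
Qed.

(** This is Fubini's theorem for the new point and the parameter [x]. *)
Lemma integral_bernoulli_step (u : X * T -> R) t : bounded_measurable u ->
  \int[nu]_x K (fun t => u (x, t)) t = K (fun t => \int[nu]_x u (x, t)) t.
Proof.
move=> bu; have [mu [M uM]] := bu.
have b1 t' : bounded_measurable (fun x => u (x, t')).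
  by split; [exact: measurableT_comp|exists M].
have b2 x : bounded_measurable (fun t => u (x, t)).
  by split; [exact: measurableT_comp|exists M].
have b3 : bounded_measurable (fun z : X * X => u (z.1, s t z.2)).
  apply: (@bounded_measurable_comp _ _ _ _ _ (fun z : X * X => (z.1, s t z.2))) bu.
  apply: measurable_fun_pair; first exact: measurable_fst.
  exact: measurableT_comp (measurableT_comp ms (pair1_measurable t)) measurable_snd.
have b4 := bounded_measurable_Rintegral_param nu b3.
rewrite /K /bernoulli_step /shift_integral.
rewrite RintegralD//; last 2 first.
- by apply/bounded_measurable_integrable/bounded_measurableZ; exact: b1.
- by apply/bounded_measurable_integrable/bounded_measurableZ; exact: b4.
rewrite !RintegralZl//; last 2 first.
- exact: bounded_measurable_integrable.
- by apply/bounded_measurable_integrable; exact: b1.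
congr (_ + e * _).
exact: Rintegral_swap b3.
Qed.

(** Pairing the state with an inert parameter allows the same steps to run on the larger space,
    which gives the measurability of the iterates jointly in the parameter and the state. *)
Let sx (z : X * T) (x : X) : X * T := (z.1, s z.2 x).

Let Kx := bernoulli_step nu sx e.

Let msx : measurable_fun setT (fun z : (X * T) * X => sx z.1 z.2).
Proof.
apply: (@measurable_fun_pair _ _ _ _ _ _ (fun z => z.1.1) (fun z : (X * T) * X => s z.1.2 z.2)); first exact: measurableT_comp measurable_fst measurable_fst.
have H : measurable_fun setT (fun z : (X * T) * X => (z.1.2, z.2)).
  apply: measurable_fun_pair; last exact: measurable_snd.
  exact: measurableT_comp measurable_snd measurable_fst.
exact: (measurableT_comp ms H).
Qed.

Let iter_KxE n (u : X * T -> R) x t :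
  iter n Kx u (x, t) = iter n K (fun t => u (x, t)) t.
Proof.
elim: n t => //= n IH t; rewrite /Kx /K /bernoulli_step -/Kx -/K IH.
by congr (_ + e * _); apply: eq_Rintegral => y _; rewrite IH.
Qed.

Lemma bounded_measurable_iter_param n (u : X * T -> R) t : bounded_measurable u ->
  bounded_measurable (fun x => iter n K (fun t => u (x, t)) t).
Proof.
move=> bu; have H := bounded_measurable_iter_bernoulli_step nu msx e n bu.
have -> : (fun x => iter n K (fun t => u (x, t)) t) = (fun x => iter n Kx u (x, t)).
  by apply/funext => x; rewrite iter_KxE.
exact: (bounded_measurable_comp (pair2_measurable t) H).
Qed.

Lemma integral_iter_bernoulli_step n (u : X * T -> R) t : bounded_measurable u ->
  \int[nu]_x iter n K (fun t => u (x, t)) t = iter n K (fun t => \int[nu]_x u (x, t)) t.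
Proof.
elim: n u => // n IH u bu.
have bK : bounded_measurable (fun z : X * T => K (fun t => u (z.1, t)) z.2).
  have -> : (fun z : X * T => K (fun t => u (z.1, t)) z.2) = Kx u.
    by apply/funext => -[x t'].
  exact: (bounded_measurable_bernoulli_step nu msx e bu).
under eq_Rintegral do rewrite iterSr.
rewrite iterSr (IH _ bK); congr (iter n K _ t).
by apply/funext => t'; rewrite /= integral_bernoulli_step.
Qed.

Variable p : R.
Hypothesis p12 : 1 <= p <= 2.
Let p1 : 1 <= p. Proof. by case/andP: p12. Qed.
Let p0 : 0 <= p. Proof. exact: le_trans p1. Qed.

Definition bregman_energy g : T -> R :=
  fun t => \int[nu]_x bregman_power p (g (s t x)) (g t).

Variable dl : R.
Hypothesis dl0 : 0 < dl.

Lemma bounded_measurable_bregman_shift g : bounded_measurable g ->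
  (forall t, dl <= g t) ->
  bounded_measurable (fun z : X * T => bregman_power p (g (s z.2 z.1)) (g z.2)).
Proof.
move=> bg dg.
have g0 t : 0 <= g t by rewrite (le_trans (ltW dl0)).
have mswap : measurable_fun setT (fun z : X * T => s z.2 z.1).
  exact: (measurableT_comp ms (@measurable_swap _ _ X T)).
apply: bounded_measurable_bregman => //.
  exact: bounded_measurable_comp bg.
exact: (bounded_measurable_comp measurable_snd bg).
Qed.

Lemma bounded_measurable_bregman_energy g : bounded_measurable g ->
  (forall t, dl <= g t) -> bounded_measurable (bregman_energy g).
Proof.
move=> bg dg.
have := bounded_measurable_bregman_shift bg dg.
move/(bounded_measurable_comp (@measurable_swap _ _ T X)).
exact: (bounded_measurable_Rintegral_param nu).
Qed.

(** The step moves [h] by [e] times the integral of the increments [h (s t x) - h t], and [h ^ p]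
    likewise. Bounding [(K h) ^ p] below by the tangent of the power at [h t] leaves exactly [e]
    times the integrated divergence. *)
Lemma bernoulli_step_powR h t : bounded_measurable h -> (forall t, dl <= h t) ->
  K (fun t => h t `^ p) t <= K h t `^ p + e * bregman_energy h t.
Proof.
move=> bh dh.
have h0 u : 0 < h u by rewrite (lt_le_trans dl0).
have bhp : bounded_measurable (fun t => h t `^ p).
  by apply: bounded_measurable_powR => // u; exact: ltW.
have Kh0 : 0 < K h t by rewrite (lt_le_trans dl0)//; exact: bernoulli_step_ge.
have := powR_bernoulli p1 (h0 t) Kh0.
have -> : bregman_energy h t = shift_integral nu s (fun t => h t `^ p) t - h t `^ p * c -
    p * h t `^ (p - 1) * (shift_integral nu s h t - h t * c).
  rewrite /bregman_energy /bregman_power /shift_integral.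
  have i1 := bounded_measurable_integrable nu (bounded_measurable_shift ms t bhp).
  have i2 := bounded_measurable_integrable nu (bounded_measurable_shift ms t bh).
  have ic r : nu.-integrable setT (EFin \o (fun _ : X => r)).
    by apply: bounded_measurable_integrable; exact: bounded_measurable_cst.
  have i3 : nu.-integrable setT (EFin \o (fun x => h (s t x) - h t)).
    apply: bounded_measurable_integrable; apply: bounded_measurableB.
      exact: (bounded_measurable_shift ms t bh).
    exact: bounded_measurable_cst.
  rewrite RintegralB//; last 2 first.
  - apply: bounded_measurable_integrable; apply: bounded_measurableB.
      exact: (bounded_measurable_shift ms t bhp).
    exact: bounded_measurable_cst.
  - apply: bounded_measurable_integrable; apply: bounded_measurableZ.
    apply: bounded_measurableB; first exact: (bounded_measurable_shift ms t bh).
    exact: bounded_measurable_cst.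
  by rewrite RintegralB// RintegralZl// RintegralB// !Rintegral_cst.
rewrite {1 3}/K /bernoulli_step -/c.
move: (shift_integral _ _ _ _) (shift_integral _ _ _ _) (h t `^ p) (h t `^ (p - 1)) (K h t `^ p) => *.
lra.
Qed.

(** Each step costs [e] times the energy of the current iterate of [g]. Joint convexity, together
    with the commutation of steps with shifts and integrals, bounds that energy by the averaged
    energy of [g] itself, so the costs simply add up. The energy of the first step is not averaged,
    hence one iteration fewer in the last term. *)
Theorem beckner_iter n g t : bounded_measurable g -> (forall t, dl <= g t) ->
  iter n.+1 K (fun t => g t `^ p) t <=
  iter n.+1 K g t `^ p + n.+1%:R * e * iter n K (bregman_energy g) t.
Proof.
move=> bg dg; have bE := bounded_measurable_bregman_energy bg dg.
have bgp : bounded_measurable (fun t => g t `^ p).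
  by apply: bounded_measurable_powR => // u; rewrite (le_trans (ltW dl0)).
elim: n t => [|n IH] t; first by rewrite /= mul1r; exact: bernoulli_step_powR.
set h := iter n.+1 K g.
have bh : bounded_measurable h by exact: bounded_measurable_iter_bernoulli_step.
have dh u : dl <= h u by exact: iter_bernoulli_step_ge.
have bhp : bounded_measurable (fun t => h t `^ p).
  by apply: bounded_measurable_powR => // u; rewrite (le_trans (ltW dl0)).
have bnE : bounded_measurable (iter n K (bregman_energy g)).
  exact: bounded_measurable_iter_bernoulli_step.
rewrite -[X in X <= _]/(K (iter n.+1 K (fun t => g t `^ p)) t); apply: le_trans.
  apply: (@le_bernoulli_step _ _ _ _ _ nu s ms e e0 ec1 _
     (fun t => h t `^ p + n.+1%:R * e * iter n K (bregman_energy g) t)) => //.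
  - exact: bounded_measurable_iter_bernoulli_step.
  - by apply: bounded_measurableD => //; exact: bounded_measurableZ.
rewrite bernoulli_stepD//; last exact: bounded_measurableZ.
rewrite bernoulli_stepZ// -/K -[K (iter n K _) t]/(iter n.+1 K _ t).
have H1 := bernoulli_step_powR t bh dh.
have H2 : bregman_energy h t <= iter n.+1 K (bregman_energy g) t.
  have bS := bounded_measurable_bregman_shift bg dg.
  have -> : bregman_energy g = fun t => \int[nu]_x (fun z : X * T =>
     bregman_power p (g (s z.2 z.1)) (g z.2)) (x, t) by [].
  rewrite -(integral_iter_bernoulli_step n.+1 t bS).
  apply: le_Rintegral => //.
  - apply: bounded_measurable_integrable.
    have := bounded_measurable_bregman_shift bh dh.
    move=> /(@bounded_measurable_comp _ _ _ _ _ (fun x => (x, t))); apply.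
    exact: pair2_measurable.
  - by apply: bounded_measurable_integrable; exact: (bounded_measurable_iter_param n.+1 t bS).
  move=> x _; rewrite /h iter_bernoulli_step_shift//.
  apply: (iter_bernoulli_step_bregman ms e0 ec1 p12 n.+1 t dl0) => //.
  by apply: bounded_measurable_comp bg; exact: (measurableT_comp ms (pair2_measurable x)).
rewrite -[iter n.+2 K g t]/(K h t).
have := ler_wpM2l e0 H2.
rewrite -[n.+2%:R](natr1 n.+1) mulrDl mul1r mulrDl => H3.
set A := K _ t in H1 *; set B := iter n.+1 K _ t in H3 *.
by move: H1 H3; move: A B (K h t `^ p) (bregman_energy h t) (n.+1%:R) => *; lra.
Qed.

End local_beckner.

(** * From binomial sums to Poisson sums *)

(** Dominated convergence for the counting measure. *)
Lemma tannery (R : realType) (a : nat -> nat -> R) (b l : nat -> R) :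
  (forall n k, (0 <= a n k <= b k)%R) ->
  (forall k, a n k @[n --> \oo] --> l k) ->
  \sum_(k <oo) (b k)%:E < +oo ->
  \sum_(k <oo) (a n k)%:E @[n --> \oo] --> \sum_(k <oo) (l k)%:E.
Proof.
move=> ab al boo.
have a0 n k : (0 <= a n k)%R by case/andP: (ab n k).
have b0 k : (0 <= b k)%R by case/andP: (ab 0%N k) => /le_trans; exact.
have l0 k : (0 <= l k)%R.
  by rewrite -(cvg_lim _ (al k))//; apply: limr_ge; [apply/cvg_ex; exists (l k)|exact: nearW].
rewrite -ge0_integral_count; last by move=> k; rewrite lee_fin.
rewrite (_ : (fun n => _) = (fun n => \int[counting]_k (a n k)%:E)); last first.
  by apply/funext => n; rewrite ge0_integral_count// => k; rewrite lee_fin.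
have ib : counting.-integrable [set: nat] (fun k => (b k)%:E).
  apply/integrableP; split=> //; rewrite (eq_integral (fun k => (b k)%:E)); last first.
    by move=> k _; rewrite gee0_abs// lee_fin.
  by rewrite ge0_integral_count// => k; rewrite lee_fin.
have cv : {ae (counting : {measure set nat -> \bar R}), forall k, [set: nat] k -> (a n k)%:E @[n --> \oo] --> (l k)%:E}.
  by apply: aeW => k _; apply: cvg_EFin; [exact: nearW|exact: al].
have dom : {ae (counting : {measure set nat -> \bar R}), forall k, forall n, [set: nat] k -> `|(a n k)%:E| <= (b k)%:E}.
  by apply: aeW => k n _; rewrite gee0_abs ?lee_fin//; case/andP: (ab n k).
have mf n : measurable_fun [set: nat] (fun k => (a n k)%:E) by [].
by have [_ _] := dominated_convergence measurableT mf (fun _ _ _ => I) cv ib dom.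
Qed.

Section poisson_limit.
Local Open Scope ring_scope.
Variable R : realType.
Implicit Types (c : R) (t : nat -> R).

(** It is used with [q = 1 - e * c]. The weights then sum to one only after multiplication by
    [c ^ k]; this factor is carried by [t k], since the positions of [k] points are integrated
    against an unnormalised measure of mass [c]. *)
Definition binomial_sum n (e q : R) t :=
  \sum_(k < n.+1) 'C(n, k)%:R * e ^+ k * q ^+ (n - k) * t k.

Lemma binomial_sum_recurrence n (e q : R) t :
  binomial_sum n.+1 e q t = q * binomial_sum n e q t + e * binomial_sum n e q (t \o succn).
Proof.
rewrite /binomial_sum !mulr_sumr.
rewrite big_ord_recl /= bin0 expr0 !mul1r subn0.
under eq_bigr => i _ do rewrite /bump /= add1n binS natrD !mulrDl subSS.
rewrite big_split/= addrA; congr (_ + _); last first.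
  by apply: eq_bigr => i _; rewrite exprS; ring.
rewrite [RHS]big_ord_recl/= bin0 expr0 !mul1r subn0 exprS mulrA; congr (_ + _).
rewrite big_ord_recr/= bin_small// !mul0r addr0.
apply: eq_bigr => i _; rewrite /bump /= add1n.
have -> : q ^+ (n - i) = q * q ^+ (n - i.+1) by rewrite -exprS subnSK.
ring.
Qed.

Lemma cvg_divn c : (n%:R^-1 * c : R) @[n --> \oo] --> (0 : R).
Proof.
rewrite -[X in _ --> X](mul0r c); apply: cvgM; last exact: cvg_cst.
rewrite -(cvg_shiftS (fun n => n%:R^-1 : R)); exact: cvg_harmonic.
Qed.

Lemma cvg_1Bdivn c : (1 - n%:R^-1 * c : R) @[n --> \oo] --> (1 : R).
Proof.
rewrite -[X in _ --> X](subr0 1); apply: cvgB; [exact: cvg_cst|exact: cvg_divn].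
Qed.

Lemma near_divn_lt1 c : \forall n \near \oo, (n%:R^-1 * c : R) < 1.
Proof. by have := cvg_divn c; move=> /cvgr_lt; apply; exact: ltr01. Qed.

(** With [x = c / n], the bound [1 + y <= exp y] at [y = - x] and at [y = x / (1 - x)] squeezes
    [1 - x] between [exp (- x / (1 - x))] and [exp (- x)]. *)
Lemma cvg_1Bdivn_expn c : 0 <= c ->
  ((1 - n%:R^-1 * c) ^+ n : R) @[n --> \oo] --> expR (- c).
Proof.
move=> c0; apply: (@squeeze_cvgr _ _ _ _ (fun n => expR (- (c / (1 - n%:R^-1 * c))))
  (fun=> expR (- c))); last exact: cvg_cst; last first.
  apply: (@continuous_cvg _ _ _ _ _ _ expR); first exact: continuous_expR.
  apply: cvgN; rewrite -[X in _ --> X](divr1 c); apply: cvgM; first exact: cvg_cst.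
  by apply: cvgV; [exact: oner_neq0|exact: cvg_1Bdivn].
near=> n.
have n0 : 0 < n%:R :> R by rewrite ltr0n; near: n; exact: nbhs_infty_gt.
have x1 : n%:R^-1 * c < 1 by near: n; exact: near_divn_lt1.
have x10 : 0 < 1 - n%:R^-1 * c by rewrite subr_gt0.
have nc : n%:R * (n%:R^-1 * c) = c by rewrite mulrA divff ?mul1r ?gt_eqF.
apply/andP; split; last first.
  have -> : expR (- c) = expR (- (n%:R^-1 * c)) ^+ n by rewrite -expRM_natl mulrN nc.
  by rewrite lerXn2r ?nnegrE ?expR_ge0 ?(ltW x10)//; exact: expR_ge1Dx.
have -> : expR (- (c / (1 - n%:R^-1 * c))) = expR (- (n%:R^-1 * c / (1 - n%:R^-1 * c))) ^+ n.
  by rewrite -expRM_natl mulrN mulrA nc.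
rewrite lerXn2r ?nnegrE ?expR_ge0 ?(ltW x10)//.
rewrite expRN invf_ple ?posrE ?expR_gt0//; apply: le_trans (expR_ge1Dx _).
rewrite -[X in _ <= X + _](divff (lt0r_neq0 x10)) -mulrDl subrK.
by rewrite mul1r.
Unshelve. all: by end_near. Qed.

Lemma cvg_ffact_ratio k : ((n ^_ k)%:R * n%:R^-1 ^+ k : R) @[n --> \oo] --> (1 : R).
Proof.
elim: k => [|k IH].
  by under eq_cvg do rewrite ffactn0 expr0 mulr1; exact: cvg_cst.
have H : ((n - k)%:R * n%:R^-1 : R) @[n --> \oo] --> (1 : R).
  apply: cvg_trans (cvg_1Bdivn k%:R); apply: near_eq_cvg; near=> n.
  have n0 : 0 < n%:R :> R by rewrite ltr0n; near: n; exact: nbhs_infty_gt.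
  rewrite natrB; last by near: n; exact: nbhs_infty_ge.
  by rewrite mulrBl divff ?gt_eqF// mulrC.
rewrite -[X in _ --> X](mulr1 1); under eq_cvg do rewrite ffactnSr natrM exprSr mulrACA.
exact: cvgM.
Unshelve. all: by end_near. Qed.

Lemma cvg_binomial_weight c k : 0 <= c ->
  ('C(n, k)%:R * n%:R^-1 ^+ k * (1 - n%:R^-1 * c) ^+ (n - k) : R) @[n --> \oo]
  --> expR (- c) / k`!%:R.
Proof.
move=> c0.
have k0 : k`!%:R != 0 :> R by rewrite pnatr_eq0 -lt0n fact_gt0.
have H1 : (k`!%:R^-1 * ((n ^_ k)%:R * n%:R^-1 ^+ k) * ((1 - n%:R^-1 * c) ^+ n *
    ((1 - n%:R^-1 * c) ^+ k)^-1) : R) @[n --> \oo] --> k`!%:R^-1 * 1 * (expR (- c) * (1 ^+ k)^-1).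
  apply: cvgM; first by apply: cvgM; [exact: cvg_cst|exact: cvg_ffact_ratio].
  apply: cvgM; first exact: cvg_1Bdivn_expn.
  apply: cvgV; first by rewrite expr1n oner_neq0.
  apply: (@continuous_cvg _ _ _ _ _ _ (fun x : R => x ^+ k)); last exact: cvg_1Bdivn.
  exact: exprn_continuous.
move: H1; rewrite mulr1 expr1n invr1 mulr1 mulrC; apply: cvg_trans.
apply: near_eq_cvg; near=> n.
have x1 : n%:R^-1 * c < 1 by near: n; exact: near_divn_lt1.
have x10 : 1 - n%:R^-1 * c != 0 by rewrite gt_eqF// subr_gt0.
have kn : (k <= n)%N by near: n; exact: nbhs_infty_ge.
rewrite -bin_ffact natrM -[X in _ * (X ^+ n * _)]/(1 - n%:R^-1 * c).
have -> : (1 - n%:R^-1 * c) ^+ n = (1 - n%:R^-1 * c) ^+ (n - k) * (1 - n%:R^-1 * c) ^+ k.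
  by rewrite -exprD subnK.
by rewrite mulfK ?expf_neq0//; field.
Unshelve. all: by end_near. Qed.

(** The uniformity in [n] provides the summable dominating sequence for [tannery]. *)
Lemma binomial_weight_le c n k : 0 <= n%:R^-1 * c <= 1 ->
  'C(n, k)%:R * n%:R^-1 ^+ k * (1 - n%:R^-1 * c) ^+ (n - k) <= k`!%:R^-1 :> R.
Proof.
move=> /andP[x0 x1].
have k0 : 0 < k`!%:R :> R by rewrite ltr0n fact_gt0.
have H : 'C(n, k)%:R * n%:R^-1 ^+ k <= k`!%:R^-1 :> R.
  rewrite -(ler_pM2l k0) divff ?gt_eqF// mulrA -natrM mulnC bin_ffact.
  have [->|n0] := eqVneq n 0%N.
    by case: k {k0} => [|k]; rewrite ?ffactn0 ?expr0 ?mulr1// ffact0n mul0r ler01.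
  rewrite exprVn ler_pdivrMr ?mul1r ?exprn_gt0 ?ltr0n ?lt0n// -natrX ler_nat.
  elim: k {k0} => [|k IH]; first by rewrite ffactn0.
  by rewrite ffactnSr expnSr leq_mul// leq_subr.
rewrite -[X in _ <= X]mulr1 ler_pM// ?mulr_ge0 ?exprn_ge0 ?invr_ge0 ?subr_ge0//.
by rewrite exprn_ile1 ?subr_ge0// lerBlDr lerDl.
Qed.

Lemma expR_eseries c : 0 <= c ->
  (\sum_(k <oo) (c ^+ k / k`!%:R)%:E = (expR c)%:E)%E.
Proof.
move=> c0; rewrite expRE -EFin_lim; last first.
  by rewrite /pseries/=; under eq_fun do rewrite mulrC; exact: is_cvg_series_exp_coeff.
apply/congr_lim/funext => n/=; rewrite /pseries/= /series/= -sumEFin//.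
by under eq_bigr do rewrite mulrC.
Qed.

Lemma binomial_sumE n (e q : R) t : 0 <= e -> 0 <= q -> (forall k, 0 <= t k) ->
  ((binomial_sum n e q t)%:E =
   \sum_(k <oo) ('C(n, k)%:R * e ^+ k * q ^+ (n - k) * t k)%:E)%E.
Proof.
move=> e0 q0 t0; rewrite (nneseries_split 0 n.+1)//; last first.
  by move=> k _; rewrite lee_fin !mulr_ge0 ?exprn_ge0.
rewrite eseries0 ?adde0; last first.
  by move=> k; rewrite add0n => nk _; rewrite bin_small// !mul0r.
by rewrite add0n sumEFin big_mkord.
Qed.

Lemma poisson_sum_fin c (M : R) t : 0 <= c -> (forall k, 0 <= t k <= M * c ^+ k) ->
  (\sum_(k <oo) (t k / k`!%:R)%:E)%E \is a fin_num.
Proof.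
move=> c0 tM; have M0 : 0 <= M.
  by have /andP[/le_trans/[apply]] := tM 0%N; rewrite expr0 mulr1.
rewrite ge0_fin_numE; last first.
  by apply: nneseries_ge0 => k _ _; rewrite lee_fin divr_ge0//; case/andP: (tM k).
apply: (@le_lt_trans _ _ (\sum_(k <oo) (M%:E * (c ^+ k / k`!%:R)%:E))%E).
  apply: lee_nneseries => k _.
    by rewrite lee_fin divr_ge0//; case/andP: (tM k).
  by rewrite lee_fin mulrA ler_wpM2r//; case/andP: (tM k).
rewrite nneseriesZl//; last by move=> k _; rewrite lee_fin divr_ge0// exprn_ge0.
by rewrite expR_eseries// -EFinM ltry.
Qed.

(** The shift by [m >= c] keeps [1 - c / (n + m)] nonnegative for every [n], so that the domination
    holds from the start of the sequence. *)
Lemma cvg_binomial_sum c (M : R) t m : 0 <= c -> c <= m%:R ->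
  (forall k, 0 <= t k <= M * c ^+ k) ->
  binomial_sum (n + m) (n + m)%:R^-1 (1 - (n + m)%:R^-1 * c) t @[n --> \oo] -->
  expR (- c) * fine (\sum_(k <oo) (t k / k`!%:R)%:E)%E.
Proof.
move=> c0 cm tM; have t0 k : 0 <= t k by case/andP: (tM k).
have M0 : 0 <= M by have /andP[/le_trans/[apply]] := tM 0%N; rewrite expr0 mulr1.
have x01 n : 0 <= (n + m)%:R^-1 * c <= 1.
  have [->|nm] := eqVneq (n + m)%N 0%N; first by rewrite invr0 mul0r lexx ler01.
  rewrite mulr_ge0 ?invr_ge0//= mulrC ler_pdivrMr ?ltr0n ?lt0n// mul1r.
  by rewrite (le_trans cm)// ler_nat leq_addl.
have fS := poisson_sum_fin c0 tM.
pose a n k := 'C(n + m, k)%:R * (n + m)%:R^-1 ^+ k * (1 - (n + m)%:R^-1 * c) ^+ (n + m - k) * t k.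
have := @tannery R a (fun k => M * c ^+ k / k`!%:R) (fun k => expR (- c) / k`!%:R * t k).
have -> : (\sum_(k <oo) (expR (- c) / k`!%:R * t k)%:E =
    (expR (- c) * fine (\sum_(k <oo) (t k / k`!%:R)%:E)%E)%:E)%E.
  rewrite EFinM fineK// -nneseriesZl//; last first.
    by move=> k _; rewrite lee_fin divr_ge0.
  by apply: eq_eseriesr => k _; rewrite -EFinM mulrAC -mulrA.
have -> : (fun n => (\sum_(k <oo) (a n k)%:E)%E) = (fun n =>
    (binomial_sum (n + m) (n + m)%:R^-1 (1 - (n + m)%:R^-1 * c) t)%:E).
  by apply/funext => n; rewrite binomial_sumE// subr_ge0; case/andP: (x01 n).
move=> H; apply: (fine_cvg (H _ _ _)) => {H} [n k|k|].
- rewrite /a; apply/andP; split.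
    by rewrite !mulr_ge0 ?exprn_ge0// subr_ge0; case/andP: (x01 n).
  rewrite mulrC; apply: ler_pM => //; last exact: binomial_weight_le.
    by rewrite !mulr_ge0 ?exprn_ge0// subr_ge0; case/andP: (x01 n).
  by case/andP: (tM k).
- apply: cvgM; last exact: cvg_cst.
  by have := cvg_binomial_weight (k := k) c0; rewrite -(cvg_shiftn m).
under eq_eseriesr do rewrite -mulrA EFinM.
rewrite nneseriesZl//; last by move=> k _; rewrite lee_fin divr_ge0// exprn_ge0.
by rewrite expR_eseries// -EFinM ltry.
Qed.

End poisson_limit.

(** * Poisson means and the local Beckner inequality *)

Section poisson_mean.
Local Open Scope ring_scope.
Context dT (T : measurableType dT) dX (X : measurableType dX) (R : realType).
Variable nu : {finite_measure set X -> \bar R}.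
Variable s : T -> X -> T.
Hypothesis ms : measurable_fun setT (fun z : T * X => s z.1 z.2).
Hypothesis sC : forall g : T -> R, measurable_fun setT g ->
  forall t x y, g (s (s t x) y) = g (s (s t y) x).
Implicit Types g h : T -> R.

Let c := fine (nu setT).
Let U := shift_integral nu s.

Let c0 : 0 <= c. Proof. exact: fine_ge0. Qed.

Lemma bounded_measurable_iter_shift_integral k g : bounded_measurable g ->
  bounded_measurable (iter k U g).
Proof.
by move=> bg; elim: k => //= k IH; exact: bounded_measurable_shift_integral.
Qed.

(* The mean of [g] over the configurations obtained from [t] by adding the
   points of a Poisson process with intensity [nu]. *)
Definition poisson_mean g t : R :=
  expR (- c) * fine (\sum_(k <oo) (iter k U g t / k`!%:R)%:E)%E.

(** The binomial expansion of a power of the operator [(1 - e * c) id + e U], whose two summands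
    commute. *)
Lemma iter_bernoulli_step_binomial e n g t : bounded_measurable g ->
  iter n (bernoulli_step nu s e) g t =
  binomial_sum n e (1 - e * c) (fun k => iter k U g t).
Proof.
elim: n g => [|n IH] g bg.
  by rewrite /binomial_sum big_ord1 bin0 !expr0 !mul1r.
have bU : bounded_measurable (U g) by exact: bounded_measurable_shift_integral.
rewrite iterSr binomial_sum_recurrence.
have -> : (fun k => iter k U g t) \o succn = fun k => iter k U (U g) t.
  by apply/funext => k; rewrite /= -iterSr.
rewrite -!IH//.
elim: n {IH} t => [|n IHn] t //=.
have b1 := bounded_measurable_iter_bernoulli_step nu ms e n bg.
have b2 := bounded_measurable_iter_bernoulli_step nu ms e n bU.
rewrite (_ : iter n _ (bernoulli_step nu s e g) = fun t =>
    (1 - e * c) * iter n (bernoulli_step nu s e) g t +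
    e * iter n (bernoulli_step nu s e) (U g) t); last exact/funext.
by rewrite bernoulli_stepD ?bernoulli_stepZ//; exact: bounded_measurableZ.
Qed.

Lemma iter_shift_integral_bound g M : bounded_measurable g ->
  (forall t, 0 <= g t <= M) -> forall k t, 0 <= iter k U g t <= M * c ^+ k.
Proof.
move=> bg gM; elim=> [|k IH] t; first by rewrite expr0 mulr1.
have bk := bounded_measurable_iter_shift_integral k bg.
apply/andP; split; first by apply: Rintegral_ge0 => x _; case/andP: (IH (s t x)).
rewrite exprSr mulrA -(shift_integral_cst nu s _ t).
apply: le_shift_integral => //; first exact: bounded_measurable_cst.
by move=> u; case/andP: (IH u).
Qed.

Lemma bounded_ge0 g : bounded_measurable g -> (forall t, 0 <= g t) ->
  exists M, forall t, 0 <= g t <= M.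
Proof.
by move=> [_ [M gM]] g0; exists M => t; rewrite g0 (le_trans (ler_norm _)).
Qed.

(** With this offset every step size [1 / (n + m)] is admissible and no denominator vanishes. *)
Let m := (Num.truncn c).+1.

Let cm : c <= m%:R. Proof. by rewrite ltW// truncnS_gt. Qed.

Let Kn n := bernoulli_step nu s (n + m)%:R^-1.

Let Kn_adm n : (0 <= (n + m)%:R^-1 :> R) /\ (n + m)%:R^-1 * c <= 1.
Proof.
split; first by rewrite invr_ge0.
rewrite mulrC ler_pdivrMr ?ltr0n ?addnS// mul1r (le_trans cm)// ler_nat.
by rewrite -addnS leq_addl.
Qed.

Lemma cvg_poisson_mean g t : bounded_measurable g -> (forall t, 0 <= g t) ->
  iter (n + m) (Kn n) g t @[n --> \oo] --> poisson_mean g t.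
Proof.
move=> bg g0; have [M gM] := bounded_ge0 bg g0.
under eq_cvg do rewrite /Kn iter_bernoulli_step_binomial//.
by apply: (cvg_binomial_sum c0 cm (M := M)) => k; exact: iter_shift_integral_bound.
Qed.

Lemma poisson_mean_ge r g t : bounded_measurable g -> 0 <= r -> (forall t, r <= g t) ->
  r <= poisson_mean g t.
Proof.
move=> bg r0 rg; have g0 u : 0 <= g u by rewrite (le_trans r0).
have H := @cvg_poisson_mean _ t bg g0.
rewrite -(cvg_lim _ H)//; apply: limr_ge; first by apply/cvg_ex; eexists; exact: H.
by apply: nearW => n; have [] := Kn_adm n => e0 ec; exact: iter_bernoulli_step_ge.
Qed.

Lemma le_poisson_mean g h t : bounded_measurable g -> bounded_measurable h ->
  (forall t, 0 <= g t <= h t) -> poisson_mean g t <= poisson_mean h t.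
Proof.
move=> bg bh gh.
have g0 u : 0 <= g u by case/andP: (gh u).
have h0 u : 0 <= h u by case/andP: (gh u) => /le_trans; exact.
apply: (ler_cvg_to (@cvg_poisson_mean _ t bg g0) (@cvg_poisson_mean _ t bh h0)).
apply: nearW => n; have [e0 ec] := Kn_adm n.
by apply: (le_iter_bernoulli_step ms e0 ec) => // u; case/andP: (gh u).
Qed.

Lemma poisson_mean_cst r t : 0 <= r -> poisson_mean (fun=> r) t = r.
Proof.
move=> r0; have := @cvg_poisson_mean (fun=> r) t (bounded_measurable_cst T r) (fun=> r0).
have -> : (fun n => iter (n + m) (Kn n) (fun=> r) t) = fun=> r.
  apply/funext => n; elim: (n + m)%N t => //= k IH t.
  rewrite (_ : iter k (Kn n) (fun=> r) = fun=> r); last exact/funext.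
  exact: bernoulli_step_cst.
by move=> /cvg_lim <-//; exact: lim_cst.
Qed.

Lemma poisson_meanD g h t : bounded_measurable g -> bounded_measurable h ->
  (forall t, 0 <= g t) -> (forall t, 0 <= h t) ->
  poisson_mean (fun t => g t + h t) t = poisson_mean g t + poisson_mean h t.
Proof.
move=> bg bh g0 h0.
have gh0 u : 0 <= g u + h u by rewrite addr_ge0.
have := @cvg_poisson_mean _ t (bounded_measurableD bg bh) gh0.
have -> : (fun n => iter (n + m) (Kn n) (fun t => g t + h t) t) =
    (fun n => iter (n + m) (Kn n) g t + iter (n + m) (Kn n) h t).
  apply/funext => n; elim: (n + m)%N t => //= k IH t.
  rewrite (_ : iter k (Kn n) (fun t => g t + h t) = fun t =>
    iter k (Kn n) g t + iter k (Kn n) h t); last exact/funext.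
  by apply: bernoulli_stepD => //; exact: bounded_measurable_iter_bernoulli_step.
have H2 : iter (n + m) (Kn n) g t + iter (n + m) (Kn n) h t @[n --> \oo] -->
    poisson_mean g t + poisson_mean h t.
  exact: cvgD (@cvg_poisson_mean _ t bg g0) (@cvg_poisson_mean _ t bh h0).
by move=> H1; exact: (cvg_unique _ H1 H2).
Qed.

Lemma bounded_measurable_poisson_mean g : bounded_measurable g ->
  (forall t, 0 <= g t) -> bounded_measurable (poisson_mean g).
Proof.
move=> bg g0; have [M gM] := bounded_ge0 bg g0.
have UM := iter_shift_integral_bound bg gM.
split.
  apply: measurable_funM; first exact: measurable_cst.
  apply: measurableT_comp; first exact: fine_measurable.
  apply: (@ge0_emeasurable_sum _ _ _ _ _ xpredT) => [k t _ _|k _].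
    by rewrite lee_fin divr_ge0//; case/andP: (UM k t).
  apply/measurable_EFinP; apply: measurable_funM; last exact: measurable_cst.
  by case: (bounded_measurable_iter_shift_integral k bg).
exists M => t; rewrite ger0_norm ?poisson_mean_ge//.
have M0 : 0 <= M by case/andP: (gM t) => /le_trans; exact.
rewrite -[X in _ <= X](@poisson_mean_cst M t)//.
by apply: le_poisson_mean => //; exact: bounded_measurable_cst.
Qed.

Variable p : R.
Hypothesis p12 : 1 <= p <= 2.
Variable dl : R.
Hypothesis dl0 : 0 < dl.

(** Taking [n + m] steps of size [1 / (n + m)] makes the factor in front of the energy equal to one.
    The lower bound [dl] keeps the limit of the means positive, where the power is continuous. *)
Theorem local_beckner g t : bounded_measurable g -> (forall t, dl <= g t) ->
  poisson_mean (fun t => g t `^ p) t <=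
  poisson_mean g t `^ p + poisson_mean (bregman_energy nu s p g) t.
Proof.
move=> bg dg.
have p1 : 1 <= p by case/andP: p12.
have p0 : 0 <= p by rewrite (le_trans _ p1).
have g0 u : 0 <= g u by rewrite (le_trans (ltW dl0)).
have bgp : bounded_measurable (fun t => g t `^ p) by exact: bounded_measurable_powR.
have bE := bounded_measurable_bregman_energy nu ms p12 dl0 bg dg.
have E0 u : 0 <= bregman_energy nu s p g u.
  by apply: Rintegral_ge0 => x _; apply: bregman_power_ge0 => //; rewrite (lt_le_trans dl0).
have H1 := @cvg_poisson_mean _ t bgp (fun u => powR_ge0 _ _).
have H2 := @cvg_poisson_mean _ t bg g0.
have H3 := @cvg_poisson_mean _ t bE E0.
have Pg0 : 0 < poisson_mean g t.
  by rewrite (lt_le_trans dl0)// poisson_mean_ge// ltW.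
have H2p : iter (n + m) (Kn n) g t `^ p @[n --> \oo] --> poisson_mean g t `^ p.
  apply: (@continuous_cvg _ _ _ _ _ _ (fun x : R => x `^ p)) H2.
  by apply/differentiable_continuous/derivable1_diffP; have [] := is_derive1_powR p Pg0.
have Hc : 1 - (n + m)%:R^-1 * c @[n --> \oo] --> (1 : R).
  by have := @cvg_1Bdivn R c; rewrite -(cvg_shiftn m).
rewrite -lerBlDl -[X in X <= _]mul1r.
(* The energy in [beckner_iter] is averaged over one step too few. On nonnegative functions a step
   dominates multiplication by [1 - c / (n + m)], so this factor, which tends to [1], supplies the
   missing step. *)
have L : (1 - (n + m)%:R^-1 * c) * (iter (n + m) (Kn n) (fun t => g t `^ p) t -
    iter (n + m) (Kn n) g t `^ p) @[n --> \oo] -->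
    1 * (poisson_mean (fun t => g t `^ p) t - poisson_mean g t `^ p).
  by apply: cvgM => //; exact: cvgB.
apply: (ler_cvg_to L H3); apply: nearW => n.
have [e0 ec1] := Kn_adm n.
have := beckner_iter ms sC e0 ec1 p12 dl0 (n + Num.truncn c) t bg dg.
have nm : (n + m = (n + Num.truncn c).+1)%N by rewrite /m addnS.
rewrite -nm -/(Kn n) mulfV ?mul1r; last by rewrite pnatr_eq0 nm.
rewrite -lerBlDl.
move=> /(ler_wpM2l (_ : 0 <= 1 - (n + m)%:R^-1 * c)); rewrite subr_ge0 => /(_ ec1).
move=> /le_trans; apply.
rewrite [in X in _ <= X]nm /= {2}/Kn /bernoulli_step -/c -[X in X <= _]addr0 lerD2l mulr_ge0//.
apply: Rintegral_ge0 => x _.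
exact: (iter_bernoulli_step_ge ms e0 ec1).
Qed.

End poisson_mean.

(** * Approximation by local functionals *)

Lemma measure_bigsetU_le d (T : measurableType d) (R : realType)
    (mu : {measure set T -> \bar R}) (F : nat -> set T) n :
  (forall i, measurable (F i)) ->
  mu (\big[setU/set0]_(i < n) F i) <= \sum_(i < n) mu (F i).
Proof.
move=> mF; elim: n => [|n IH]; first by rewrite !big_ord0 measure0.
rewrite !big_ord_recr/=; apply: (le_trans (measureU2 _ _ _)) => //.
  by apply: bigsetU_measurable.
exact: leeD2r.
Qed.

Section local_approximation.
Context d (X : measurableType d) (R : realType) dO (Omega : measurableType dO).
Variables (P : probability Omega R) (eta : Omega -> config X R).
Hypothesis meta : measurable_fun setT eta.
Variable A : nat -> set X.
Hypotheses (mA : forall n, measurable (A n)) (ndA : {homo A : n m / (n <= m)%N >-> n `<=` m}).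
Hypothesis AT : \bigcup_n A n = setT.
Implicit Types (S : set (config X R)) (mu : config X R).

Definition agree_on (B : set X) mu mu' :=
  forall C, measurable C -> C `<=` B -> mu C = mu' C.

Definition local_on (B : set X) (T : Type) (f : config X R -> T) :=
  forall mu mu', agree_on B mu mu' -> f mu = f mu'.

Lemma local_on_subset (B C : set X) (T : Type) (f : config X R -> T) :
  B `<=` C -> local_on B f -> local_on C f.
Proof.
by move=> BC lf mu mu' H; apply: lf => D mD DB; apply: H => //; exact: subset_trans BC.
Qed.

Definition set_distance S S' := P (eta @^-1` ((S `\` S') `|` (S' `\` S))).

(** Approximation under the law of [eta] by events that depend only on the restriction to some
    window [A n]. Such sets form a sigma-field, and this yields the density of local events. *)
Definition approximable : set (set (config X R)) :=
  [set S | measurable S /\ forall e : R, (0 < e)%R -> exists n S',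
     [/\ measurable S', local_on (A n) (fun mu => mu \in S') & set_distance S S' <= e%:E]].

Let mpre S : measurable S -> measurable (eta @^-1` S).
Proof. by move=> mS; rewrite -[X in measurable X]setTI; exact: meta. Qed.

Lemma measurable_set_distance S S' : measurable S -> measurable S' ->
  measurable (eta @^-1` ((S `\` S') `|` (S' `\` S))).
Proof. by move=> mS mS'; apply/mpre/measurableU; exact: measurableD. Qed.

Lemma approximable_local n S : measurable S -> local_on (A n) (fun mu => mu \in S) ->
  approximable S.
Proof.
move=> mS lS; split=> // e e0; exists n, S; split => //.
by rewrite /set_distance setDv setU0 preimage_set0 measure0 lee_fin ltW.
Qed.

Lemma approximableC S : approximable S -> approximable (~` S).
Proof.
move=> [mS H]; split; first exact: measurableC.
move=> e /H[n [S' [mS' lS' SS']]]; exists n, (~` S'); split.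
- exact: measurableC.
- by move=> mu mu' /lS'; rewrite !in_setC => ->.
rewrite /set_distance (_ : _ `|` _ = (S `\` S') `|` (S' `\` S))//.
by rewrite !setDE !setCK setUC setIC; congr (_ `|` _); rewrite setIC.
Qed.

(** Half of the error is spent on cutting the union down to finitely many sets, the other half is
    shared among their approximations. *)
Lemma approximable_bigcup (F : nat -> set (config X R)) :
  (forall i, approximable (F i)) -> approximable (\bigcup_i F i).
Proof.
move=> aF; have mF i : measurable (F i) by case: (aF i).
split=> [|e e0]; first exact: bigcupT_measurable.
have e20 : (0 < e / 2)%R by rewrite divr_gt0.
pose G n := \bigcup_(i < n) F i.
have mG n : measurable (G n) by apply: bigcup_measurable.
have GE : \bigcup_n G n = \bigcup_i F i.
  apply/seteqP; split=> mu; first by move=> [n _ [i _ Fi]]; exists i.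
  by move=> [i _ Fi]; exists i.+1 => //; exists i => /=.
(* Continuity from above: what the first [n] sets miss of the union becomes negligible. *)
have cvgG : P (eta @^-1` ((\bigcup_i F i) `\` G n)) @[n --> \oo] --> 0.
  have := @nonincreasing_cvg_mu _ _ _ P (fun n => eta @^-1` ((\bigcup_i F i) `\` G n)).
  rewrite (_ : \bigcap_n _ = set0) ?measure0.
    apply => //.
    - by rewrite ltey_eq fin_num_measure//; apply/mpre/measurableD => //; exact: bigcupT_measurable.
    - by move=> n; apply/mpre/measurableD => //; exact: bigcupT_measurable.
    move=> m n mn; apply/subsetPset => w /= [Uw nGw]; split => // -[i /= im Fi].
    by apply: nGw; exists i => //=; exact: leq_trans mn.
  apply/seteqP; split=> // w H; have [[i _ Fi] _] := H 0%N I.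
  by have [_] := H i.+1 I; apply; exists i => /=.
have [N HN] : exists N, P (eta @^-1` ((\bigcup_i F i) `\` G N)) <= (e / 2)%:E.
  have /fine_cvgP[fin_near] := cvgG.
  move=> /cvgrPdist_le /(_ _ e20) near2.
  have [N _ HN] : \forall n \near \oo, P (eta @^-1` ((\bigcup_i F i) `\` G n)) <= (e / 2)%:E.
    near=> n; have fn : P (eta @^-1` ((\bigcup_i F i) `\` G n)) \is a fin_num by near: n.
    have : (`|0 - fine (P (eta @^-1` ((\bigcup_i F i) `\` G n)))| <= e / 2)%R by near: n.
    by rewrite sub0r normrN ger0_norm ?fine_ge0// -lee_fin fineK.
  by exists N; exact: (HN N (leqnn N)).
have N10 : (0 < e / 2 / N.+1%:R)%R by rewrite divr_gt0.
have /choice[a /choice[S' HS']] : forall i, exists n S', [/\ measurable S',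
    local_on (A n) (fun mu => mu \in S') & set_distance (F i) S' <= (e / 2 / N.+1%:R)%:E].
  by move=> i; have [_ /(_ _ N10)] := aF i.
(* The windows increase, so finitely many local events are all local on the largest of their
   windows. *)
exists (\max_(i < N) a i)%N, (\bigcup_(i < N) S' i); split.
- by apply: bigcup_measurable => i _; case: (HS' i).
- move=> mu mu' H.
  have E i : (i < N)%N -> (mu \in S' i) = (mu' \in S' i).
    move=> iN; have [_ lS _] := HS' i; apply: (local_on_subset _ lS) H.
    by apply: ndA; exact: (leq_bigmax (Ordinal iN)).
  apply/idP/idP; rewrite !inE => -[i /= iN Si]; exists i => //.
    by apply/set_mem; rewrite -E//; exact/mem_set.
  by apply/set_mem; rewrite E//; exact/mem_set.
have mS'i i : measurable (S' i) by case: (HS' i).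
have mS'U : measurable (\bigcup_(i < N) S' i) by apply: bigcup_measurable.
apply: (@le_trans _ _ (P (eta @^-1` ((\bigcup_i F i) `\` G N)) +
    \sum_(i < N) set_distance (F i) (S' i))).
  apply: (@le_trans _ _ (P ((eta @^-1` ((\bigcup_i F i) `\` G N)) `|`
     \big[setU/set0]_(i < N) (eta @^-1` ((F i `\` S' i) `|` (S' i `\` F i)))))).
    apply: le_measure; rewrite ?inE.
    - by apply: measurable_set_distance => //; exact: bigcupT_measurable.
    - apply: measurableU.
        by apply/mpre/measurableD => //; exact: bigcupT_measurable.
      by apply: bigsetU_measurable => i _; exact: measurable_set_distance.
    rewrite -(bigcup_mkord N (fun i => eta @^-1` ((F i `\` S' i) `|` (S' i `\` F i)))).
    move=> w /= [[[i _ Fi] nS]|[[i iN Si] nF]].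
      have [[j jN Fj]|nG] := pselect (G N (eta w)); last by left; split => //; exists i.
      right; exists j => //=; left; split => // Sj; apply: nS; exists j => //.
    right; exists i => //=; right; split => // Fi; apply: nF; exists i => //.
  apply: (le_trans (measureU2 _ _ _)).
  - by apply/mpre/measurableD => //; exact: bigcupT_measurable.
  - by apply: bigsetU_measurable => i _; exact: measurable_set_distance.
  rewrite leeD2l// /set_distance.
  apply: (measure_bigsetU_le P (F := fun i => eta @^-1` ((F i `\` S' i) `|` (S' i `\` F i)))).
  by move=> i; exact: measurable_set_distance.
rewrite (splitr e) EFinD leeD//.
apply: (@le_trans _ _ (\sum_(i < N) (e / 2 / N.+1%:R)%:E)).
  by apply: lee_sum => i _; case: (HS' i).
rewrite sumEFin lee_fin big_const_ord iter_addr_0 -[X in (_ <= X)%R](@divfK _ N.+1%:R) ?pnatr_eq0//.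
by rewrite -[leLHS]mulr_natr ler_wpM2l ?ler_nat// ltW.
Unshelve. all: by end_near. Qed.

Lemma approximable_measurable S : measurable S -> approximable S.
Proof.
move=> mS; suff : @measurable _ (config X R) `<=` approximable by exact.
have SA : sigma_algebra setT approximable.
  split; first by apply: (@approximable_local 0%N) => // mu mu' _; rewrite !in_set0.
    by move=> C aC; rewrite setTD; exact: approximableC.
  exact: approximable_bigcup.
apply: smallest_sub => // _ [B mB [U mU <-]]; rewrite setTI.
(* For fixed [B] the admissible value sets [U] form a sigma-field, so it suffices to treat the rays
   that generate the sigma-field of the extended line. *)
pose D := [set U : set (\bar R) | measurable U /\ approximable (config_ev B @^-1` U)].
suff : @measurable _ (\bar R) `<=` D by move=> /(_ _ mU)[].
rewrite [X in X `<=` _](_ : _ = <<s @ErealGenOInfty.G R >>); last first.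
  exact: ErealGenOInfty.measurableE.
apply: smallest_sub.
  have [SA0 SAC SAU] := SA; split.
  - by split => //; rewrite preimage_set0.
  - move=> V [mV aV]; split; first exact: measurableD.
    by rewrite setTD preimage_setC -setTD; exact: SAC.
  - move=> F aF; split; first by apply: bigcupT_measurable => i; case: (aF i).
    by rewrite preimage_bigcup; apply: SAU => i; case: (aF i).
move=> _ [x ->]; split; first exact: emeasurable_itv.
have mBA n : measurable (B `&` A n) by exact: measurableI.
(* The ray is open at [x] and contains the value [+oo]. Since [mu B] is the increasing limit of the
   masses of [B] in the windows, it exceeds [x] exactly when one of them does. *)
have -> : config_ev B @^-1` `]x%:E, +oo[%classic =
    \bigcup_n (config_ev (B `&` A n) @^-1` `]x%:E, +oo[%classic).
  apply/seteqP; split=> mu /=; rewrite /config_ev /=; last first.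
    move=> [n _ /=]; rewrite !in_itv/= !andbT => /lt_le_trans; apply.
    by apply: le_measure; rewrite ?inE.
  rewrite in_itv/= andbT => xB; apply: contrapT => H.
  have := @nondecreasing_cvg_mu _ _ _ mu (fun n => B `&` A n) mBA.
  rewrite -setI_bigcupr AT setIT => /(_ mB) cv.
  have {}cv : mu (B `&` A n) @[n --> \oo] --> mu B.
    by apply: cv => m n mn; apply/subsetPset; apply: setIS; exact: ndA.
  move: xB; apply/negP; rewrite -leNgt -(cvg_lim _ cv)//.
  apply: lime_le; first by apply/cvg_ex; eexists; exact: cv.
  apply: nearW => n; rewrite leNgt; apply/negP => xBn; apply: H.
  by exists n => //=; rewrite in_itv/= andbT.
apply: approximable_bigcup => n; apply: (@approximable_local n).
  rewrite -[X in measurable X]setTI; apply: (measurable_config_ev (mBA n)) => //.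
  exact: emeasurable_itv.
move=> mu mu' H; apply/idP/idP; rewrite !inE /config_ev/=.
  by rewrite H.
by rewrite H.
Qed.

End local_approximation.

(** The sum is the integer part of [u], in the layered form that turns a function into a sum of
    indicators of its level sets. *)
Lemma floor_layers (R : realType) N (u : R) : (0 <= u <= N%:R ->
  0 <= u - \sum_(j < N) (j.+1%:R <= u)%R%:R <= 1)%R.
Proof.
elim: N u => [|N IH] u /andP[u0 uN].
  by rewrite big_ord0 subr0 u0/=; apply: le_trans uN _.
have [u1|u1] := ltP u 1%R.
  rewrite big1 ?subr0 ?u0 ?ltW// => j _; rewrite leNgt (lt_le_trans u1)//.
  by rewrite (ler_nat _ 1).
have /IH : (0 <= u - 1 <= N%:R)%R.
  by rewrite subr_ge0 u1/= lerBlDr natr1.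
rewrite big_ord_recl/= u1 opprD addrA.
under [in X in X -> _]eq_bigr => j _ do rewrite lerBrDr natr1.
by under [in X in _ -> X]eq_bigr => j _ do rewrite /bump/= add1n.
Qed.

Section l1_approximation.
Context d (X : measurableType d) (R : realType) dO (Omega : measurableType dO).
Variables (P : probability Omega R) (eta : Omega -> config X R).
Hypothesis meta : measurable_fun setT eta.
Variable A : nat -> set X.
Hypotheses (mA : forall n, measurable (A n)) (ndA : {homo A : n m / (n <= m)%N >-> n `<=` m}).
Hypothesis AT : \bigcup_n A n = setT.

(** [F] is rounded down to multiples of a mesh [h] above [dl], which costs at most [h <= e / 2], and
    each of the [N] level sets of the rounded function is replaced by a local event. The result
    stays between [dl] and [M] because it is [dl] plus [h] times a sum of [N] indicators. *)
Lemma l1_approximation (F : config X R -> R) dl M e :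
  measurable_fun setT F -> (dl < M)%R -> (forall mu, (dl <= F mu <= M)%R) -> (0 < e)%R ->
  exists n G, [/\ bounded_measurable G, forall mu, (dl <= G mu <= M)%R, local_on (A n) G &
    \int[P]_w `|F (eta w) - G (eta w)|%:E <= e%:E].
Proof.
move=> mF dM dFM e0; pose L := (M - dl)%R.
have L0 : (0 < L)%R by rewrite subr_gt0.
pose N := (Num.truncn (2 * L / e)).+1.
have N0 : (0 < N%:R :> R)%R by rewrite ltr0n.
pose h := (L / N%:R)%R; have h0 : (0 < h)%R by rewrite divr_gt0.
have he : (h <= e / 2)%R.
  rewrite ler_pdivrMr// -ler_pdivrMl ?divr_gt0// invf_div mulrC.
  by rewrite mulrCA mulrA ltW// truncnS_gt.
pose S j := [set mu : config X R | (dl + j.+1%:R * h <= F mu)%R].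
have mS j : measurable (S j).
  rewrite -[X in measurable X]setTI -[S j]/([set mu | _]).
  by apply: measurable_fun_le => //; exact: measurable_cst.
(* Each level set enters with weight [h = L / N], so the [N] errors of this size add up to
   [e / 2]. *)
have e'0 : (0 < e / 2 / L)%R by rewrite !divr_gt0.
have /choice[a /choice[S' HS']] : forall j, exists n S', [/\ measurable S',
    local_on (A n) (fun mu => mu \in S') & set_distance P eta (S j) S' <= (e / 2 / L)%:E].
  by move=> j; have [_ /(_ _ e'0)] := approximable_measurable P meta mA ndA AT (mS j).
have mS' j : measurable (S' j) by case: (HS' j).
pose G mu := (dl + h * \sum_(j < N) \1_(S' j) mu)%R.
pose DS j := (S j `\` S' j) `|` (S' j `\` S j).
have mDS j : measurable (eta @^-1` DS j) by exact: measurable_set_distance.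
have dGM mu : (dl <= G mu <= M)%R.
  rewrite lerDl mulr_ge0 ?sumr_ge0//=; last exact: ltW.
  rewrite -lerBrDl -[leRHS](divfK (lt0r_neq0 N0)) ler_pM2l//.
  rewrite -[X in (_ <= X%:R)%R]card_ord -sum1_card natr_sum; apply: ler_sum => j _.
  by rewrite indicE lern1 leq_b1.
exists (\max_(i < N) a i)%N, G; split.
- split.
    apply: measurable_funD; first exact: measurable_cst.
    apply: measurable_funM; first exact: measurable_cst.
    by apply: measurable_sum => j; exact: measurable_indic.
  exists (`|dl| + `|M|)%R => mu; have /andP[dG GM] := dGM mu.
  rewrite ler_norml; have := ler_norm M; have := ler_norm (- dl).
  by rewrite normrN; have := normr_ge0 M; have := normr_ge0 dl; lra.
- exact: dGM.
- move=> mu mu' H; rewrite /G; congr (_ + _ * _)%R; apply: eq_bigr => j _.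
  rewrite !indicE; congr (nat_of_bool _)%:R; have [_ lS _] := HS' j.
  by apply: (local_on_subset _ lS) H; apply: ndA; exact: (leq_bigmax j).
have FG w : (`|F (eta w) - G (eta w)| <= h + h * \sum_(j < N) \1_(eta @^-1` DS j) w)%R.
  pose u := ((F (eta w) - dl) / h)%R.
  have uN : (0 <= u <= N%:R)%R.
    have /andP[dF FM] := dFM (eta w).
    rewrite /u divr_ge0 ?subr_ge0//=; last exact: ltW.
    rewrite ler_pdivrMr//; by rewrite /h mulrC divfK ?gt_eqF// lerB.
  have := floor_layers uN; set s := (\sum_(j < N) _)%R => su.
  have sE : s = (\sum_(j < N) \1_(S j) (eta w))%R.
    apply: eq_bigr => j _; rewrite indicE; congr (nat_of_bool _)%:R.
    rewrite ler_pdivlMr// lerBrDl.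
    by apply/idP/idP; rewrite inE.
  have -> : (F (eta w) - G (eta w) = h * (u - s) + h * (s - \sum_(j < N) \1_(S' j) (eta w)))%R.
    rewrite /G /u; set z := (\sum_(j < N) _)%R.
    by field; rewrite gt_eqF.
  rewrite (le_trans (ler_normD _ _))// lerD//.
    by case/andP: su => s0 s1; rewrite normrM (gtr0_norm h0) ger0_norm// ger_pMr.
  rewrite normrM (gtr0_norm h0) ler_pM2l// sE -sumrB.
  rewrite (le_trans (ler_norm_sum _ _ _))//; apply: ler_sum => j _.
  rewrite !indicE /DS.
  have [H|H] := boolP (eta w \in S j); have [H'|H'] := boolP (eta w \in S' j);
    rewrite ?subrr ?normr0 ?subr0 ?sub0r ?normrN ?normr1//.
  - by rewrite mem_set//; left; split; [exact: set_mem|rewrite notin_setE in H'].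
  - by rewrite mem_set//; right; split; [exact: set_mem|rewrite notin_setE in H].
have mFG : measurable_fun setT (fun w => (F (eta w) - G (eta w))%R).
  apply: measurable_funB; first exact: measurableT_comp.
  apply: measurable_funD; first exact: measurable_cst.
  apply: measurable_funM; first exact: measurable_cst.
  apply: measurable_sum => j; apply: measurableT_comp meta.
  exact: measurable_indic.
apply: (@le_trans _ _ (\int[P]_w (h%:E + \sum_(j < N) (h * \1_(eta @^-1` DS j) w)%:E))).
  apply: ge0_le_integral => //.
  - by apply/measurable_EFinP; exact: measurableT_comp.
  - apply: emeasurable_funD; first exact: measurable_cst.
    apply: emeasurable_sum => j; apply/measurable_EFinP.
    apply: measurable_funM; first exact: measurable_cst.
    exact: measurable_indic.
  - by move=> w _; rewrite sumEFin -EFinD lee_fin -mulr_sumr.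
rewrite ge0_integralD//; last 3 first.
- by move=> w _; rewrite lee_fin ltW.
- by move=> w _; apply: sume_ge0 => j _; rewrite lee_fin mulr_ge0// ltW.
- apply: emeasurable_sum => j; apply/measurable_EFinP.
  apply: measurable_funM; first exact: measurable_cst.
  exact: measurable_indic.
rewrite integral_probability_cst (splitr e) EFinD; apply: leeD; first by rewrite lee_fin.
rewrite ge0_integral_sum//; last 2 first.
- move=> j; apply/measurable_EFinP; apply: measurable_funM; first exact: measurable_cst.
  exact: measurable_indic.
- by move=> j w _; rewrite lee_fin mulr_ge0// ltW.
apply: (@le_trans _ _ (\sum_(j < N) (h * (e / 2 / L))%:E)).
  apply: lee_sum => j _; under eq_integral do rewrite EFinM.
  rewrite ge0_integralZl//; last 2 first.
  - by apply/measurable_EFinP; exact: measurable_indic.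
  - by rewrite lee_fin ltW.
  rewrite integral_indic// setIT [leRHS]EFinM; apply: lee_wpmul2l; first by rewrite lee_fin ltW.
  by case: (HS' j).
rewrite sumEFin lee_fin sumr_const card_ord -mulr_natr /h.
apply: le_of_eq; field.
by rewrite !gt_eqF.
Qed.

End l1_approximation.

(** * Moments under a recursive inequality *)

Section moment_scalars.
Local Open Scope ring_scope.
Variable R : realType.
Implicit Types q r x y B v : R.

(** It bounds [(1 - 1/q) ^ (q/2)], the ratio between the moment bound at [q - 1], raised to the
    power [q / (q - 1)], and the moment bound at [q]. *)
Definition moment_ratio : R := expR (- 2^-1).

Lemma moment_ratio01 : 0 < moment_ratio < 1.
Proof. by rewrite expR_gt0/= expR_lt1 oppr_lt0 invr_gt0. Qed.

Lemma moment_constant_sqr : moment_constant R ^+ 2 = 3 / (1 - moment_ratio).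
Proof.
rewrite /moment_constant; have -> : Num.sqrt (expR 1) = moment_ratio^-1 :> R.
  apply: (@mulIf _ (Num.sqrt (expR 1))); first by rewrite sqrtr_eq0 -ltNge expR_gt0.
  rewrite -expr2 sqr_sqrtr ?expR_ge0// /moment_ratio -expRN opprK.
  rewrite (_ : expR 1 = expR (2^-1) ^+ 2); last by rewrite -expRM_natl divff.
  by rewrite sqrtr_sqr ger0_norm ?expR_ge0.
have /andP[s0 s1] := moment_ratio01.
have E : moment_ratio^-1 / (moment_ratio^-1 - 1) = (1 - moment_ratio)^-1.
  by field; rewrite !gt_eqF// ?subr_gt0.
by rewrite sqr_sqrtr E// divr_ge0// subr_ge0 ltW.
Qed.

Lemma powR_Binv_le q : 2 <= q -> (1 - q^-1) `^ (q / 2) <= moment_ratio.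
Proof.
move=> q2; have q0 : 0 < q by lra.
have h : 0 < 1 - q^-1 by rewrite subr_gt0 invf_lt1//; lra.
rewrite /powR gt_eqF// ler_expR.
have : ln (1 - q^-1) <= - q^-1 by have := ln_sublinear h; rewrite -ler_expR lnK ?posrE// => _; have := expR_ge1Dx (- q^-1); rewrite -ler_ln ?posrE ?expR_gt0// expRK.
move=> H; have : q / 2 * ln (1 - q^-1) <= q / 2 * - q^-1.
  by rewrite ler_wpM2l// divr_ge0 ?ltW.
move=> /le_trans; apply; apply: le_of_eq; field.
by rewrite gt_eqF.
Qed.

(** Young's inequality is applied twice: it splits the product into [x ^ q] and [y ^ (q/2)], and
    then trades [y ^ (q/2)] for [y ^ (r/2)] and a constant, since only the moment of order [r / 2]
    is under control. *)
Lemma young_moment_normalized q r x y : 2 <= q -> q <= r -> 0 <= x -> 0 <= y ->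
  x `^ (q - 2) * y <= (1 - 2 / q) * x `^ q + 2 / r * y `^ (r / 2) + (2 / q - 2 / r).
Proof.
move=> q2 qr x0 y0; have q0 : 0 < q by lra.
have r0 : 0 < r by lra.
have t01 : 0 <= 1 - 2 / q <= 1.
  by rewrite subr_ge0 ler_pdivrMr// mul1r q2/= gerBl divr_ge0// ltW.
have t02 : 0 <= q / r <= 1.
  by apply/andP; split; [rewrite divr_ge0// ltW|rewrite ler_pdivrMr// mul1r].
have := young_powR (powR_ge0 x q) (powR_ge0 y (q / 2)) t01.
rewrite subKr -!powRrM.
have -> : q * (1 - 2 / q) = q - 2 by field; rewrite gt_eqF.
have -> : q / 2 * (2 / q) = 1 by field; rewrite gt_eqF.
rewrite powRr1// => /le_trans; apply; rewrite -addrA lerD2l.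
have := young_powR (powR_ge0 y (r / 2)) ler01 t02.
rewrite powR1 mulr1 -powRrM.
have -> : r / 2 * (q / r) = q / 2 by field; rewrite gt_eqF.
move=> H; have : 2 / q * y `^ (q / 2) <= 2 / q * (q / r * y `^ (r / 2) + (1 - q / r) * 1).
  by rewrite ler_wpM2l// divr_ge0// ltW.
move=> /le_trans; apply; apply: le_of_eq; field.
by rewrite !gt_eqF.
Qed.

(** The normalised inequality, with [x] measured in units of the square root of [B] and [y] in units
    of [v]. *)
Lemma young_moment q r x y B v : 2 <= q -> q <= r -> 0 <= x -> 0 <= y ->
  0 < B -> 0 < v ->
  x `^ (q - 2) * y <= B `^ ((q - 2) / 2) * v *
    ((1 - 2 / q) * (x `^ q * B `^ (- (q / 2))) + 2 / r * (y `^ (r / 2) * v `^ (- (r / 2))) +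
     (2 / q - 2 / r)).
Proof.
move=> q2 qr x0 y0 B0 v0.
have X0 : 0 <= x * B `^ (- 2^-1) by rewrite mulr_ge0 ?powR_ge0.
have Y0 : 0 <= y * v `^ (-1) by rewrite mulr_ge0 ?powR_ge0.
have := young_moment_normalized q2 qr X0 Y0.
rewrite !powRM ?powR_ge0// -!powRrM.
rewrite (_ : - 2^-1 * q = - (q / 2)); last by ring.
rewrite (_ : - 1 * (r / 2) = - (r / 2)); last by ring.
rewrite (_ : - 2^-1 * (q - 2) = - ((q - 2) / 2)); last by ring.
have Bv : 0 < B `^ ((q - 2) / 2) * v by rewrite mulr_gt0// powR_gt0.
move/(ler_wpM2l (ltW Bv)); apply: le_trans.
apply: le_of_eq.
rewrite !powRN powRr1 ?ltW//; field.
by rewrite !gt_eqF// powR_gt0.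
Qed.

End moment_scalars.

Section moment_induction.
Context dT (T : measurableType dT) (R : realType) (P : probability T R).
Variables (H : T -> R) (V : T -> \bar R) (dl M r v : R).
Hypotheses (mH : measurable_fun setT H) (dl0 : (0 < dl)%R).
Hypothesis dHM : forall t, (dl <= H t <= M)%R.
Hypotheses (mV : measurable_fun setT V) (V0 : forall t, 0 <= V t).
Hypotheses (r2 : (2 <= r)%R) (v0 : (0 < v)%R).
Hypothesis Vv : \int[P]_t (V t `^ (r / 2)) <= (v `^ (r / 2))%:E.

Let H0 t : (0 < H t)%R. Proof. by case/andP: (dHM t) => + _; exact: lt_le_trans. Qed.

Let r0 : (0 < r)%R. Proof. exact: lt_le_trans r2. Qed.

Let m (q : R) := fine (\int[P]_t (H t `^ q)%:E).

Lemma moment_fin (q : R) : (0 <= q)%R -> (m q)%:E = \int[P]_t (H t `^ q)%:E.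
Proof.
move=> q0; have bH : bounded_measurable H.
  by split=> //; exists M => t; rewrite gtr0_norm//; case/andP: (dHM t).
have := EFin_Rintegral P (bounded_measurable_powR q0 (fun t => ltW (H0 t)) bH).
by rewrite /m => <-.
Qed.

Let mHq q : measurable_fun setT (fun t => (H t `^ q)%:E).
Proof. by apply/measurable_EFinP; exact: measurableT_comp (measurable_powR _) mH. Qed.

Let mVr : measurable_fun setT (fun t => V t `^ (r / 2)).
Proof. exact: measurableT_comp (measurable_poweR _) mV. Qed.

(** After integration the term with [V ^ (r/2)] is at most [2 / r] by [Vv], which cancels the
    constant [- 2 / r]; the bound no longer depends on [r]. *)
Lemma young_moment_integral (q B : R) : (2 <= q)%R -> (q <= r)%R -> (0 < B)%R ->
  \int[P]_t ((H t `^ (q - 2))%:E * V t) <=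
  (B `^ ((q - 2) / 2) * v * ((1 - 2 / q) * (m q * B `^ (- (q / 2))) + 2 / q))%:E.
Proof.
move=> q2 qr B0; have q0 : (0 < q)%R by lra.
pose a := (B `^ ((q - 2) / 2) * v)%R.
have a0 : (0 < a)%R by rewrite mulr_gt0 ?powR_gt0.
pose b := (a * ((1 - 2 / q) * B `^ (- (q / 2))))%R.
pose c := (a * (2 / r * v `^ (- (r / 2))))%R.
pose e := (a * (2 / q - 2 / r))%R.
have b0 : (0 <= b)%R.
  apply: mulr_ge0; [exact: ltW|apply: mulr_ge0; last exact: powR_ge0].
  by rewrite subr_ge0 ler_pdivrMr// mul1r.
have c0 : (0 < c)%R.
  apply: mulr_gt0 => //; apply: mulr_gt0; [by rewrite divr_gt0|exact: powR_gt0].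
have e0 : (0 <= e)%R.
  by apply: mulr_ge0; [exact: ltW|rewrite subr_ge0 ler_pM2l// lef_pV2].
apply: (@le_trans _ _ (\int[P]_t (b%:E * (H t `^ q)%:E + (c%:E * V t `^ (r / 2) + e%:E)))).
  apply: ge0_le_integral => //.
  - by move=> t _; rewrite mule_ge0// lee_fin powR_ge0.
  - exact: emeasurable_funM.
  - apply: emeasurable_funD; first exact: emeasurable_funM.
    by apply: emeasurable_funD => //; exact: emeasurable_funM.
  (* [V] may be infinite at [t]; then so is the right-hand side, because [c] and the exponent
     [r / 2] are positive. *)
  move=> t _; have := V0 t; case: (V t) => [y| |]//; last first.
    have rh : (r / 2 != 0)%R by rewrite gt_eqF// divr_gt0.
    have c0' : 0 < c%:E by rewrite lte_fin.
    by move=> _; rewrite (poweRyr rh) (gt0_muley c0') addye// addey// leey.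
  rewrite lee_fin => y0; rewrite poweR_EFin -!EFinM -!EFinD lee_fin.
  have := young_moment q2 qr (ltW (H0 t)) y0 B0 v0; rewrite -/a => /le_trans; apply.
  apply: le_of_eq; rewrite /b /c /e; ring.
rewrite ge0_integralD//; last 4 first.
- by move=> t _; rewrite -EFinM lee_fin mulr_ge0 ?powR_ge0.
- exact: emeasurable_funM.
- by move=> t _; rewrite adde_ge0 ?mule_ge0 ?poweR_ge0// lee_fin// ltW.
- by apply: emeasurable_funD => //; exact: emeasurable_funM.
rewrite ge0_integralD//; last 2 first.
- by move=> t _; rewrite mule_ge0 ?poweR_ge0// lee_fin ltW.
- exact: emeasurable_funM.
rewrite !ge0_integralZl//; last 3 first.
- by move=> t _; rewrite poweR_ge0.
- by rewrite lee_fin ltW.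
- by move=> t _; rewrite lee_fin powR_ge0.
rewrite integral_probability_cst -moment_fin; last exact: ltW.
apply: (@le_trans _ _ (b%:E * (m q)%:E + (c%:E * (v `^ (r / 2))%:E + e%:E))).
  by rewrite leeD2l// leeD2r// lee_wpmul2l// lee_fin ltW.
rewrite -!EFinM -!EFinD lee_fin; apply: le_of_eq.
have E : (v `^ (- (r / 2)) * v `^ (r / 2) = 1)%R by apply: powR_sum_eq1 => //; rewrite addNr.
by rewrite /b /c /e -!mulrA E; ring.
Qed.

Hypothesis H2 : \int[P]_t (H t `^ 2)%:E <= (3 * v)%:E.
Hypothesis step : forall q : R, (2 <= q)%R -> (q <= r)%R ->
  \int[P]_t (H t `^ q)%:E <= (m (q - 1) `^ (q / (q - 1)))%:E +
    q%:E * \int[P]_t ((H t `^ (q - 2))%:E * V t).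

Variable C : R.
Hypothesis CE : (C = 3 / (1 - moment_ratio R))%R.

Let C3 : (3 <= C)%R.
Proof.
have /andP[s0 s1] := moment_ratio01 R.
by rewrite CE ler_pdivlMr ?subr_gt0//; nra.
Qed.

Let m_ge0 q : (0 <= m q)%R.
Proof. by rewrite fine_ge0// integral_ge0// => t _; rewrite lee_fin powR_ge0. Qed.

(** Jensen's inequality bounds the moment by [(3 v) ^ (q/2)], starting from [H2]; it is obtained by
    integrating the tangent of [x ^ (q/2)] at [3 v]. The claim follows since [C >= 3] and
    [q >= 1]. *)
Lemma moment_base (q : R) : (1 <= q <= 2)%R -> (m q <= (C * q * v) `^ (q / 2))%R.
Proof.
move=> /andP[q1 q2].
have q02 : (0 <= q / 2 <= 1)%R by rewrite ler_pdivrMr// mul1r q2 divr_ge0//; lra.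
have v3 : (0 < 3 * v)%R by rewrite mulr_gt0.
apply: (@le_trans _ _ ((3 * v) `^ (q / 2))%R); last first.
  apply: ge0_ler_powR; rewrite ?nnegrE//; try by lra.
  - by rewrite ltW// !mulr_gt0//; have := C3; lra.
  - by rewrite ler_pM2r//; have := C3; nra.
rewrite -lee_fin moment_fin; last by lra.
apply: (@le_trans _ _ (\int[P]_t (((q / 2) * (3 * v) `^ (q / 2 - 1))%:E * (H t `^ 2)%:E +
   ((1 - q / 2) * (3 * v) `^ (q / 2))%:E))).
  apply: ge0_le_integral => //.
  - by move=> t _; rewrite lee_fin powR_ge0.
  - by apply: emeasurable_funD => //; exact: emeasurable_funM.
  move=> t _; rewrite -EFinM -EFinD lee_fin.
  have := young_powR (powR_ge0 (H t) 2) (ltW v3) q02.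
  rewrite -powRrM (_ : 2 * (q / 2) = q)%R; last by field.
  have W0 : (0 < (3 * v) `^ (q / 2 - 1))%R by rewrite powR_gt0.
  have E : ((3 * v) `^ (1 - q / 2) * (3 * v) `^ (q / 2 - 1) = 1)%R.
    by apply: powR_sum_eq1 => //; ring.
  move/(ler_wpM2r (ltW W0)); rewrite -[X in (X <= _)%R -> _]mulrA E mulr1 => /le_trans; apply.
  have q20 : (0 < q / 2)%R by lra.
  rewrite -(mulr_powRB1 (ltW v3) q20).
  by apply: le_of_eq; ring.
have k1 : (0 <= q / 2 * (3 * v) `^ (q / 2 - 1))%R by rewrite mulr_ge0 ?powR_ge0//; lra.
have k2 : (0 <= (1 - q / 2) * (3 * v) `^ (q / 2))%R by rewrite mulr_ge0 ?powR_ge0//; lra.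
rewrite ge0_integralD//; last 2 first.
- by move=> t _; rewrite -EFinM lee_fin; apply: mulr_ge0 => //; exact: powR_ge0.
- exact: emeasurable_funM.
rewrite ge0_integralZl//; last by move=> t _; rewrite lee_fin powR_ge0.
rewrite integral_probability_cst.
apply: (@le_trans _ _ ((q / 2 * (3 * v) `^ (q / 2 - 1))%:E * (3 * v)%:E +
   ((1 - q / 2) * (3 * v) `^ (q / 2))%:E)).
  by rewrite leeD2r// lee_wpmul2l.
have q20 : (0 < q / 2)%R by lra.
rewrite -EFinM -EFinD lee_fin -(mulr_powRB1 (ltW v3) q20).
by apply: le_of_eq; ring.
Qed.

(** Relative to the target [A = (C q v) ^ (q/2)], the first term of the recursion is at most
    [moment_ratio R], and Young's inequality returns a multiple [1 / C] of a mean of [1] and the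
    unknown ratio [m q / A]. If this ratio exceeded [1], the recursion would contradict the size of
    [C]. *)
Lemma moment_induction_step (q : R) : (2 <= q)%R -> (q <= r)%R ->
  (m (q - 1) <= (C * (q - 1) * v) `^ ((q - 1) / 2))%R -> (m q <= (C * q * v) `^ (q / 2))%R.
Proof.
move=> q2 qr IH; have q0 : (0 < q)%R by lra.
have q10 : (0 < q - 1)%R by lra.
have C0 : (0 < C)%R by have := C3; lra.
(* This choice of the scale in Young's inequality makes the prefactor [q * v] times the power
   [(q - 2) / 2] of [B] equal to [A / C]. *)
pose B := (C * q * v)%R; have B0 : (0 < B)%R by rewrite !mulr_gt0.
pose A := (B `^ (q / 2))%R; have A0 : (0 < A)%R by rewrite powR_gt0.
have first_term : (m (q - 1) `^ (q / (q - 1)) <= moment_ratio R * A)%R.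
  have x0 : (0 <= C * (q - 1) * v)%R by rewrite !mulr_ge0 ?ltW.
  apply: (@le_trans _ _ (((C * (q - 1) * v) `^ ((q - 1) / 2)) `^ (q / (q - 1)))%R).
    apply: ge0_ler_powR => //; rewrite ?nnegrE ?powR_ge0//.
    by rewrite ltW// divr_gt0.
  rewrite -powRrM (_ : (q - 1) / 2 * (q / (q - 1)) = q / 2)%R; last by field; rewrite gt_eqF.
  rewrite (_ : C * (q - 1) * v = (1 - q^-1) * B)%R; last by rewrite /B; field; rewrite gt_eqF.
  rewrite powRM ?(ltW B0)//; last by rewrite subr_ge0 invf_le1//; lra.
  by rewrite ler_pM2r//; exact: powR_Binv_le.
have mstep : (m q <= moment_ratio R * A + A / C * ((1 - 2 / q) * (m q / A) + 2 / q))%R.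
  rewrite -lee_fin moment_fin ?(ltW q0)//; apply: (le_trans (step q2 qr)).
  rewrite EFinD leeD ?lee_fin//.
  have qe0 : 0 <= q%:E by rewrite lee_fin ltW.
  apply: (le_trans (lee_wpmul2l qe0 (young_moment_integral q2 qr B0))).
  rewrite -EFinM lee_fin; apply: le_of_eq.
  have AE : (A = B * B `^ ((q - 2) / 2))%R.
    have h0 : (0 < q / 2)%R by rewrite divr_gt0.
    by rewrite /A -(mulr_powRB1 (ltW B0) h0); congr (_ * _ `^ _)%R; field.
  rewrite powRN -/A; set W := ((1 - 2 / q) * (m q / A) + 2 / q)%R.
  rewrite (_ : A / C = q * v * B `^ ((q - 2) / 2))%R; first by ring.
  by rewrite AE /B; field; rewrite gt_eqF.
(* With [m q = x A], [x > 1] and [s = moment_ratio R], the recursion gives [x <= s + x / C], where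
   [1 / C = (1 - s) / 3]. Hence [x <= 3 s / (2 + s) < 1]. *)
rewrite leNgt; apply/negP => mA; rewrite -/B -/A in mA.
have [x xE] : exists x, (m q = x * A)%R by exists (m q / A)%R; rewrite divfK// gt_eqF.
rewrite xE in mstep mA.
have x1 : (1 < x)%R by rewrite -(ltr_pM2r A0) mul1r.
have {}mstep : (x <= moment_ratio R + C^-1 * ((1 - 2 / q) * x + 2 / q))%R.
  rewrite -(ler_pM2r A0); move: mstep; rewrite mulfK ?gt_eqF// => /le_trans; apply.
  by apply: le_of_eq; ring.
have : ((1 - 2 / q) * x + 2 / q <= x)%R.
  have : (0 <= 2 / q * (x - 1))%R by rewrite mulr_ge0 ?divr_ge0 ?(ltW q0)//; lra.
  lra.
have Ci0 : (0 <= C^-1)%R by rewrite invr_ge0 ltW.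
move=> /(ler_wpM2l Ci0) xx; have {xx mstep} : (x <= moment_ratio R + C^-1 * x)%R by lra.
have /andP[s0 s1] := moment_ratio01 R.
have Ci : (C^-1 = (1 - moment_ratio R) / 3)%R by rewrite CE invf_div.
rewrite Ci; move: (moment_ratio R) s0 s1 => s s0 s1; nra.
Qed.

Theorem moment_induction (q : R) : (1 <= q)%R -> (q <= r)%R -> (m q <= (C * q * v) `^ (q / 2))%R.
Proof.
move=> q1; have : (q <= (Num.truncn q).+2%:R)%R.
  by rewrite ltW// (lt_trans (truncnS_gt q))// ltr_nat.
move: (Num.truncn q) => k; elim: k q q1 => [|k IH] q q1 qk qr; first by apply: moment_base; rewrite q1.
have [q2|q2] := leP q 2%R; first by apply: moment_base; rewrite q1.
apply: moment_induction_step => //; first exact: ltW.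
apply: IH; first by lra.
  by rewrite lerBlDr natr1.
by lra.
Qed.

End moment_induction.

(** * Fatou's lemma, truncation and superadditivity of powers *)

(** A one-sided asymptotic bound is enough, because the minimum of [f_ n] and [f] converges to [f]
    and is still dominated by [f_ n]. *)
Lemma fatou_le d (T : measurableType d) (R : realType) (mu : {measure set T -> \bar R})
    (f : T -> R) (f_ : nat -> T -> R) K :
  measurable_fun setT f -> (forall n, measurable_fun setT (f_ n)) ->
  (forall t, 0 <= f t)%R -> (forall n t, 0 <= f_ n t)%R ->
  (forall t e, (0 < e)%R -> \forall n \near \oo, (f t <= f_ n t + e)%R) ->
  (forall n, \int[mu]_t (f_ n t)%:E <= K) -> \int[mu]_t (f t)%:E <= K.
Proof.
move=> mf mf_ f0 f_0 ff_ fK.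
pose g n t := (Num.min (f_ n t) (f t))%:E.
have mg n : measurable_fun setT (g n).
  by apply/measurable_EFinP; exact: measurable_minr.
have g0 n t : 0 <= g n t by rewrite lee_fin le_min f_0 f0.
have gf t : g n t @[n --> \oo] --> (f t)%:E.
  apply/fine_cvgP; split; first exact: nearW.
  apply/cvgrPdist_le => e e0; near=> n.
  have fn : (f t <= f_ n t + e)%R by near: n; exact: ff_.
  rewrite /= ger0_norm; last by rewrite subr_ge0 ge_min lexx orbT.
  by case: (leP (f_ n t) (f t)) => _; lra.
have H := @fatou _ _ _ mu setT measurableT g mg (fun n t _ => g0 n t).
rewrite (_ : \int[mu]_t (f t)%:E = \int[mu]_t limn_einf (g^~ t)); last first.
  by apply: eq_integral => t _; rewrite (cvg_limn_einf_sup (gf t)).1.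
apply: (le_trans H); rewrite limn_einf_lim; apply: lime_le; first exact: is_cvg_einfs.
apply: nearW => n; apply: le_trans (fK n).
apply: (@le_trans _ _ (\int[mu]_t g n t)); first by apply: ereal_inf_lbound; exists n => //=.
apply: ge0_le_integral => //; first by apply/measurable_EFinP.
by move=> t _; rewrite lee_fin ge_min lexx.
Unshelve. all: by end_near. Qed.

Section truncation.
Variable R : realType.
Local Open Scope ring_scope.

Definition truncation (n : nat) (x : R) : R := Num.max (Num.min x n%:R) (- n%:R).

Lemma truncation_le n x : `|truncation n x| <= n%:R.
Proof.
rewrite /truncation ler_norml le_max lexx orbT/= ge_max ge_min lexx orbT/=.
by rewrite (le_trans _ (ler0n _ n))// oppr_le0.
Qed.

Lemma truncation_norm_le n x : `|truncation n x| <= `|x|.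
Proof.
have := ler0n R n; rewrite /truncation; move: (n%:R) => N N0.
have := ler_norm x; have := ler_norm (- x); rewrite normrN ler_norml.
by case: (leP x N) => h; [case: (leP x (- N))|case: (leP N (- N))] => h' h1 h2; lra.
Qed.

Lemma truncation_id n x : `|x| <= n%:R -> truncation n x = x.
Proof.
rewrite ler_norml => /andP[nx xn]; rewrite /truncation.
by rewrite (min_idPl xn) (max_idPl nx).
Qed.

(** Truncation is nondecreasing and contracts distances, so it cannot enlarge a positive part of an
    increment; this is what keeps [vplus] under control. *)
Lemma truncation_increment n x y :
  Num.max (truncation n x - truncation n y) 0 <= Num.max (x - y) 0.
Proof.
rewrite /truncation ge_max !le_max lexx !orbT andbT.
have N0 := ler0n R n; apply/orP.
have H (N z : R) : 0 <= N -> [\/ Num.max (Num.min z N) (- N) = z /\ - N <= z <= N,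
    Num.max (Num.min z N) (- N) = N /\ N <= z | Num.max (Num.min z N) (- N) = - N /\ z <= - N].
  move=> {}N0; case: (leP z N) => zN; [case: (leP z (- N))|case: (leP N (- N))] => zN';
    [apply: Or33|apply: Or31|apply: Or32|apply: Or32]; split; lra.
case: (leP x y) => xy; [right|left];
  case: (H _ x N0) => -[-> hx]; case: (H _ y N0) => -[-> hy]; lra.
Qed.

Lemma measurable_truncation n : measurable_fun setT (truncation n).
Proof.
apply: measurable_maxr; last exact: measurable_cst.
by apply: measurable_minr; [exact: measurable_id|exact: measurable_cst].
Qed.

Lemma near_truncation x : \forall n \near \oo, truncation n x = x.
Proof.
exists (Num.truncn `|x|).+1 => // n /= xn; apply: truncation_id.
by rewrite (le_trans (ltW (truncnS_gt _)))// ler_nat.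
Qed.

End truncation.

(** [g] need not be measurable, and its integral is then the supremum over simple functions below
    it. Setting [f] to zero on the null set leaves its integral unchanged and makes the comparison
    pointwise. *)
Lemma ae_le_lower_integral d (T : measurableType d) (R : realType)
    (mu : {measure set T -> \bar R}) (f g : T -> \bar R) :
  measurable_fun setT f -> (forall t, 0 <= f t) -> (forall t, 0 <= g t) ->
  {ae mu, forall t, f t <= g t} -> \int[mu]_t f t <= \int[mu]_t g t.
Proof.
move=> mf f0 g0 [N [mN N0 fg]].
have mh : measurable_fun setT (f \_ (~` N)).
  by apply/(measurable_restrictT _ (measurableC mN)); exact: measurable_funTS.
have h0 t : 0 <= (f \_ (~` N)) t by rewrite patchE; case: ifP.
rewrite (_ : \int[mu]_t f t = \int[mu]_t (f \_ (~` N)) t); last first.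
  apply: ge0_ae_eq_integral => //; exists N; split => // t /= H.
  apply: contrapT => nN; apply: H => _; rewrite patchE mem_set//.
rewrite ge0_integralTE// [leRHS]ge0_integralTE//; apply: ereal_sup_le => _ [h hf <-].
exists h => // t; apply: le_trans (hf t) _; rewrite patchE; case: ifPn => //.
by rewrite inE => nN; apply: contrapT => H; apply: nN; exact: fg.
Qed.

(** A fraction [x / (a + b)] in the unit interval decreases when raised to a power [s >= 1]. The
    inequality recombines the moments of [vplus] for [F] and [- F] without loss. *)
Lemma superadditive_powR (R : realType) (a b s : R) :
  (1 <= s -> 0 <= a -> 0 <= b -> a `^ s + b `^ s <= (a + b) `^ s)%R.
Proof.
move=> s1 a0 b0; have s0 : (0 < s)%R by lra.
have [ab0|ab0] := eqVneq (a + b)%R 0%R.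
  have [-> ->] : a = 0%R /\ b = 0%R by split; lra.
  by rewrite addr0 powR0 ?gt_eqF// addr0.
have ab : (0 < a + b)%R by rewrite lt0r ab0 addr_ge0.
have H (x : R) : (0 <= x <= a + b -> x `^ s <= x / (a + b) * (a + b) `^ s)%R.
  move=> /andP[x0 xab]; have [->|xn0] := eqVneq x 0%R.
    by rewrite powR0 ?gt_eqF// mul0r mul0r.
  have u01 : (0 < x / (a + b) <= 1)%R.
    have x0' : (0 < x)%R by rewrite lt0r xn0.
    by rewrite divr_gt0//= ler_pdivrMr// mul1r.
  have u0 : (0 <= x / (a + b))%R by case/andP: u01 => /ltW.
  rewrite -{1}(divfK ab0 x) powRM ?(ltW ab)// ler_wpM2r ?powR_ge0//.
  by rewrite -[leRHS]powRr1// ger_powR.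
apply: le_trans (lerD (H a _) (H b _)) _.
- by rewrite a0 lerDl.
- by rewrite b0 lerDr.
by rewrite -mulrDl -mulrDl divff// mul1r.
Qed.

Lemma superadditive_poweR (R : realType) (a b : \bar R) (s : R) :
  (1 <= s)%R -> 0 <= a -> 0 <= b -> a `^ s + b `^ s <= (a + b) `^ s.
Proof.
move=> s1; have s0 : s != 0%R by rewrite gt_eqF// (lt_le_trans _ s1).
case: a => [a| |]//; case: b => [b| |]//; rewrite ?lee_fin => a0 b0.
- exact: superadditive_powR.
- by rewrite addey// poweRyr// leey.
- by rewrite addye// poweRyr// leey.
- by rewrite addye// poweRyr// leey.
Qed.

(** * Functionals of a Poisson process *)

Section poisson_functional.
Context d (X : measurableType d) (R : realType) dO (Omega : measurableType dO).
Variables (P : probability Omega R).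
Variable lambda : {sigma_finite_measure set X -> \bar R}.
Variables (eta : Omega -> config X R) (kappa : Omega -> \bar R).
Variable Z : nat -> Omega -> X.
Hypothesis eta_poisson : poisson_process P lambda eta.
Hypothesis eta_proper : proper_representation P eta kappa Z.

Let meta : measurable_fun setT eta. Proof. by case: eta_poisson. Qed.

Notation addp := (@add_point d X R).


Lemma measurable_add_point_eta (w : Omega) :
  measurable_fun setT (fun x => add_point (eta w) x).
Proof.
exact: measurableT_comp (@measurable_add_point _ X R) (pair2_measurable (eta w)).
Qed.

Lemma measurable_count_mul (B : set X) (g : config X R -> R) :
  measurable B -> measurable_fun setT g ->
  measurable_fun setT (fun w => eta w B * (g (eta w))%:E).
Proof.
move=> mB mg; apply: emeasurable_funM; first exact: (measurable_count eta_poisson mB).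
by apply/measurable_EFinP; exact: measurableT_comp.
Qed.

Lemma measurable_points_terms (u : nat -> Omega -> \bar R) :
  (forall i, measurable_fun setT (u i)) -> (forall i w, 0 <= u i w) ->
  measurable_fun setT (fun w => \sum_(i <oo | i%:R%:E < kappa w) u i w).
Proof.
move=> mu u0; under eq_fun do rewrite eseries_mkcond.
apply: (@ge0_emeasurable_sum _ _ _ _ _ xpredT) => [i w _ _|i _]; first by case: ifP.
apply: measurable_fun_ifT => //.
apply: (@measurable_fun_bool _ _ setT _ true).
by rewrite setTI; exact: measurable_has_point eta_proper i.
Qed.

Lemma measurable_points_sum (h : X * config X R -> \bar R) :
  measurable_fun setT h -> (forall z, 0 <= h z) ->
  measurable_fun setT
    (fun w => \sum_(i <oo | i%:R%:E < kappa w) h (Z i w, others kappa Z i w)).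
Proof.
move=> mh h0; apply: measurable_points_terms => // i.
apply: (measurableT_comp mh); apply: measurable_fun_pair; first by case: eta_proper.
exact: measurable_others eta_proper i.
Qed.

(** Applied to [h (x, mu) = 1_B(x) g (mu + delta_x)], the Mecke formula reassembles [eta] at each of
    its points, so that the sum over the points just counts those in [B]. *)
Lemma mecke_count (B : set X) (g : config X R -> R) :
  measurable B -> measurable_fun setT g -> (forall mu, (0 <= g mu)%R) ->
  \int[P]_w (eta w B * (g (eta w))%:E) =
  \int[P]_w \int[lambda]_(x in B) (g (add_point (eta w) x))%:E.
Proof.
move=> mB mg g0.
pose h (z : X * config X R) := (\1_B z.1 * g (add_point z.2 z.1))%:E.
have mh : measurable_fun setT h.
  apply/measurable_EFinP; apply: measurable_funM.
    by apply: measurableT_comp measurable_fst; exact: measurable_indic.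
  exact: measurableT_comp mg (@measurable_add_point _ _ _).
have h0 z : 0 <= h z by rewrite lee_fin mulr_ge0.
have := mecke_formula eta_poisson eta_proper mh h0.
have -> : \int[P]_w \int[lambda]_x h (x, eta w) =
    \int[P]_w \int[lambda]_(x in B) (g (add_point (eta w) x))%:E.
  apply: eq_integral => w _; rewrite [RHS]integral_mkcond; apply: eq_integral => x _.
  by rewrite /h/= patchE indicE; case: ifP; rewrite ?mul1r ?mul0r.
move=> <-; apply: ge0_ae_eq_integral => //.
- exact: measurable_count_mul.
- exact: measurable_points_sum.
- by move=> w _; apply: mule_ge0 => //; rewrite lee_fin.
- by move=> w _; apply: nneseries_ge0.
have H1 := eta_others eta_proper; have H2 := dirac_sum_eta eta_proper.
near=> w => _.
have E1 : forall i, has_point kappa i w ->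
    config_eq (eta w) (add_point (others kappa Z i w) (Z i w)) by near: w.
have E2 : forall B, measurable B ->
   eta w B = \sum_(i <oo) (\1_(has_point kappa i `&` Z i @^-1` B) w)%:E by near: w.
rewrite E2// muleC -nneseriesZl; last by move=> i _; rewrite lee_fin.
rewrite [RHS]eseries_mkcond; apply: eq_eseriesr => i _.
rewrite indicE in_setI.
rewrite (_ : (w \in has_point kappa i) = (i%:R%:E < kappa w)); last first.
  by apply/idP/idP; rewrite inE.
case: ifP => ki; last by rewrite mule0.
rewrite (_ : (w \in Z i @^-1` B) = (Z i w \in B)); last by apply/idP/idP; rewrite !inE.
rewrite /h /= indicE -EFinM mulrC; congr (_ * _)%:E.
by apply: config_eq_fun mg _ (E1 i ki) => r; exact: measurable_set1.
Unshelve. all: by end_near. Qed.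

Lemma void_probability (A : set X) : measurable A -> lambda A < +oo ->
  P [set w | eta w A = 0] = (expR (- fine (lambda A)))%:E.
Proof.
move=> mA Aoo; have := poisson_count eta_poisson 0 mA Aoo.
by move=> ->; rewrite poisson_prob_set0// fine_ge0.
Qed.

Lemma measurable_addp : measurable_fun setT (fun z : config X R * X => addp z.1 z.2).
Proof. exact: (measurableT_comp (@measurable_add_point _ X R) (@measurable_swap _ _ _ _)). Qed.

Lemma addpC (g : config X R -> R) : measurable_fun setT g ->
  forall mu x y, g (addp (addp mu x) y) = g (addp (addp mu y) x).
Proof.
move=> mg mu x y; apply: config_eq_fun mg _ _ => [r|B mB]; first exact: measurable_set1.
by rewrite !add_pointE addeAC.
Qed.

(** * Conditioning on the absence of points in a set of finite intensity *)

Section restriction_to_finite_set.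
Variables (A : set X) (mA : measurable A) (Aoo : lambda A < +oo).

Definition restricted_intensity : {finite_measure set X -> \bar R} :=
  mfrestr mA Aoo.

Let nu := restricted_intensity.
Let c := fine (lambda A).
Let U := shift_integral nu addp.

Lemma restricted_intensityT : fine (nu setT) = c.
Proof. by rewrite /nu /= /mfrestr /mrestr setTI. Qed.

Lemma EFin_shift_integral (g : config X R -> R) mu : bounded_measurable g ->
  (forall mu, (0 <= g mu)%R) ->
  (U g mu)%:E = \int[lambda]_(x in A) (g (add_point mu x))%:E.
Proof.
move=> bg g0.
rewrite /U /shift_integral EFin_Rintegral; last exact: (bounded_measurable_shift measurable_addp mu bg).
rewrite -(ge0_integral_mrestr lambda mA)// => [|x]; last by rewrite lee_fin.
apply/measurable_EFinP; case: bg => mg _.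
apply: (measurableT_comp mg).
exact: (measurableT_comp measurable_addp (pair1_measurable mu)).
Qed.

Let count_eq (n : nat) := [set w | eta w A = n%:R%:E].

Let mcount n : measurable (count_eq n).
Proof. exact: (measurable_count_eq eta_poisson _ mA). Qed.

(** The Mecke formula for [g] times the indicator of [n + 1] points in [A]: the added point lies in
    [A], so before its insertion there were [n]. *)
Lemma integral_count_succ n (g : config X R -> R) : bounded_measurable g ->
  (forall mu, (0 <= g mu)%R) ->
  n.+1%:R%:E * \int[P]_(w in count_eq n.+1) (g (eta w))%:E =
  \int[P]_(w in count_eq n) (U g (eta w))%:E.
Proof.
move=> bg g0; have [mg _] := bg.
have mge : measurable_fun setT (fun w => (g (eta w))%:E).
  by apply/measurable_EFinP; exact: measurableT_comp.
pose S := [set mu : config X R | mu A = n.+1%:R%:E].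
have mS : measurable S.
  rewrite -[X in measurable X]setTI.
  exact: (measurable_config_ev mA measurableT (emeasurable_set1 n.+1%:R%:E)).
pose h mu := (g mu * \1_S mu)%R.
have mh : measurable_fun setT h by apply: measurable_funM => //; exact: measurable_indic.
have h0 mu : (0 <= h mu)%R by rewrite mulr_ge0.
have H := mecke_count mA mh h0.
rewrite -ge0_integralZl//; last 2 first.
- exact: measurable_funTS.
- by move=> w _; rewrite lee_fin.
rewrite integral_mkcond.
transitivity (\int[P]_w (eta w A * (h (eta w))%:E)).
  apply: eq_integral => w _; rewrite patchE /h indicE.
  rewrite (_ : (eta w \in S) = (w \in count_eq n.+1)); last by apply/idP/idP; rewrite !inE.
  case: ifPn => [|_]; last by rewrite mulr0 mule0.
  by rewrite inE => ->; rewrite mulr1.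
rewrite {}H [RHS]integral_mkcond; apply: eq_integral => w _; rewrite patchE.
case: ifPn => [|nw].
  rewrite inE => wn; rewrite EFin_shift_integral//; apply: eq_integral => x.
  rewrite inE => Ax; rewrite /h indicE mem_set ?mulr1//.
  by rewrite /S /= -[LHS]/(add_point (eta w) x A) add_pointE wn diracE mem_set// -EFinD natr1.
apply: integral0_eq => x Ax; rewrite /h indicE memNset ?mulr0//.
rewrite /S /= -[X in X = _]/(add_point (eta w) x A) add_pointE diracE mem_set// => E.
move: nw; apply/negP/negPn; rewrite inE /count_eq/=.
move/(congr1 (fun y => y - 1)): E; rewrite addeK// => ->.
by rewrite -EFinB -natr1 addrK.
Qed.

Lemma integral_count n (g : config X R -> R) : bounded_measurable g ->
  (forall mu, (0 <= g mu)%R) ->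
  n`!%:R%:E * \int[P]_(w in count_eq n) (g (eta w))%:E =
  \int[P]_(w in count_eq 0) (iter n U g (eta w))%:E.
Proof.
elim: n g => [|n IH] g bg g0; first by rewrite fact0 mul1e.
have bU : bounded_measurable (U g).
  exact: (bounded_measurable_shift_integral nu measurable_addp bg).
have U0 mu : (0 <= U g mu)%R by apply: Rintegral_ge0.
rewrite factS mulnC natrM EFinM -muleA integral_count_succ// IH//.
by under eq_integral do rewrite -iterSr.
Qed.

Lemma count_finite : {ae P, forall w, (\bigcup_n count_eq n) w}.
Proof.
exists [set w | eta w A = +oo]; split.
- exact: (measurable_count_eq eta_poisson _ mA).
- exact: (poisson_count_pinfty eta_poisson).
move=> w /= nw; have [//|[n wn]] := (configP (eta w)).1 _ mA.
by exfalso; apply: nw; exists n.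
Qed.

(* The law of [eta] is obtained from its law conditioned on [A] being empty by
   adding an independent Poisson process with intensity [nu]. *)
Lemma integral_poisson_mean (g : config X R -> R) : bounded_measurable g ->
  (forall mu, (0 <= g mu)%R) ->
  \int[P]_w (g (eta w))%:E =
  (expR c)%:E * \int[P]_(w in count_eq 0) (poisson_mean nu addp g (eta w))%:E.
Proof.
move=> bg g0; have [mg _] := bg.
have mge : measurable_fun setT (fun w => (g (eta w))%:E).
  by apply/measurable_EFinP; exact: measurableT_comp.
have bU k := bounded_measurable_iter_shift_integral nu measurable_addp k bg.
have [M gM] := bounded_ge0 bg g0.
have UM := iter_shift_integral_bound nu measurable_addp bg gM.
have c0 : (0 <= fine (nu setT))%R by exact: fine_ge0.
have mUk k : measurable_fun setT (fun w => (iter k U g (eta w) / k`!%:R)%:E).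
  apply/measurable_EFinP; apply: measurable_funM; last exact: measurable_cst.
  by apply: measurableT_comp => //; case: (bU k).
have Uk0 k mu : (0 <= iter k U g mu / k`!%:R)%R.
  by rewrite divr_ge0//; case/andP: (UM k mu).
transitivity (\int[P]_(w in \bigcup_n count_eq n) (g (eta w))%:E).
  rewrite [RHS]integral_mkcond; apply: ge0_ae_eq_integral => //.
  - have mU : measurable (\bigcup_n count_eq n) by exact: bigcupT_measurable.
    by apply/(measurable_restrictT _ mU); exact: measurable_funTS.
  - by move=> w _; rewrite lee_fin.
  - by move=> w _; rewrite patchE; case: ifP => // _; rewrite lee_fin.
  by apply: filterS count_finite => w Aw _; rewrite patchE mem_set.
rewrite ge0_integral_bigcup//; last 3 first.
- exact: measurable_funTS.
- by move=> w _; rewrite lee_fin.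
- move=> i j _ _ [w [/= wi wj]]; have [/eqP] := etrans (esym wi) wj.
  by rewrite eqr_nat => /eqP.
transitivity (\sum_(n <oo) \int[P]_(w in count_eq 0) (iter n U g (eta w) / n`!%:R)%:E).
  apply: eq_eseriesr => n _.
  have n0 : n`!%:R != 0%R :> R by rewrite pnatr_eq0 -lt0n fact_gt0.
  have := integral_count n bg g0; move=> /(congr1 (fun y => n`!%:R^-1%:E * y)).
  rewrite muleA -EFinM mulVf// mul1e => ->.
  rewrite -ge0_integralZl//.
  - by apply: eq_integral => w _; rewrite -EFinM mulrC.
  - apply/measurable_EFinP/measurable_funTS.
    by apply: measurableT_comp => //; case: (bU n).
  - by move=> w _; rewrite lee_fin; case/andP: (UM n (eta w)).
rewrite -integral_nneseries//; last 2 first.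
- by move=> n; exact: measurable_funTS.
- by move=> n w _; rewrite lee_fin.
rewrite -ge0_integralZl//; last 2 first.
- apply/measurable_EFinP/measurable_funTS; apply: measurableT_comp => //.
  by case: (bounded_measurable_poisson_mean nu measurable_addp bg g0).
- move=> w _; rewrite lee_fin mulr_ge0 ?expR_ge0// fine_ge0//.
  by apply: nneseries_ge0 => k _ _; rewrite lee_fin.
apply: eq_integral => w _.
rewrite /poisson_mean -/U restricted_intensityT -EFinM mulrA -expRD subrr expR0 mul1r fineK//.
exact: (poisson_sum_fin c0 (fun k => UM k (eta w))).
Qed.

End restriction_to_finite_set.

(** * The Beckner inequality on the whole space *)

Section global_beckner.

Lemma agree_on_add_point A (mu mu' : config X R) x :
  agree_on A mu mu' -> agree_on A (addp mu x) (addp mu' x).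
Proof. by move=> H C mC CA; rewrite !add_pointE H. Qed.

Lemma local_on_poisson_mean A (nu : {finite_measure set X -> \bar R}) (g : config X R -> R) :
  local_on A g -> local_on A (poisson_mean nu addp g).
Proof.
move=> lg mu mu' H; rewrite /poisson_mean; congr (_ * fine _)%R.
apply: eq_eseriesr => k _; congr (_ / _)%:E.
elim: k mu mu' H => [|k IH] mu mu' H /=; first exact: lg.
by apply: eq_Rintegral => x _; apply: IH; exact: agree_on_add_point.
Qed.

Lemma agree_on_empty A (mu mu' : config X R) : measurable A -> mu A = 0 -> mu' A = 0 ->
  agree_on A mu mu'.
Proof.
move=> mA mu0 mu'0 C mC CA.
have H (m : {measure set X -> \bar R}) : m A = 0 -> m C = 0.
  by move=> m0; apply/eqP; rewrite eq_le measure_ge0 andbT -m0 le_measure ?inE.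
by rewrite !H.
Qed.

Variable p : R.
Hypothesis p12 : (1 <= p <= 2)%R.
Let p1 : (1 <= p)%R. Proof. by case/andP: p12. Qed.
Let p0 : (0 <= p)%R. Proof. exact: le_trans p1. Qed.

(** The tangent at [x] has slope at most [p * M ^ (p - 1)], so an error [D] in the argument costs at
    most this multiple of [D]. *)
Lemma powR_le_tangent (x y M D : R) : (0 < x <= M -> 0 < y -> 0 <= D -> x <= y + D ->
  x `^ p <= y `^ p + p * M `^ (p - 1) * D)%R.
Proof.
move=> /andP[x0 xM] y0 D0 xyD; have := powR_bernoulli p1 x0 y0.
rewrite -lerBrDr => /le_trans; apply; rewrite lerD2l -mulrN opprB.
have xM' : (x `^ (p - 1) <= M `^ (p - 1))%R.
  apply: ge0_ler_powR => //; rewrite ?nnegrE ?subr_ge0//; first exact: ltW.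
  exact: le_trans (ltW x0) xM.
apply: (@le_trans _ _ (p * x `^ (p - 1) * D))%R.
  by rewrite ler_wpM2l ?mulr_ge0 ?powR_ge0// lerBlDl.
by rewrite ler_wpM2r// ler_wpM2l.
Qed.

Variables (F : config X R -> R) (dl M : R).
Hypotheses (mF : measurable_fun setT F) (dl0 : (0 < dl)%R) (dlM : (dl < M)%R).
Hypothesis dFM : forall mu, (dl <= F mu <= M)%R.

Let F0 mu : (0 < F mu)%R.
Proof. by have /andP[+ _] := dFM mu; exact: lt_le_trans. Qed.

Let bF : bounded_measurable F.
Proof.
split=> //; exists M => mu; rewrite gtr0_norm//.
by case/andP: (dFM mu).
Qed.

Let bFp : bounded_measurable (fun mu => F mu `^ p)%R.
Proof. by apply: bounded_measurable_powR => // mu; exact: ltW. Qed.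

Let energy w := \int[lambda]_x (bregman_power p (F (addp (eta w) x)) (F (eta w)))%:E.

Let energy_integrand (z : X * config X R) : \bar R :=
  (bregman_power p (F (addp z.2 z.1)) (F z.2))%:E.

Let energy_integrand_ge0 z : 0 <= energy_integrand z.
Proof. by rewrite lee_fin bregman_power_ge0. Qed.

Let measurable_energy_integrand : measurable_fun setT energy_integrand.
Proof.
apply/measurable_EFinP.
have dF mu : (dl <= F mu)%R by case/andP: (dFM mu).
by have [] := bounded_measurable_bregman_shift measurable_addp p12 dl0 bF dF.
Qed.

Let measurable_energy : measurable_fun setT energy.
Proof.
have := @measurable_fun_fubini_tonelli_G _ _ _ _ _ lambda _ measurable_energy_integrand
  energy_integrand_ge0.
by move=> /measurableT_comp; apply.
Qed.

(** Given that [A] is empty, [local_beckner] compares with the power of the Poisson mean of [F],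
    which still depends on the points outside [A]. The Poisson mean of the local function [G] is
    constant on that event and equals the mean of [G(eta)]. Replacing [F] by [G] under the Poisson
    mean, and then the mean of [G] by that of [F], costs the multiple [p * M ^ (p - 1)] of [e] each
    time. *)
Lemma local_error A e (G : config X R -> R) : measurable A -> lambda A < +oo ->
  bounded_measurable G -> (forall mu, (dl <= G mu <= M)%R) -> local_on A G ->
  \int[P]_w `|F (eta w) - G (eta w)|%:E <= e%:E ->
  \int[P]_w (F (eta w) `^ p)%:E <= ((fine (\int[P]_w (F (eta w))%:E) `^ p +
    p * M `^ (p - 1) * (2 * e))%R)%:E + \int[P]_w energy w.
Proof.
move=> mA Aoo bG dGM lG FGe.
have dF mu : (dl <= F mu)%R by case/andP: (dFM mu).
have dG mu : (dl <= G mu)%R by case/andP: (dGM mu).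
have G0 mu : (0 <= G mu)%R by rewrite (le_trans (ltW dl0)).
have F0' mu : (0 <= F mu)%R by exact: ltW.
pose nu := restricted_intensity mA Aoo; pose PM := poisson_mean nu addp.
have ms := measurable_addp; have sC := addpC.
pose E0 := [set w | eta w A = 0%:R%:E].
have mE0 : measurable E0 by exact: (measurable_count_eq eta_poisson 0 mA).
have PE0 : P E0 = (expR (- fine (lambda A)))%:E := void_probability mA Aoo.
have IPM (g : config X R -> R) : bounded_measurable g -> (forall mu, (0 <= g mu)%R) ->
    \int[P]_w (g (eta w))%:E = (expR (fine (lambda A)))%:E * \int[P]_(w in E0) (PM g (eta w))%:E.
  exact: (integral_poisson_mean mA Aoo).
have Icst (m : R) : (expR (fine (lambda A)))%:E * \int[P]_(w in E0) m%:E = m%:E.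
  rewrite integral_cst// [X in _ * (_ * X)]PE0 muleCA -EFinM.
  by rewrite -expRD subrr expR0 mulr1.
pose D mu := `|F mu - G mu|%R.
have bD : bounded_measurable D.
  have [mFG [N HN]] := bounded_measurableB bF bG.
  by split; [exact: measurableT_comp|exists N => mu; rewrite normr_id].
have D0 mu : (0 <= D mu)%R by rewrite normr_ge0.
have PM0 (g : config X R -> R) : bounded_measurable g -> (forall mu, (0 <= g mu)%R) ->
    forall mu, (0 <= PM g mu)%R.
  by move=> bg g0 mu; exact: (poisson_mean_ge nu ms).
have mPM (g : config X R -> R) : bounded_measurable g -> (forall mu, (0 <= g mu)%R) ->
    measurable_fun E0 (fun w => (PM g (eta w))%:E).
  move=> bg g0; apply/measurable_EFinP/measurable_funTS.
  by apply: measurableT_comp => //; case: (bounded_measurable_poisson_mean nu ms bg g0).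
(* [point] is the zero configuration, a representative of all configurations without points in
   [A]. *)
pose m := PM G point.
have PMG w : E0 w -> PM G (eta w) = m.
  move=> Ew; apply: (local_on_poisson_mean nu lG); exact: agree_on_empty.
have mE : m%:E = \int[P]_w (G (eta w))%:E.
  rewrite IPM// -Icst; congr (_ * _); apply: eq_integral => w; rewrite inE => Ew.
  by rewrite PMG.
have mG : measurable_fun setT (fun w => (G (eta w))%:E).
  by apply/measurable_EFinP; apply: measurableT_comp => //; case: bG.
have mFe : measurable_fun setT (fun w => (F (eta w))%:E).
  by apply/measurable_EFinP; exact: measurableT_comp.
have mDe : measurable_fun setT (fun w => (D (eta w))%:E).
  by apply/measurable_EFinP; apply: measurableT_comp => //; case: bD.
have IFfin : \int[P]_w (F (eta w))%:E \is a fin_num.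
  rewrite -EFin_Rintegral//; case: bF => _ [N HN].
  by split; [exact: measurableT_comp|exists N => w].
set f := fine (\int[P]_w (F (eta w))%:E).
have fE : f%:E = \int[P]_w (F (eta w))%:E by rewrite fineK.
have IPc (r : R) : \int[P]_w r%:E = r%:E.
  by rewrite integral_probability_cst.
have mM : (m <= M)%R.
  rewrite -lee_fin mE -(IPc M); apply: ge0_le_integral => //.
  - by move=> w _; rewrite lee_fin.
  - by move=> w _; rewrite lee_fin; case/andP: (dGM (eta w)).
have m0 : (0 < m)%R.
  by apply: (lt_le_trans dl0); apply: (poisson_mean_ge nu ms) => //; exact: ltW.
have f0 : (0 < f)%R.
  apply: (lt_le_trans dl0); rewrite -lee_fin fE -(IPc dl); apply: ge0_le_integral => //.
  - by move=> w _; rewrite lee_fin ltW.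
  - by move=> w _; rewrite lee_fin.
have e0 : (0 <= e)%R.
  by rewrite -lee_fin (le_trans _ FGe)// integral_ge0// => w _; rewrite lee_fin.
have mf : (m <= f + e)%R.
  rewrite -lee_fin EFinD mE fE (le_trans _ (leeD2l _ FGe))//.
  rewrite -ge0_integralD//; last by move=> w _; rewrite lee_fin.
  apply: ge0_le_integral => //.
  - by move=> w _; rewrite lee_fin.
  - exact: emeasurable_funD.
  - move=> w _; rewrite -EFinD lee_fin -lerBlDl distrC; exact: ler_norm.
have mpf : (m `^ p <= f `^ p + p * M `^ (p - 1) * e)%R.
  by apply: powR_le_tangent => //; rewrite m0.
pose K := (p * M `^ (p - 1))%R.
have K0 : (0 <= K)%R by rewrite mulr_ge0 ?powR_ge0.
pose En := bregman_energy nu addp p F.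
have bEn : bounded_measurable En.
  exact: (bounded_measurable_bregman_energy nu ms p12 dl0 bF dF).
have En0 mu : (0 <= En mu)%R.
  by apply: Rintegral_ge0 => x _; rewrite bregman_power_ge0.
have pointwise w : E0 w ->
    (PM (fun mu => F mu `^ p) (eta w) <= m `^ p + (K * PM D (eta w) + PM En (eta w)))%R.
  move=> Ew; rewrite addrA; apply: le_trans (local_beckner nu ms sC p12 dl0 (eta w) bF dF) _.
  rewrite lerD2r; apply: powR_le_tangent => //; last 2 first.
  - exact: PM0.
  - rewrite -(PMG _ Ew) -(poisson_meanD nu ms (eta w) bG bD G0 D0).
    apply: (le_poisson_mean nu ms) => //; first exact: bounded_measurableD.
    by move=> mu; rewrite F0'/= -lerBlDl; exact: ler_norm.
  apply/andP; split.
    by apply: (lt_le_trans dl0); apply: (poisson_mean_ge nu ms) => //; exact: ltW.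
  rewrite -[leRHS](poisson_mean_cst nu ms (eta w) (le_trans (ltW m0) mM)).
  apply: (le_poisson_mean nu ms) => //; first exact: bounded_measurable_cst.
  by move=> mu; rewrite F0'/=; case/andP: (dFM mu).
rewrite (IPM (fun mu => F mu `^ p)%R)//; last by move=> mu; exact: powR_ge0.
have c0 : 0 <= (expR (fine (lambda A)))%:E :> \bar R by rewrite lee_fin expR_ge0.
apply: (@le_trans _ _ ((expR (fine (lambda A)))%:E * \int[P]_(w in E0)
    ((m `^ p)%:E + (K%:E * (PM D (eta w))%:E + (PM En (eta w))%:E)))).
  apply: lee_wpmul2l => //; apply: ge0_le_integral => //.
  - by move=> w _; rewrite lee_fin PM0// => mu; exact: powR_ge0.
  - by apply: mPM => // mu; exact: powR_ge0.
  - apply: emeasurable_funD => //; apply: emeasurable_funD; last exact: mPM.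
    by apply: emeasurable_funM => //; exact: mPM.
rewrite ge0_integralD//; last 3 first.
- by move=> w _; rewrite lee_fin powR_ge0.
- by move=> w _; rewrite -EFinM -EFinD lee_fin; apply: addr_ge0; [apply: mulr_ge0 => //|]; exact: PM0.
- apply: emeasurable_funD; last exact: mPM.
  by apply: emeasurable_funM => //; exact: mPM.
rewrite ge0_integralD//; last 4 first.
- by move=> w _; rewrite -EFinM lee_fin; apply: mulr_ge0 => //; exact: PM0.
- by apply: emeasurable_funM => //; exact: mPM.
- by move=> w _; rewrite lee_fin PM0.
- exact: mPM.
rewrite ge0_integralZl//; last 2 first.
- exact: mPM.
- by move=> w _; rewrite lee_fin PM0.
have JD : 0 <= \int[P]_(w in E0) (PM D (eta w))%:E.
  by apply: integral_ge0 => w _; rewrite lee_fin PM0.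
have JE : 0 <= \int[P]_(w in E0) (PM En (eta w))%:E.
  by apply: integral_ge0 => w _; rewrite lee_fin PM0.
have Jm : 0 <= \int[P]_(w in E0) (m `^ p)%:E.
  by apply: integral_ge0 => w _; rewrite lee_fin powR_ge0.
have JKD : 0 <= K%:E * \int[P]_(w in E0) (PM D (eta w))%:E by exact: mule_ge0.
rewrite (ge0_muleDr _ Jm (adde_ge0 JKD JE)) (ge0_muleDr _ JKD JE).
rewrite Icst muleCA -(IPM D)// -(IPM En)//.
rewrite addeA; apply: leeD; last first.
  apply: ge0_le_integral => //.
  - by move=> w _; rewrite lee_fin.
  - by apply/measurable_EFinP; apply: measurableT_comp => //; case: bEn.
  move=> w _; rewrite /En /bregman_energy EFin_Rintegral; last first.
    have bsh := bounded_measurable_bregman_shift ms p12 dl0 bF dF.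
    exact: (bounded_measurable_comp (pair2_measurable (eta w)) bsh).
  have mi : measurable_fun setT (fun x => energy_integrand (x, eta w)).
    exact: (measurableT_comp measurable_energy_integrand (pair2_measurable (eta w))).
  rewrite (ge0_integral_mrestr lambda mA mi)//.
  by apply: ge0_subset_integral.
apply: (@le_trans _ _ ((m `^ p)%:E + K%:E * e%:E)).
  by rewrite leeD2l//; apply: lee_wpmul2l; rewrite ?lee_fin.
rewrite -EFinM -EFinD lee_fin; move: mpf; rewrite -/K; lra.
Qed.

Theorem global_beckner :
  \int[P]_w (F (eta w) `^ p)%:E <=
  (fine (\int[P]_w (F (eta w))%:E) `^ p)%:E + \int[P]_w energy w.
Proof.
have M0 : (0 < M)%R by exact: lt_trans dlM.
have [A [AT ndA mA]] := (sigma_finiteP _ _).1 (sigma_finiteT lambda).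
have ndA' : {homo A : n m / (n <= m)%N >-> n `<=` m}.
  by move=> n m nm; apply/subsetPset; exact: ndA.
have K0 : (0 < p * M `^ (p - 1))%R by rewrite mulr_gt0 ?powR_gt0// (lt_le_trans _ p1).
apply/lee_addgt0Pr => e e0.
(* With this accuracy the error term of [local_error] is exactly [e]. *)
have e'0 : (0 < e / (2 * (p * M `^ (p - 1))))%R by rewrite divr_gt0// mulr_gt0.
have [n [G [bG dG lG FG]]] :=
  l1_approximation P meta (fun n => (mA n).1) ndA' (esym AT) mF dlM dFM e'0.
apply: le_trans (local_error (mA n).1 (mA n).2 bG dG lG FG) _.
rewrite EFinD -addeA [X in _ + X]addeC addeA leeD2l// lee_fin.
apply: le_of_eq.
by move: K0; set K := (p * _)%R => K0; field; rewrite gt_eqF.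
Qed.

End global_beckner.

(** * The recursive moment inequality *)

Lemma measurable_intensity_integral (h : X * config X R -> \bar R) :
  measurable_fun setT h -> (forall z, 0 <= h z) ->
  measurable_fun setT (fun w => \int[lambda]_x h (x, eta w)).
Proof.
move=> mh h0.
have := @measurable_fun_fubini_tonelli_G _ _ _ _ _ lambda _ mh h0.
by move=> /measurableT_comp; apply.
Qed.

Lemma measurable_intensity_section (h : X * config X R -> \bar R) mu :
  measurable_fun setT h -> measurable_fun setT (fun x => h (x, mu)).
Proof. by move=> mh; exact: (measurableT_comp mh (pair2_measurable mu)). Qed.

Implicit Types H : config X R -> R.

Definition decrease_sq H mu mu' : R := (Num.max (H mu - H mu') 0 ^+ 2)%R.

(* Unlike [diff_rem], the configurations [others kappa Z i w] are measurable in
   [w]; almost surely [others kappa Z i w] is [eta w] with the point [Z i w]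
   removed, see [vplus_ae]. *)
Definition vplus H w : \bar R :=
  \int[lambda]_x (decrease_sq H (eta w) (addp (eta w) x))%:E +
  \sum_(i <oo | i%:R%:E < kappa w) (decrease_sq H (eta w) (others kappa Z i w))%:E.

Lemma decrease_sq_ge0 H mu mu' : (0 <= decrease_sq H mu mu')%R.
Proof. by rewrite exprn_ge0// le_max lexx orbT. Qed.

Lemma measurable_decrease_sq H dT (T : measurableType dT) (f g : T -> config X R) :
  measurable_fun setT H -> measurable_fun setT f -> measurable_fun setT g ->
  measurable_fun setT (fun t => (decrease_sq H (f t) (g t))%:E).
Proof.
move=> mH mf mg; apply/measurable_EFinP; apply: measurable_funX.
apply: measurable_maxr; last exact: measurable_cst.
by apply: measurable_funB; exact: measurableT_comp.
Qed.

Let madd : measurable_fun setT (fun z : X * config X R => addp z.2 z.1).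
Proof. exact: measurable_add_point. Qed.

Lemma vplus_ge0 H w : 0 <= vplus H w.
Proof.
apply: adde_ge0; first by apply: integral_ge0 => x _; rewrite lee_fin decrease_sq_ge0.
by apply: nneseries_ge0 => i _ _; rewrite lee_fin decrease_sq_ge0.
Qed.

Lemma measurable_loss H : measurable_fun setT H ->
  measurable_fun setT
    (fun w => \int[lambda]_x (decrease_sq H (eta w) (addp (eta w) x))%:E).
Proof.
move=> mH; pose h (z : X * config X R) := (decrease_sq H z.2 (addp z.2 z.1))%:E.
apply: (measurable_intensity_integral (h := h)).
  by apply: measurable_decrease_sq => //; exact: measurable_snd.
by move=> z; rewrite lee_fin decrease_sq_ge0.
Qed.

Lemma measurable_gain H : measurable_fun setT H ->
  measurable_fun setT
    (fun w => \sum_(i <oo | i%:R%:E < kappa w) (decrease_sq H (eta w) (others kappa Z i w))%:E).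
Proof.
move=> mH; apply: (measurable_points_terms) => [i|i w]; last first.
  by rewrite lee_fin decrease_sq_ge0.
apply: measurable_decrease_sq => //.
exact: measurable_others eta_proper i.
Qed.

Lemma measurable_vplus H : measurable_fun setT H -> measurable_fun setT (vplus H).
Proof.
by move=> mH; apply: emeasurable_funD; [exact: measurable_loss|exact: measurable_gain].
Qed.

Lemma max_powR_sq (s t a : R) : (Num.max s t `^ a * (s - t) ^+ 2 =
  t `^ a * Num.max (t - s) 0 ^+ 2 + s `^ a * Num.max (s - t) 0 ^+ 2)%R.
Proof.
case: (leP s t) => st.
  rewrite (max_idPl _) ?subr_ge0// [X in (_ + _ * X ^+ 2)%R](max_idPr _) ?subr_le0//.
  by rewrite -(sqrrN (s - t)) opprB expr0n mulr0 addr0.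
rewrite (max_idPr _) ?subr_le0 ?ltW// [X in (_ + _ * X ^+ 2)%R](max_idPl _) ?subr_ge0 ?ltW//.
by rewrite expr0n mulr0 add0r.
Qed.

Theorem moment_step H (dl M q : R) : measurable_fun setT H -> (0 < dl)%R -> (dl < M)%R ->
  (forall mu, (dl <= H mu <= M)%R) -> (2 <= q)%R ->
  \int[P]_w (H (eta w) `^ q)%:E <=
  (fine (\int[P]_w (H (eta w) `^ (q - 1))%:E) `^ (q / (q - 1)))%:E +
  q%:E * \int[P]_w ((H (eta w) `^ (q - 2))%:E * vplus H w).
Proof.
move=> mH dl0 dlM dHM q2.
have q10 : (0 < q - 1)%R by lra.
have q0 : (0 <= q)%R by lra.
have H0 mu : (0 < H mu)%R by case/andP: (dHM mu) => + _; exact: lt_le_trans.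
pose p := (q / (q - 1))%R.
have p12 : (1 <= p <= 2)%R by rewrite /p ler_pdivlMr// ler_pdivrMr//; lra.
pose g mu := (H mu `^ (q - 1))%R.
have mg : measurable_fun setT g by exact: measurableT_comp (measurable_powR _) mH.
have dlq : (0 < dl `^ (q - 1))%R by rewrite powR_gt0.
have dMq : (dl `^ (q - 1) < M `^ (q - 1))%R.
  by apply: gt0_ltr_powR => //; rewrite ?nnegrE ltW//; exact: lt_trans dlM.
have dgM mu : (dl `^ (q - 1) <= g mu <= M `^ (q - 1))%R.
  have /andP[d1 d2] := dHM mu; have M0 : (0 <= M)%R by exact: ltW (lt_trans dl0 dlM).
  by apply/andP; split; apply: ge0_ler_powR => //; rewrite ?nnegrE ltW.
have bg : bounded_measurable g.
  split=> //; exists (M `^ (q - 1))%R => mu; rewrite ger0_norm ?powR_ge0//.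
  by case/andP: (dgM mu).
have dg mu : (dl `^ (q - 1) <= g mu)%R by case/andP: (dgM mu).
have [mb _] := bounded_measurable_bregman_shift measurable_addp p12 dlq bg dg.
have mbe : measurable_fun setT (fun z : X * config X R =>
    (bregman_power p (g (addp z.2 z.1)) (g z.2))%:E) by exact/measurable_EFinP.
have b0 mu mu' : (0 <= bregman_power p (g mu) (g mu'))%R.
  apply: bregman_power_ge0; first by case/andP: p12.
    exact: lt_le_trans (dg mu).
  exact: lt_le_trans (dg mu').
have := global_beckner p12 mg dlq dMq dgM.
have gp mu : (g mu `^ p = H mu `^ q)%R.
  by rewrite /g -powRrM /p mulrC divfK// gt_eqF.
under eq_integral do rewrite gp.
move=> /le_trans; apply; rewrite leeD2l//.
(* [h1] collects the points whose insertion lowers [H], where the larger value is that at [eta];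
   [h2] those whose insertion raises it. In [h2] the larger value belongs to the enlarged
   configuration, which the Mecke formula turns into [eta], so both parts end up with the weight
   [H (eta w) ^ (q - 2)]. *)
pose h1 (z : X * config X R) := ((H z.2 `^ (q - 2))%:E *
  (decrease_sq H z.2 (addp z.2 z.1))%:E).
pose h2 (z : X * config X R) := (H (addp z.2 z.1) `^ (q - 2) *
  decrease_sq H (addp z.2 z.1) z.2)%:E.
have mHp : measurable_fun setT (fun mu => H mu `^ (q - 2))%R.
  exact: measurableT_comp (measurable_powR _) mH.
have mh1 : measurable_fun setT h1.
  apply: emeasurable_funM.
    by apply/measurable_EFinP; exact: measurableT_comp mHp measurable_snd.
  by apply: measurable_decrease_sq => //; exact: measurable_snd.
have mh2 : measurable_fun setT h2.
  rewrite [h2](_ : _ = fun z => (H (addp z.2 z.1) `^ (q - 2))%:E *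
    (decrease_sq H (addp z.2 z.1) z.2)%:E)//.
  apply: emeasurable_funM; first by apply/measurable_EFinP; exact: (measurableT_comp mHp madd).
  by apply: measurable_decrease_sq => //; exact: measurable_snd.
have h10 z : 0 <= h1 z by rewrite mule_ge0// lee_fin ?powR_ge0 ?decrease_sq_ge0.
have h20 z : 0 <= h2 z by rewrite lee_fin mulr_ge0 ?powR_ge0 ?decrease_sq_ge0.
have I10 w : 0 <= \int[lambda]_x h1 (x, eta w) by exact: integral_ge0.
have I20 w : 0 <= \int[lambda]_x h2 (x, eta w) by exact: integral_ge0.
have mI1 := measurable_intensity_integral mh1 h10.
have mI2 := measurable_intensity_integral mh2 h20.
have S20 w : 0 <= \sum_(i <oo | i%:R%:E < kappa w) h2 (Z i w, others kappa Z i w).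
  exact: nneseries_ge0.
apply: (@le_trans _ _ (\int[P]_w (q%:E * (\int[lambda]_x h1 (x, eta w) +
    \int[lambda]_x h2 (x, eta w))))).
  apply: ge0_le_integral => //.
  - by move=> w _; apply: integral_ge0 => x _; rewrite lee_fin b0.
  - by apply: (measurable_intensity_integral mbe) => z; rewrite lee_fin b0.
  - by apply: emeasurable_funM => //; exact: emeasurable_funD.
  move=> w _; rewrite -ge0_integralD//; last 2 first.
  - exact: measurable_intensity_section.
  - exact: measurable_intensity_section.
  rewrite -ge0_integralZl//; last 2 first.
  - by apply: emeasurable_funD; exact: measurable_intensity_section.
  - by move=> x _; exact: adde_ge0.
  apply: ge0_le_integral => //.
  - by move=> x _; rewrite lee_fin b0.
  - exact: (measurable_intensity_section _ mbe).
  - apply: emeasurable_funM => //.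
    by apply: emeasurable_funD; exact: measurable_intensity_section.
  move=> x _; have := bregman_power_le q2 (H0 (addp (eta w) x)) (H0 (eta w)).
  by rewrite -lee_fin -mulrA max_powR_sq => /le_trans; apply; exact: lexx.
rewrite ge0_integralZl//; last 2 first.
- exact: emeasurable_funD.
- by move=> w _; exact: adde_ge0.
apply: lee_wpmul2l; first by rewrite lee_fin.
rewrite ge0_integralD// -(mecke_formula eta_poisson eta_proper mh2 h20).
rewrite -ge0_integralD//; last exact: (measurable_points_sum mh2 h20).
apply: le_of_eq; apply: ge0_ae_eq_integral => //.
- apply: emeasurable_funD => //; exact: (measurable_points_sum mh2 h20).
- apply: emeasurable_funM; last exact: measurable_vplus.
  by apply/measurable_EFinP; exact: (measurableT_comp mHp meta).
- by move=> w _; exact: adde_ge0.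
- by move=> w _; apply: mule_ge0; [rewrite lee_fin powR_ge0|exact: vplus_ge0].
have H1 := eta_others eta_proper.
near=> w => _.
have E1 : forall i, has_point kappa i w ->
    config_eq (eta w) (add_point (others kappa Z i w) (Z i w)) by near: w.
rewrite /vplus ge0_muleDr; last 2 first.
- by apply: integral_ge0 => x _; rewrite lee_fin decrease_sq_ge0.
- by apply: nneseries_ge0 => i _ _; rewrite lee_fin decrease_sq_ge0.
congr (_ + _).
  rewrite -ge0_integralZl// ?lee_fin ?powR_ge0//.
  - by apply: measurable_decrease_sq; [|exact: measurable_cst|exact: measurable_add_point_eta].
  - by move=> x _; rewrite lee_fin decrease_sq_ge0.
rewrite -nneseriesZl; last by move=> i _; rewrite lee_fin decrease_sq_ge0.
apply: eq_eseriesr => i ki; rewrite /h2/= -EFinM; congr (_ * _)%:E.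
  by congr (_ `^ _)%R; apply/esym; apply: config_eq_fun mH _ (E1 i ki) => r; exact: measurable_set1.
congr (Num.max (_ - _) _ ^+ 2)%R.
by apply/esym; apply: config_eq_fun mH _ (E1 i ki) => r; exact: measurable_set1.
Unshelve. all: by end_near. Qed.

(** * Variance and moment bounds for bounded functionals *)

Section bounded_functional.

Lemma le_vplus (F G : config X R -> R) :
  measurable_fun setT F -> measurable_fun setT G ->
  (forall mu mu', (Num.max (F mu - F mu') 0 <= Num.max (G mu - G mu') 0)%R) ->
  forall w, vplus F w <= vplus G w.
Proof.
move=> mF mG FG w.
have D mu mu' : (decrease_sq F mu mu' <= decrease_sq G mu mu')%R.
  by apply: lerXn2r; [rewrite nnegrE le_max lexx orbT|rewrite nnegrE le_max lexx orbT|exact: FG].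
apply: leeD.
  apply: ge0_le_integral => //.
  - by move=> x _; rewrite lee_fin decrease_sq_ge0.
  - by apply: measurable_decrease_sq; [|exact: measurable_cst|exact: measurable_add_point_eta].
  - by apply: measurable_decrease_sq; [|exact: measurable_cst|exact: measurable_add_point_eta].
  - by move=> x _; rewrite lee_fin.
apply: lee_nneseries => i _; first by move=> _; rewrite lee_fin decrease_sq_ge0.
by rewrite lee_fin.
Qed.

Variables (F : config X R -> R) (M : R).
Hypotheses (mF : measurable_fun setT F) (FM : forall mu, (`|F mu| <= M)%R).

Let a := fine (\int[P]_w (F (eta w))%:E).

Let bF : bounded_measurable (fun w => F (eta w)).
Proof. by split; [exact: measurableT_comp|exists M => w]. Qed.

Let IF : \int[P]_w (F (eta w))%:E = a%:E.
Proof. by rewrite -EFin_Rintegral. Qed.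

Let aM : (`|a| <= M)%R.
Proof.
rewrite -lee_fin -abse_EFin -IF.
apply: le_trans (le_abse_integral _ _ _) _ => //.
  by apply/measurable_EFinP; exact: measurableT_comp.
apply: (@le_trans _ _ (\int[P]_w M%:E)).
  apply: ge0_le_integral => //.
  - by apply: measurableT_comp => //; apply/measurable_EFinP; exact: measurableT_comp.
  - by move=> w _; rewrite lee_fin.
by rewrite integral_probability_cst.
Qed.

Let mV : measurable_fun setT (vplus F).
Proof. exact: measurable_vplus. Qed.

(** At [q = 2] the exponent [q / (q - 1)] is [2] and the weight in front of [vplus] is [1], so
    [moment_step] becomes a bound on the variance. *)
Theorem poincare_bounded :
  \int[P]_w ((F (eta w) - a) ^+ 2)%:E <= 2%:E * \int[P]_w vplus F w.
Proof.
(* A constant shift makes the functional at least [1] and changes neither its variance nor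
   [vplus]. *)
pose c := (M + 1)%R; pose H mu := (F mu + c)%R.
have mH : measurable_fun setT H by apply: measurable_funD => //; exact: measurable_cst.
have M0 : (0 <= M)%R by exact: le_trans (FM point).
have M1 : (1 < 2 * M + 2)%R by lra.
have HM mu : (1 <= H mu <= 2 * M + 2)%R.
  by have := FM mu; rewrite ler_norml /H /c; lra.
have h0 : (0 < a + c)%R by move: aM; rewrite ler_norml /c; lra.
have := moment_step mH ltr01 M1 HM (lexx 2%R).
have mHe : measurable_fun setT (fun w => (H (eta w))%:E).
  by apply/measurable_EFinP; exact: measurableT_comp.
have H0 w : (0 <= H (eta w))%R by case/andP: (HM (eta w)); lra.
have IH : \int[P]_w (H (eta w))%:E = (a + c)%:E.
  under eq_integral do rewrite /H EFinD.
  rewrite integralD//; last 2 first.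
  - exact: (bounded_measurable_integrable P bF).
  - exact: (bounded_measurable_integrable P (@bounded_measurable_cst _ Omega R c)).
  by rewrite IF integral_probability_cst.
have -> : \int[P]_w (H (eta w) `^ (2 - 1))%:E = (a + c)%:E.
  by rewrite -IH; apply: eq_integral => w _; rewrite (_ : 2 - 1 = 1)%R ?powRr1//; lra.
have -> : \int[P]_w ((H (eta w) `^ (2 - 2))%:E * vplus H w) = \int[P]_w vplus F w.
  apply: eq_integral => w _; rewrite subrr powRr0 mul1e.
  rewrite /vplus; congr (_ + _).
    by apply: eq_integral => x _; rewrite /decrease_sq /H opprD addrACA subrr addr0.
  by apply: eq_eseriesr => i _; rewrite /decrease_sq /H opprD addrACA subrr addr0.
rewrite (_ : 2 / (2 - 1) = 2 :> R)%R; last by rewrite -[X in (_ / (X - _))%R]/(1 + 1)%R addrK divr1.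
rewrite /= => H2.
have e2 (x : R) : (0 <= x -> x `^ 2 = x ^+ 2)%R by move=> x0; rewrite -powR_mulrn.
rewrite e2 ?(ltW h0)// in H2.
have E : \int[P]_w ((F (eta w) - a) ^+ 2)%:E + (2 * (a + c) ^+ 2)%:E =
    \int[P]_w (H (eta w) `^ 2)%:E + ((a + c) ^+ 2)%:E.
  have -> : ((2 * (a + c) ^+ 2)%:E = \int[P]_w ((2 * (a + c))%:E * (H (eta w))%:E))%E.
    rewrite ge0_integralZl ?lee_fin//; last by rewrite mulr_ge0// ltW.
      by rewrite IH -EFinM; congr EFin; ring.
    by move=> w _; rewrite lee_fin.
  have -> : (((a + c) ^+ 2)%:E = \int[P]_w ((a + c) ^+ 2)%:E)%E.
    by rewrite integral_probability_cst.
  rewrite -!ge0_integralD//.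
  - by apply: eq_integral => w _; rewrite e2// -EFinM -!EFinD /H; congr EFin; ring.
  - by move=> w _; rewrite lee_fin powR_ge0.
  - apply/measurable_EFinP; apply: measurableT_comp (measurable_powR _) _.
    exact: measurableT_comp.
  - by move=> w _; rewrite lee_fin sqr_ge0.
  - by move=> w _; rewrite lee_fin sqr_ge0.
  - apply/measurable_EFinP; apply: measurable_funX; apply: measurable_funB => //.
    exact: measurableT_comp.
  - by move=> w _; rewrite -EFinM lee_fin mulr_ge0// mulr_ge0// ltW.
  - exact: emeasurable_funM.
rewrite -(leeD2rE _ _ (_ : (2 * (a + c) ^+ 2)%:E \is a fin_num))// E.
apply: (le_trans (leeD2r _ H2)).
by rewrite addeAC -EFinD addeC leeD2l// lee_fin; lra.
Qed.

Variable r : R.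
Hypothesis r2 : (2 <= r)%R.

Let C := (moment_constant R ^+ 2)%R.

(** The floor [dl], the square root of [v], keeps [H] away from zero and does not increase [vplus].
    It also gives [H ^ 2 <= (F - a) ^ 2 + v], so the second moment of [H] is at most [2 v + v],
    which starts the induction on moments. *)
Lemma upper_moment_level (v : R) : (0 < v)%R ->
  \int[P]_w (vplus F w `^ (r / 2)) <= (v `^ (r / 2))%:E ->
  \int[P]_w (Num.max (F (eta w) - a) 0 `^ r)%:E <= ((C * r * v) `^ (r / 2))%:E.
Proof.
move=> v0 Vv; pose dl := Num.sqrt v; have dl0 : (0 < dl)%R by rewrite sqrtr_gt0.
pose H (mu : config X R) : R := Num.max (F mu - a)%R dl.
have mH : measurable_fun setT H.
  apply: measurable_maxr; last exact: measurable_cst.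
  by apply: measurable_funB => //; exact: measurable_cst.
have M0 : (0 <= M)%R by exact: le_trans (FM point).
have dlM : (dl < 2 * M + dl + 1)%R by lra.
have HM mu : (dl <= H mu <= 2 * M + dl + 1)%R.
  rewrite le_max lexx orbT/= ge_max; have := FM mu; have := aM.
  by rewrite !ler_norml; lra.
have VHF w : vplus H w <= vplus F w.
  apply: le_vplus => // mu mu'; rewrite /H ge_max le_max le_max lexx !orbT andbT.
  by case: (leP (F mu - a)%R dl) => h1; case: (leP (F mu' - a)%R dl) => h2; lra.
have mHeta : measurable_fun setT (fun w => H (eta w)) by exact: measurableT_comp.
have V0 w : 0 <= vplus F w by exact: vplus_ge0.
have HMeta w : (dl <= H (eta w) <= 2 * M + dl + 1)%R by exact: HM.
(* At exponent [2] and [B = 1] the integrated Young inequality is Jensen's: the moment of order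
   [r / 2] controls the mean. *)
have EV : \int[P]_w vplus F w <= v%:E.
  have := young_moment_integral mHeta dl0 HMeta mV V0 r2 v0 Vv (lexx 2%R) r2 ltr01.
  rewrite subrr; under eq_integral do rewrite powRr0 mul1e.
  move=> /le_trans; apply; rewrite lee_fin mul0r powRr0 divff//.
  by rewrite subrr mul0r add0r mulr1 mul1r.
have H2 : \int[P]_w (H (eta w) `^ 2)%:E <= (3 * v)%:E.
  have mFa : measurable_fun setT (fun w => ((F (eta w) - a) ^+ 2)%:E).
    apply/measurable_EFinP; apply: measurable_funX; apply: measurable_funB => //.
    exact: measurableT_comp.
  apply: (@le_trans _ _ (\int[P]_w (((F (eta w) - a) ^+ 2)%:E + v%:E))).
    apply: ge0_le_integral => //.
    - by move=> w _; rewrite lee_fin powR_ge0.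
    - by apply/measurable_EFinP; exact: measurableT_comp (measurable_powR _) mHeta.
    - exact: emeasurable_funD.
    move=> w _; have h0 : (0 <= H (eta w))%R.
      by rewrite /H le_max (ltW dl0) orbT.
    rewrite powR_mulrn// -EFinD lee_fin /H.
    case: (leP (F (eta w) - a)%R dl) => _; first by rewrite /dl sqr_sqrtr ?(ltW v0)// lerDr sqr_ge0.
    by rewrite lerDl ltW.
  rewrite ge0_integralD//; last 2 first.
  - by move=> w _; rewrite lee_fin sqr_ge0.
  - by move=> w _; rewrite lee_fin ltW.
  rewrite integral_probability_cst.
  have -> : (3 * v = 2 * v + v)%R by ring.
  rewrite EFinD leeD2r// EFinM (le_trans poincare_bounded)// lee_wpmul2l//.
have step (q : R) : (2 <= q)%R -> (q <= r)%R ->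
    \int[P]_w (H (eta w) `^ q)%:E <=
    (fine (\int[P]_w (H (eta w) `^ (q - 1))%:E) `^ (q / (q - 1)))%:E +
    q%:E * \int[P]_w ((H (eta w) `^ (q - 2))%:E * vplus F w).
  move=> q2 qr; apply: le_trans (moment_step mH dl0 dlM HM q2) _.
  rewrite leeD2l//; apply: lee_wpmul2l; first by rewrite lee_fin; lra.
  have mp : measurable_fun setT (fun w => (H (eta w) `^ (q - 2))%:E).
    by apply/measurable_EFinP; exact: measurableT_comp (measurable_powR _) mHeta.
  apply: ge0_le_integral => //.
  - by move=> w _; apply: mule_ge0; [rewrite lee_fin powR_ge0|exact: vplus_ge0].
  - apply: emeasurable_funM => //; exact: measurable_vplus.
  - exact: emeasurable_funM.
  - by move=> w _; apply: lee_wpmul2l => //; rewrite lee_fin powR_ge0.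
have r1 : (1 <= r)%R by rewrite (le_trans _ r2)// ler1n.
have r0 : (0 <= r)%R by exact: le_trans r2.
have mi := moment_induction mHeta dl0 HMeta mV V0 r2 v0 Vv H2 step (moment_constant_sqr R) r1 (lexx r).
have mf := moment_fin P mHeta dl0 HMeta r0.
apply: (@le_trans _ _ (\int[P]_w (H (eta w) `^ r)%:E)); last by rewrite -mf lee_fin; exact: mi.
apply: ge0_le_integral => //.
- by move=> w _; rewrite lee_fin powR_ge0.
- apply/measurable_EFinP; apply: measurableT_comp (measurable_powR _) _.
  apply: measurable_maxr; last exact: measurable_cst.
  by apply: measurable_funB => //; exact: measurableT_comp.
- by apply/measurable_EFinP; exact: measurableT_comp (measurable_powR _) mHeta.
move=> w _; rewrite lee_fin; apply: ge0_ler_powR => //.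
- by rewrite nnegrE le_max lexx orbT.
- by rewrite nnegrE /H le_max (ltW dl0) orbT.
by rewrite /H ge_max le_max lexx/= le_max (ltW dl0) orbT.
Qed.

Theorem upper_moment_bounded :
  \int[P]_w (Num.max (F (eta w) - a) 0 `^ r)%:E <=
  ((C * r) `^ (r / 2))%:E * \int[P]_w (vplus F w `^ (r / 2)).
Proof.
have r0 : (0 < r)%R by exact: lt_le_trans r2.
have C0 : (0 < C)%R.
  have /andP[s0 s1] := moment_ratio01 R.
  by rewrite /C moment_constant_sqr divr_gt0// subr_gt0.
have K0 : (0 < (C * r) `^ (r / 2))%R by rewrite powR_gt0// mulr_gt0.
have I0 : 0 <= \int[P]_w (vplus F w `^ (r / 2)).
  by apply: integral_ge0 => w _; exact: poweR_ge0.
have [Ifin|] := boolP (\int[P]_w (vplus F w `^ (r / 2)) \is a fin_num); last first.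
  by rewrite ge0_fin_numE// -leNgt leye_eq => /eqP ->; rewrite gt0_muley ?lte_fin// leey.
apply/lee_addgt0Pr => e e0.
(* The summand with [e] keeps [v] positive even if [vplus F] vanishes almost surely; its size is
   such that it contributes exactly [e] to the final bound. *)
pose t := (fine (\int[P]_w (vplus F w `^ (r / 2))) + e / (C * r) `^ (r / 2))%R.
have t0 : (0 < t)%R by rewrite ltr_wpDl ?fine_ge0// divr_gt0.
pose v := (t `^ (2 / r))%R; have v0 : (0 < v)%R by rewrite powR_gt0.
have vr : (v `^ (r / 2) = t)%R.
  rewrite /v -powRrM (_ : 2 / r * (r / 2) = 1)%R ?powRr1 ?ltW//.
  by field; rewrite gt_eqF.
have Vv : \int[P]_w (vplus F w `^ (r / 2)) <= (v `^ (r / 2))%:E.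
  by rewrite vr /t EFinD fineK// leeDl// lee_fin divr_ge0// ltW.
apply: le_trans (upper_moment_level v0 Vv) _.
rewrite powRM ?(ltW v0)//; last by rewrite mulr_ge0// ltW.
rewrite vr /t mulrDr EFinD EFinM fineK// leeD2l// lee_fin.
by rewrite mulrC divfK// gt_eqF.
Qed.

End bounded_functional.

(** * Removing boundedness by truncation *)

Section square_integrable_functional.

Variables (F : config X R -> R) (r : R).
Hypotheses (mF : measurable_fun setT F) (r2 : (2 <= r)%R).

Let mV : measurable_fun setT (vplus F).
Proof. exact: measurable_vplus. Qed.

Let mFeta : measurable_fun setT (fun w => F (eta w)).
Proof. exact: measurableT_comp. Qed.

Let r0 : (0 < r)%R. Proof. exact: lt_le_trans r2. Qed.

Let r21 : (1 <= r / 2)%R. Proof. by rewrite ler_pdivlMr// mul1r. Qed.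

Let J := \int[P]_w (vplus F w `^ (r / 2)).

Hypothesis Joo : J < +oo.

Let Fn (n : nat) (mu : config X R) := truncation n (F mu).

Let mFn n : measurable_fun setT (Fn n).
Proof. exact: (measurableT_comp (measurable_truncation n) mF). Qed.

Let mFne n : measurable_fun setT (fun w => Fn n (eta w)).
Proof. exact: measurableT_comp. Qed.

Let Fn_le n mu : (`|Fn n mu| <= n%:R)%R. Proof. exact: truncation_le. Qed.

Let an n := fine (\int[P]_w (Fn n (eta w))%:E).

Let VFn n w : vplus (Fn n) w <= vplus F w.
Proof. by apply: le_vplus => // mu mu'; exact: truncation_increment. Qed.

Let mVFn n : measurable_fun setT (vplus (Fn n)).
Proof. exact: measurable_vplus. Qed.

Let J0 : 0 <= J. Proof. by apply: integral_ge0 => w _; exact: poweR_ge0. Qed.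

Let Jfin : J \is a fin_num. Proof. by rewrite ge0_fin_numE. Qed.

Let K := (2 * (1 + fine J))%R.

Let K0 : (0 <= K)%R. Proof. by rewrite mulr_ge0// addr_ge0// fine_ge0. Qed.

Lemma le_1D_poweR (y : \bar R) (s : R) : (1 <= s)%R -> 0 <= y -> y <= 1 + y `^ s.
Proof.
move=> s1; case: y => [y| |]//; last first.
  by move=> _; rewrite poweRyr ?gt_eqF// (lt_le_trans _ s1).
rewrite lee_fin => y0; rewrite poweR_EFin -EFinD lee_fin.
have [y1|/ltW y1] := leP y 1%R; first by rewrite (le_trans y1)// lerDl powR_ge0.
rewrite (@le_trans _ _ (y `^ s)%R)//; last by rewrite lerDr.
by rewrite -[leLHS]powRr1// ler_powR.
Qed.

(** The bound is uniform in [n], since [vplus] of a truncation is at most [vplus F], which is at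
    most one plus its power of exponent [r / 2]. *)
Let variance_bound n : \int[P]_w ((Fn n (eta w) - an n) ^+ 2)%:E <= K%:E.
Proof.
apply: le_trans (poincare_bounded (mFn n) (Fn_le n)) _.
rewrite /K EFinM lee_wpmul2l//.
apply: (@le_trans _ _ (\int[P]_w (1 + vplus F w `^ (r / 2)))).
  apply: ge0_le_integral => //.
  - by move=> w _; exact: vplus_ge0.
  - apply: emeasurable_funD => //.
    exact: (measurableT_comp (measurable_poweR _) mV).
  - by move=> w _; rewrite (le_trans (VFn n w))// le_1D_poweR// vplus_ge0.
rewrite ge0_integralD//; last 2 first.
- by move=> w _; exact: poweR_ge0.
- exact: (measurableT_comp (measurable_poweR _) mV).
by rewrite integral_probability_cst EFinD fineK.
Qed.

Let B m := [set w | (`|F (eta w)| <= m%:R)%R].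

Let mB m : measurable (B m).
Proof.
rewrite -[X in measurable X]setTI; apply: measurable_fun_le => //.
  exact: measurableT_comp.
Qed.

Let positive_level : exists m, 0 < P (B m).
Proof.
apply: contrapT => /forallNP H.
have : P.-negligible (\bigcup_m B m).
  apply: negligible_bigcup => m; apply/negligibleP => //.
  by apply/eqP; rewrite eq_le measure_ge0 andbT leNgt; apply/negP/H.
rewrite (_ : \bigcup_m B m = setT); last first.
  apply/seteqP; split=> // w _; exists (Num.truncn `|F (eta w)|).+1 => //.
  by rewrite /B/= ltW// truncnS_gt.
move=> /negligibleP => /(_ measurableT)/eqP.
by rewrite [X in X == _]probability_setT onee_eq0.
Qed.

(** Bounded variances do not exclude diverging means. But [F] is bounded on an event of positive
    probability, and so are all its truncations; means far away would make the variances large on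
    that event. *)
Let mean_bound : exists L : R, forall n, (an n ^+ 2 <= L)%R.
Proof.
have [m Pm] := positive_level.
have Pmfin : P (B m) \is a fin_num by exact: fin_num_measure.
pose p := fine (P (B m)); have p0 : (0 < p)%R by rewrite -lte_fin fineK.
exists ((2 * m%:R ^+ 2 + 2 * K) / p)%R => n.
rewrite ler_pdivlMr// -lee_fin EFinM /p fineK//.
have mD : measurable_fun setT (fun w => ((Fn n (eta w) - an n) ^+ 2)%:E).
  by apply/measurable_EFinP; apply: measurable_funX; apply: measurable_funB.
rewrite -integral_cst//.
apply: (@le_trans _ _ (\int[P]_w ((2 * m%:R ^+ 2)%:E + 2%:E * ((Fn n (eta w) - an n) ^+ 2)%:E))).
  apply: (@le_trans _ _ (\int[P]_(w in B m) ((2 * m%:R ^+ 2)%:E +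
      2%:E * ((Fn n (eta w) - an n) ^+ 2)%:E))).
    apply: ge0_le_integral => //.
    - by move=> w _; rewrite lee_fin sqr_ge0.
    - apply: measurable_funTS; apply: emeasurable_funD => //.
      exact: emeasurable_funM.
    move=> w Bw; rewrite -EFinM -EFinD lee_fin.
    have := truncation_norm_le n (F (eta w)); rewrite -/(Fn n (eta w)) => H.
    have {}H : (Fn n (eta w) ^+ 2 <= m%:R ^+ 2)%R.
      rewrite -[leLHS]real_normK ?num_real// lerXn2r ?nnegrE//.
      exact: le_trans H Bw.
    by have := sqr_ge0 (2 * Fn n (eta w) - an n)%R; rewrite !expr2 in H *; nra.
  apply: ge0_subset_integral => //.
    by apply: emeasurable_funD => //; exact: emeasurable_funM.
  by move=> w _; rewrite -EFinM -EFinD lee_fin addr_ge0// mulr_ge0// sqr_ge0.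
rewrite ge0_integralD//; last 2 first.
- by move=> w _; rewrite mule_ge0// lee_fin sqr_ge0.
- exact: emeasurable_funM.
rewrite ge0_integralZl//; last by move=> w _; rewrite lee_fin sqr_ge0.
rewrite integral_probability_cst [leRHS]EFinD leeD2l//.
by rewrite [leRHS]EFinM lee_wpmul2l// variance_bound.
Qed.

(** Uniform bounds on the means and variances of the truncations bound their second moments, and
    Fatou's lemma passes this bound on to [F]. *)
Lemma functional_integrable : P.-integrable setT (EFin \o (F \o eta)).
Proof.
have [L aL] := mean_bound.
have mF2 : measurable_fun setT (fun w => (F (eta w) ^+ 2)%:E).
  by apply/measurable_EFinP; exact: measurable_funX.
have IF2 : \int[P]_w (F (eta w) ^+ 2)%:E <= (2 * K + 2 * L)%:E.
  apply: (@fatou_le _ _ _ _ _ (fun n w => Fn n (eta w) ^+ 2)%R).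
  - exact: measurable_funX.
  - by move=> n; exact: measurable_funX.
  - by move=> w; rewrite sqr_ge0.
  - by move=> n w; rewrite sqr_ge0.
  - move=> w e e0; near=> n; rewrite /Fn (_ : truncation n (F (eta w)) = F (eta w)) ?lerDl ?ltW//.
    by near: n; exact: near_truncation.
  move=> n; have mD : measurable_fun setT (fun w => ((Fn n (eta w) - an n) ^+ 2)%:E).
    by apply/measurable_EFinP; apply: measurable_funX; apply: measurable_funB.
  apply: (@le_trans _ _ (\int[P]_w (2%:E * ((Fn n (eta w) - an n) ^+ 2)%:E + (2 * an n ^+ 2)%:E))).
    apply: ge0_le_integral => //.
    - by move=> w _; rewrite lee_fin sqr_ge0.
    - by apply/measurable_EFinP; exact: measurable_funX.
    - by apply: emeasurable_funD => //; exact: emeasurable_funM.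
    move=> w _; rewrite -EFinM -EFinD lee_fin.
    by have := sqr_ge0 (Fn n (eta w) - 2 * an n)%R; rewrite !expr2; nra.
  rewrite ge0_integralD//; last 3 first.
  - by move=> w _; rewrite -EFinM lee_fin mulr_ge0// sqr_ge0.
  - exact: emeasurable_funM.
  - by move=> w _; rewrite lee_fin mulr_ge0// sqr_ge0.
  rewrite ge0_integralZl//; last by move=> w _; rewrite lee_fin sqr_ge0.
  rewrite integral_probability_cst [leRHS]EFinD leeD//.
    by rewrite [leRHS]EFinM lee_wpmul2l// variance_bound.
  by rewrite lee_fin ler_pM2l.
apply/integrableP; split; first exact/measurable_EFinP.
apply: (@le_lt_trans _ _ (\int[P]_w (1 + (F (eta w) ^+ 2)%:E))).
  apply: ge0_le_integral => //.
  - by apply: measurableT_comp => //; exact/measurable_EFinP.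
  - exact: emeasurable_funD.
  move=> w _; rewrite /= -EFinD lee_fin.
  have := sqr_ge0 (`|F (eta w)| - 1)%R; rewrite -[X in (1 + X)%R]real_normK ?num_real//.
  by have := normr_ge0 (F (eta w)); rewrite !expr2; nra.
rewrite ge0_integralD//; last by move=> w _; rewrite lee_fin sqr_ge0.
rewrite integral_probability_cst.
by apply: lte_add_pinfty; rewrite ?ltry// (le_lt_trans IF2)// ltry.
Unshelve. all: by end_near. Qed.

Let a := fine (\int[P]_w (F (eta w))%:E).

Let cvg_an : an n @[n --> \oo] --> a.
Proof.
have iF := functional_integrable.
have [] := @dominated_convergence _ _ _ P setT measurableT (fun n w => (Fn n (eta w))%:E)
  (fun w => (F (eta w))%:E) (fun w => `|(F (eta w))%:E|).
- by move=> n; exact/measurable_EFinP.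
- exact/measurable_EFinP.
- apply: aeW => w _; apply: cvg_near_cst; near=> n; congr EFin.
  by near: n; exact: near_truncation.
- exact: integrable_abse iF.
- by apply: aeW => w n _; rewrite lee_fin; exact: truncation_norm_le.
move=> _ _ H; apply: fine_cvg; rewrite fineK//; exact: integrable_fin_num.
Unshelve. all: by end_near. Qed.

Let C := (moment_constant R ^+ 2)%R.

Theorem upper_moment :
  \int[P]_w (Num.max (F (eta w) - a) 0 `^ r)%:E <= ((C * r) `^ (r / 2))%:E * J.
Proof.
apply: (@fatou_le _ _ _ _ _ (fun n w => Num.max (Fn n (eta w) - an n) 0 `^ r)%R).
- apply: measurableT_comp (measurable_powR _) _.
  by apply: measurable_maxr => //; apply: measurable_funB.
- move=> n; apply: measurableT_comp (measurable_powR _) _.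
  by apply: measurable_maxr => //; apply: measurable_funB.
- by move=> w; exact: powR_ge0.
- by move=> n w; exact: powR_ge0.
- move=> w e e0; set y := Num.max (F (eta w) - a)%R 0%R.
  have [->|yn0] := eqVneq y 0%R.
    by apply: nearW => n; rewrite powR0 ?gt_eqF// addr_ge0 ?powR_ge0// ltW.
  have y0 : (0 < y)%R by rewrite lt0r yn0/= le_max lexx orbT.
  have k0 : (0 < r * y `^ (r - 1))%R by rewrite mulr_gt0// powR_gt0.
  (* The first bound keeps the shifted value [yn] positive; with the second, the tangent of the
     power [r] at [y] loses at most [e]. *)
  pose e' : R := Num.min (y / 2)%R (e / (r * y `^ (r - 1)))%R.
  have e'0 : (0 < e')%R by rewrite lt_min !divr_gt0.
  have /cvgrPdist_le /(_ _ e'0) near1 := cvg_an.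
  have near2 := near_truncation (F (eta w)).
  near=> n; rewrite /Fn (_ : truncation n (F (eta w)) = F (eta w)); last by near: n.
  have H : (`|a - an n| <= e')%R by near: n.
  set yn := Num.max (F (eta w) - an n)%R 0%R.
  have yyn : (y - e' <= yn)%R.
    move: H; rewrite ler_norml /y /yn => /andP[H1 H2].
    by move: e'0; case: (leP (F (eta w) - a)%R 0%R) => h1; case: (leP (F (eta w) - an n)%R 0%R) => h2; lra.
  have [e'1 e'2] : (e' <= y / 2 /\ e' <= e / (r * y `^ (r - 1)))%R.
    by rewrite /e' !ge_min !lexx orbT.
  have yn1 : (0 < yn)%R by lra.
  have r1 : (1 <= r)%R by rewrite (le_trans _ r2)// ler1n.
  have := powR_bernoulli r1 y0 yn1.
  have : (- e <= r * y `^ (r - 1) * (yn - y))%R.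
    apply: (@le_trans _ _ (r * y `^ (r - 1) * - e')%R).
      rewrite mulrN lerN2; move: e'2; rewrite ler_pdivlMr//; rewrite mulrC; exact.
    by rewrite ler_pM2l//; lra.
  move: (y `^ r)%R (yn `^ r)%R (r * y `^ (r - 1) * (yn - y))%R => *; lra.
move=> n; have := upper_moment_bounded (mFn n) (Fn_le n) r2.
move=> /le_trans; apply; apply: lee_wpmul2l; first by rewrite lee_fin powR_ge0.
apply: ge0_le_integral => //.
- by move=> w _; exact: poweR_ge0.
- exact: (measurableT_comp (measurable_poweR _) (mVFn n)).
- exact: (measurableT_comp (measurable_poweR _) mV).
move=> w _; apply: gt0_ler_poweR; last exact: VFn.
- exact: le_trans r21.
- by rewrite in_itv/= leey andbT vplus_ge0.
- by rewrite in_itv/= leey andbT vplus_ge0.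
Unshelve. all: by end_near. Qed.

End square_integrable_functional.

(** * Almost sure identification of the difference operators *)

Section difference_operators_ae.
Variable F : config X R -> R.
Hypothesis mF : measurable_fun setT F.

(** Almost surely an existing point [Z i w] carries mass in [eta w], so [diff_rem] takes its first
    branch; the two ways of removing the point agree on measurable sets, which is all that [F] can
    see. *)
Lemma diff_rem_others : {ae P, forall w i, has_point kappa i w ->
  diff_rem F (Z i w) (eta w) = (F (eta w) - F (others kappa Z i w))%R}.
Proof.
apply: filterS (eta_others eta_proper) => w H i ki; have E := H i ki.
rewrite /diff_rem; case: pselect => [h|nh].
  congr (_ - _)%R; apply: config_eq_fun mF _ _ => [x|B mB]; first exact: measurable_set1.
  by rewrite (Defs.remE h mB : remove_point h B = _) E// add_pointE// addeK.
exfalso; apply: nh => B mB; rewrite E// add_pointE//.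
by rewrite leeDr.
Qed.

Lemma vplus_ae : {ae P, forall w,
  \int[lambda]_x ((Num.max (- diff_add F x (eta w)) 0) ^+ 2)%:E +
  points_integral (kappa w) (Z ^~ w)
    (fun x => ((Num.max (diff_rem F x (eta w)) 0) ^+ 2)%:E) = vplus F w}.
Proof.
apply: filterS diff_rem_others => w H; rewrite /vplus; congr (_ + _).
  by apply: eq_integral => x _; rewrite /decrease_sq /diff_add opprB.
by apply: eq_eseriesr => i ki; rewrite H.
Qed.

(** A square is the sum of the squares of the positive and negative parts, and the negative part of
    an increment of [F] is the positive part of that of [- F]. *)
Lemma vplusD_ae : {ae P, forall w,
  \int[lambda]_x ((diff_add F x (eta w)) ^+ 2)%:E +
  points_integral (kappa w) (Z ^~ w) (fun x => ((diff_rem F x (eta w)) ^+ 2)%:E) =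
  vplus F w + vplus (fun mu => - F mu)%R w}.
Proof.
have mN : measurable_fun setT (fun mu => - F mu)%R by exact: measurableT_comp.
have D mu mu' : ((F mu - F mu') ^+ 2 =
    decrease_sq F mu mu' + decrease_sq (fun mu => - F mu) mu mu')%R.
  rewrite /decrease_sq opprK [in X in (_ + X ^+ 2)%R]addrC.
  have := max_powR_sq (F mu') (F mu) 0; rewrite !powRr0 !mul1r => <-.
  by rewrite -sqrrN opprB.
apply: filterS diff_rem_others => w H; rewrite /vplus addeACA; congr (_ + _).
  rewrite -ge0_integralD//.
  - by apply: eq_integral => x _; rewrite -EFinD -D /diff_add -sqrrN opprB.
  - by move=> x _; rewrite lee_fin decrease_sq_ge0.
  - by apply: measurable_decrease_sq; [|exact: measurable_cst|exact: measurable_add_point_eta].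
  - by move=> x _; rewrite lee_fin decrease_sq_ge0.
  - by apply: measurable_decrease_sq; [|exact: measurable_cst|exact: measurable_add_point_eta].
rewrite -nneseriesD; last 2 first.
- by move=> i _; rewrite lee_fin decrease_sq_ge0.
- by move=> i _; rewrite lee_fin decrease_sq_ge0.
by apply: eq_eseriesr => i ki; rewrite -EFinD -D H.
Qed.

End difference_operators_ae.

End poisson_functional.

Lemma LnormE d (T : measurableType d) (R : realType) (mu : {measure set T -> \bar R})
    (f : T -> \bar R) (r : R) :
  'N[mu]_r%:E[f] = (\int[mu]_t (`|f t| `^ r)) `^ r^-1.
Proof. by rewrite unlock. Qed.

Lemma Lnorm_sqrte d (T : measurableType d) (R : realType)
    (mu : {measure set T -> \bar R}) (W : T -> \bar R) (r : R) : (forall t, 0 <= W t) ->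
  'N[mu]_r%:E[(fun t => sqrte (W t))] = (\int[mu]_t (W t `^ (r / 2))) `^ r^-1.
Proof.
move=> W0; rewrite LnormE; congr (_ `^ _); apply: eq_integral => t _.
by rewrite gee0_abs ?sqrte_ge0// -poweR12_sqrt// -poweRrM mulrC.
Qed.

Lemma le_moment_root (R : realType) (r : R) (I J : \bar R) : (0 < r)%R -> 0 <= I -> 0 <= J ->
  I <= ((moment_constant R ^+ 2 * r) `^ (r / 2))%:E * J ->
  I `^ r^-1 <= (moment_constant R * Num.sqrt r)%:E * J `^ r^-1.
Proof.
move=> r0 I0 J0 IJ.
have D0 : (0 <= moment_constant R)%R by exact: sqrtr_ge0.
have rK : (r / 2 * r^-1 = 2^-1)%R by field; rewrite gt_eqF.
rewrite (_ : (moment_constant R * Num.sqrt r)%:E =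
    ((moment_constant R ^+ 2 * r) `^ (r / 2))%:E `^ r^-1); last first.
  rewrite poweR_EFin -powRrM rK powR12_sqrt; last by apply: mulr_ge0; [exact: sqr_ge0|exact: ltW].
  by rewrite sqrtrM ?sqr_ge0// sqrtr_sqr ger0_norm.
rewrite -poweRM ?lee_fin ?powR_ge0//.
apply: gt0_ler_poweR => //; first by rewrite invr_ge0 ltW.
  by rewrite in_itv/= I0 leey.
by rewrite in_itv/= leey andbT mule_ge0// lee_fin powR_ge0.
Qed.

Lemma lty_moment_root (R : realType) (c r : R) (J : \bar R) : (0 < c)%R -> (0 < r)%R ->
  c%:E * J `^ r^-1 < +oo -> J < +oo.
Proof.
move=> c0 r0 H; have ri : (r^-1 != 0)%R by rewrite gt_eqF// invr_gt0.
apply: (lty_poweRy ri); rewrite ltey; apply/eqP => E; move: H.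
by rewrite E gt0_muley ?lte_fin// ltxx.
Qed.

Theorem proposition4p18 (R : realType)
    (d : measure_display) (X : measurableType d)
    (dO : measure_display) (Omega : measurableType dO)
    (P : probability Omega R)
    (lambda : {sigma_finite_measure set X -> \bar R})
    (eta : Omega -> config X R)
    (kappa : Omega -> \bar R) (Z : nat -> Omega -> X)
    (eta_poisson : poisson_process P lambda eta)
    (eta_proper : proper_representation P eta kappa Z)
    (F : config X R -> R) (mF : measurable_fun setT F)
    (r : R) (r_ge2 : (2 <= r)%R) :
  let centered := fun w => (F (eta w))%:E - 'E_P[F \o eta] in
  let V := fun w =>
    \int[lambda]_x ((diff_add F x (eta w)) ^+ 2)%:E +
    points_integral (kappa w) (Z ^~ w)
      (fun x => ((diff_rem F x (eta w)) ^+ 2)%:E) in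
  let Vplus := fun w =>
    \int[lambda]_x ((Num.max (- diff_add F x (eta w)) 0) ^+ 2)%:E +
    points_integral (kappa w) (Z ^~ w)
      (fun x => ((Num.max (diff_rem F x (eta w)) 0) ^+ 2)%:E) in
  let bound := fun W : Omega -> \bar R =>
    (moment_constant R * Num.sqrt r)%:E * 'N[P]_r%:E [(fun w => sqrte (W w))] in
  (bound V < +oo ->
    P.-integrable setT (EFin \o (F \o eta)) /\
    'N[P]_r%:E [centered] <= bound V) /\
  (bound Vplus < +oo ->
    P.-integrable setT (EFin \o (F \o eta)) /\
    'N[P]_r%:E [(fun w => maxe (centered w) 0)] <= bound Vplus).
Proof.
move=> centered V Vplus bound.
have r0 : (0 < r)%R by exact: lt_le_trans r_ge2.
have r20 : (0 <= r / 2)%R by rewrite divr_ge0// ltW.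
have r21 : (1 <= r / 2)%R by rewrite ler_pdivlMr// mul1r.
have meta : measurable_fun setT eta by case: eta_poisson.
have mFeta : measurable_fun setT (F \o eta) by exact: measurableT_comp.
pose NF mu := (- F mu)%R; have mNF : measurable_fun setT NF by exact: measurableT_comp.
pose U := vplus lambda eta kappa Z.
have mU G : measurable_fun setT G -> measurable_fun setT (U G).
  exact: (measurable_vplus eta_poisson eta_proper).
have U0 G w : 0 <= U G w by exact: vplus_ge0.
have mUr G : measurable_fun setT G -> measurable_fun setT (fun w => U G w `^ (r / 2)).
  by move=> mG; exact: (measurableT_comp (measurable_poweR _) (mU _ mG)).
have [V0 Vplus0] : (forall w, 0 <= V w) /\ (forall w, 0 <= Vplus w).
  split=> w; (apply: adde_ge0;
    [apply: integral_ge0 => x _|apply: nneseries_ge0 => i _ _]); by rewrite lee_fin sqr_ge0.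
have c0 : (0 < moment_constant R * Num.sqrt r)%R.
  apply: mulr_gt0; last by rewrite sqrtr_gt0.
  rewrite lt0r sqrtr_ge0 andbT -sqrf_eq0 moment_constant_sqr.
  by have /andP[_ s1] := moment_ratio01 R; rewrite mulf_neq0// invr_neq0// gt_eqF// subr_gt0.
have poweR_mono (x y : \bar R) : 0 <= x -> x <= y -> x `^ (r / 2) <= y `^ (r / 2).
  move=> x0 xy; apply: gt0_ler_poweR => //; rewrite in_itv/= leey andbT//.
  exact: le_trans xy.
have Efine : P.-integrable setT (EFin \o (F \o eta)) ->
    'E_P[F \o eta] = (fine (\int[P]_w (F (eta w))%:E))%:E.
  by move=> iF; rewrite unlock fineK//; exact: integrable_fin_num iF.
have mmax (a : R) (G : config X R -> R) : measurable_fun setT G ->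
    measurable_fun setT (fun w => (Num.max (G (eta w) - a) 0 `^ r)%:E).
  move=> mG; apply/measurable_EFinP; apply: measurableT_comp (measurable_powR _) _.
  apply: measurable_maxr => //; apply: measurable_funB => //.
  exact: measurableT_comp.
split; rewrite /bound (Lnorm_sqrte P r) // => boundW.
- have Woo := lty_moment_root c0 r0 boundW.
  have UW : \int[P]_w ((U F w + U NF w) `^ (r / 2)) <= \int[P]_w (V w `^ (r / 2)).
    apply: ae_le_lower_integral.
    + by apply: (measurableT_comp (measurable_poweR _)); apply: emeasurable_funD; exact: mU.
    + by move=> w; exact: poweR_ge0.
    + by move=> w; exact: poweR_ge0.
    + by apply: filterS (vplusD_ae lambda eta_proper mF) => w E; rewrite /V E.
  (* Superadditivity of the power [r / 2 >= 1] makes the two one-sided moments add up to at most the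
     two-sided one, so the first inequality has the same constant as the second. *)
  have UFNF : \int[P]_w (U F w `^ (r / 2)) + \int[P]_w (U NF w `^ (r / 2)) <=
      \int[P]_w (V w `^ (r / 2)).
    apply: le_trans UW; rewrite -ge0_integralD//; last 4 first.
    + by move=> w _; exact: poweR_ge0.
    + exact: mUr.
    + by move=> w _; exact: poweR_ge0.
    + exact: mUr.
    apply: ge0_le_integral => //.
    + by move=> w _; rewrite adde_ge0// poweR_ge0.
    + by apply: emeasurable_funD; exact: mUr.
    + by apply: (measurableT_comp (measurable_poweR _)); apply: emeasurable_funD; exact: mU.
    + by move=> w _; exact: superadditive_poweR.
  have I0 G : 0 <= \int[P]_w (U G w `^ (r / 2)).
    by apply: integral_ge0 => w _; exact: poweR_ge0.
  have JF : \int[P]_w (U F w `^ (r / 2)) < +oo.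
    by apply: le_lt_trans Woo; apply: le_trans UFNF; rewrite leeDl.
  have JNF : \int[P]_w (U NF w `^ (r / 2)) < +oo.
    by apply: le_lt_trans Woo; apply: le_trans UFNF; rewrite leeDr.
  have iF := functional_integrable eta_poisson eta_proper mF r_ge2 JF.
  split => //; rewrite LnormE; apply: le_moment_root => //.
  + by apply: integral_ge0 => w _; exact: poweR_ge0.
  + by apply: integral_ge0 => w _; exact: poweR_ge0.
  set a := fine (\int[P]_w (F (eta w))%:E).
  have aN : fine (\int[P]_w (NF (eta w))%:E) = (- a)%R.
    by rewrite /NF; under eq_integral do rewrite EFinN; rewrite integralN ?fineN//;
      exact: integrable_add_def iF.
  have H1 := upper_moment eta_poisson eta_proper mF r_ge2 JF.
  have H2 := upper_moment eta_poisson eta_proper mNF r_ge2 JNF.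
  rewrite aN in H2.
  (* At each [w] one of the two positive parts vanishes, so the absolute moment is the sum of the
     one-sided moments of [F] and [- F]. *)
  apply: (@le_trans _ _ (\int[P]_w (Num.max (F (eta w) - a) 0 `^ r)%:E +
      \int[P]_w (Num.max (NF (eta w) - (- a)) 0 `^ r)%:E)).
    rewrite -ge0_integralD//; last 4 first.
    * by move=> w _; rewrite lee_fin powR_ge0.
    * exact: mmax.
    * by move=> w _; rewrite lee_fin powR_ge0.
    * exact: mmax.
    apply: le_of_eq; apply: eq_integral => w _.
    rewrite /centered Efine// -/a -EFinB abse_EFin poweR_EFin -EFinD; congr EFin.
    rewrite /NF -opprD; set y := (F (eta w) - a)%R.
    case: (leP 0%R y) => y0.
      by rewrite (max_idPr _) ?oppr_le0// powR0 ?gt_eqF// addr0 ger0_norm.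
    by rewrite (max_idPl _) ?oppr_ge0 ?ltW// powR0 ?gt_eqF// add0r ltr0_norm.
  rewrite -/a -/U in H1; rewrite -/U in H2.
  have K0 : 0 <= ((moment_constant R ^+ 2 * r) `^ (r / 2))%:E by rewrite lee_fin powR_ge0.
  move: K0 H1 H2; move: (_ `^ (r / 2))%:E => K K0 H1 H2.
  apply: (le_trans (leeD H1 H2)); rewrite -(ge0_muleDr _ (I0 F) (I0 NF)).
  exact: lee_wpmul2l.
have Woo := lty_moment_root c0 r0 boundW.
have UW : \int[P]_w (U F w `^ (r / 2)) <= \int[P]_w (Vplus w `^ (r / 2)).
  apply: ae_le_lower_integral.
  - exact: mUr.
  - by move=> w; exact: poweR_ge0.
  - by move=> w; exact: poweR_ge0.
  - by apply: filterS (vplus_ae lambda eta_proper mF) => w E; rewrite /Vplus E.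
have JF : \int[P]_w (U F w `^ (r / 2)) < +oo by exact: le_lt_trans Woo.
have iF := functional_integrable eta_poisson eta_proper mF r_ge2 JF.
split => //; rewrite LnormE; apply: le_moment_root => //.
- by apply: integral_ge0 => w _; exact: poweR_ge0.
- by apply: integral_ge0 => w _; exact: poweR_ge0.
have H1 := upper_moment eta_poisson eta_proper mF r_ge2 JF.
apply: (@le_trans _ _ (((moment_constant R ^+ 2 * r) `^ (r / 2))%:E *
    \int[P]_w (U F w `^ (r / 2)))); last by apply: lee_wpmul2l => //; rewrite lee_fin powR_ge0.
apply: le_trans H1; apply: le_of_eq.
apply: eq_integral => w _; rewrite /centered Efine// -EFinB.
by rewrite -EFin_max abse_EFin poweR_EFin ger0_norm// le_max lexx orbT.
Qed.
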